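(* For every $\alpha>0$, the reflection coefficient $R(\theta)$ of the equation $u''+(1+\theta x_+^\alpha)u=0$ on $\mathbb{R}$ satisfies, as $\theta\to 0^+$, \[ R(\theta)=\frac{\Gamma(\alpha+1)}{(2i)^{\alpha+2}}\,\theta+O\!\left(\theta^{1+\min\left(\frac1\alpha,1\right)}\right). \]
   Context: Here $x_+=\max(x,0)$, $\Gamma$ is the Euler Gamma function, and $i^{s}=e^{i\pi s/2}$, so $(2i)^{s}=2^{s}e^{i\pi s/2}$. The exponent $\alpha>0$ is fixed (not necessarily an integer), $\theta>0$ is a parameter, and the constant in $O(\cdot)$ may depend on $\alpha$. Origin of the parameter: consider the acoustic wave equation $(c^{-2}(\mathbf{x})\partial_t^2-\Delta_{\mathbf{x}})u=0$ in $\mathbb{R}^3$ with $c^{-2}(\mathbf{x})=c_0^{-2}[1+(x_1/\ell)_+^\alpha]$, $\ell>0$, time dependence $e^{i\omega t}$, and an incident plane wave with wave vector $(k_1,k_2,k_3)=\frac{\omega}{c_0}(\sqrt{1-\eta^2},\eta_2,\eta_3)$, $\eta^2=\eta_2^2+\eta_3^2<1$. After Fourier transform in $t,x_2,x_3$ and the rescaling $x_1=\frac{c_0}{\omega}(1-\eta^2)^{-1/2}x$, one gets $u''+c^{-2}(x)u=0$ on $\mathbb{R}$ with $c^{-2}(x)=1+\theta x_+^\alpha$ and $\theta=\left(\frac{c_0}{\ell\omega}\right)^{\alpha}(1-\eta^2)^{-\frac{\alpha+2}{2}}$. Outgoing solutions: a nonzero solution $u$ of $u''+c^{-2}(x)u=0$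 on $\mathbb{R}$ is outgoing to $+\infty$ if there is a sequence of solutions $u(\cdot;\sigma)$ of $u''+(1+i\sigma)^2c^{-2}(x)u=0$, with real $\sigma<0$ tending to $0$, such that $u(x;\sigma)\to u(x)$ as $\sigma\to0^-$ uniformly on compact sets of $x\in\mathbb{R}$ and, for each such $\sigma$, $\lim_{x\to+\infty}u(x;\sigma)=0$. Such solutions, together with $0$, form a one-dimensional space. Reflection coefficient: let $u$ be a (nonzero) solution outgoing to $+\infty$, and write $u(x)=A\,e^{ix}+B\,e^{-ix}$ for $x<0$. Then $R(\theta)=A/B$; it does not depend on the normalization of $u$. (Here $e^{-ix}$ is the incident wave, coming from $-\infty$, and $e^{ix}$ the reflected wave.) *)

(* Defs.v *)
From Stdlib Require Import Reals.
From Coquelicot Require Import Coquelicot.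
Open Scope R_scope.

(* [Rpower 0 a] is 1 in the standard library, hence the case distinction. *)
Definition pos_part_pow (x alpha : R) : R :=
  if Rlt_dec 0 x then Rpower x alpha else 0.

Definition slowness2 (alpha theta x : R) : R := 1 + theta * pos_part_pow x alpha.

(* exp (i t) *)
Definition cis (t : R) : C := (cos t, sin t).

(* (2i)^s = 2^s exp (i pi s / 2) *)
Definition pow_2i (s : R) : C := (RtoC (Rpower 2 s) * cis (PI * s / 2))%C.

(* Euler's integral; used only for s > 0, where it converges. *)
Definition Gamma (s : R) : R :=
  RInt_gen (fun t => Rpower t (s - 1) * exp (- t))
           (at_right 0) (Rbar_locally p_infty).

(* u'' + k^2 q u = 0 on the whole line. [C_R_NormedModule] is C as a real
   normed space; the canonical structure on C would be the complex one. *)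
Definition is_solution (k : C) (q : R -> R) (u : R -> C) : Prop :=
  exists du ddu : R -> C,
    (forall x, is_derive (V := C_R_NormedModule) u x (du x)) /\
    (forall x, is_derive (V := C_R_NormedModule) du x (ddu x)) /\
    (forall x, (ddu x + k * k * RtoC (q x) * u x)%C = RtoC 0).

Definition cvg_uniformly_on_compacts (U : nat -> R -> C) (u : R -> C) : Prop :=
  forall K : R -> Prop, compact K ->
  forall eps : R, 0 < eps ->
  eventually (fun n => forall x, K x -> Cmod (U n x - u x)%C < eps).

Definition outgoing (q : R -> R) (u : R -> C) : Prop :=
  is_solution (RtoC 1) q u /\
  (exists x, u x <> RtoC 0) /\
  exists (sigma : nat -> R) (U : nat -> R -> C),
    (forall n, sigma n < 0) /\
    is_lim_seq sigma 0 /\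
    (forall n, is_solution (RtoC 1 + Ci * RtoC (sigma n))%C q (U n)) /\
    cvg_uniformly_on_compacts U u /\
    (forall n, filterlim (U n) (Rbar_locally p_infty) (locally (RtoC 0))).

Definition is_reflection (alpha theta : R) (r : C) : Prop :=
  exists (u : R -> C) (A B : C),
    outgoing (slowness2 alpha theta) u /\
    (forall x, x < 0 -> u x = (A * cis x + B * cis (- x))%C) /\
    B <> RtoC 0 /\
    r = (A / B)%C.

(* By [iota_correct], this is the reflection coefficient as soon as
   [is_reflection alpha theta] holds of exactly one complex number. *)
Definition reflection (alpha theta : R) : C :=
  iota (T := CompleteNormedModule.CompleteSpace _ C_R_CompleteNormedModule) (is_reflection alpha theta).

(* Main.v *)
Require Import Defs.
From Stdlib Require Import Reals Lra Lia ClassicalEpsilon.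
From Coquelicot Require Import Coquelicot.
Open Scope R_scope.

(* Put P(x) = a + b x_+^alpha. If some unit complex number w has Re w > 0 and
   Re (w P) > 0 on x >= 0, then Re (w v' conj v) is increasing along solutions
   of v'' = P v, and there is exactly one decaying solution with v(0) = 1 (a
   shrinking Weyl disc argument), with bounds depending only on the coercivity
   constants. Replacing x by exp(-i phi) x turns (a, b) into
   (exp(-2 i phi) a, exp(-i (alpha + 2) phi) b) and v'(0) into exp(-i phi) v'(0).
   For the damped equation, k = 1 + i sigma with sigma < 0, coercivity holds for
   all 0 <= phi <= phi0 = pi / (2 (alpha + 2)), but degenerates as sigma -> 0
   at phi = 0; at phi = phi0 it is uniform in sigma and theta. Hence
   u'(0) / u(0) for the outgoing solution u is exp(i phi0) v'(0), where v is the
   exponentially decaying solution on the rotated ray. There the first Born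
   approximation has an error O(theta^2), and its coefficient is Euler's
   integral for Gamma(alpha + 1) along a rotated ray. *)

(** * Calculus of complex-valued functions of a real variable *)

(** On the real axis the Born integral of [x^alpha * exp (-2 i x)] diverges, and [theta * x^alpha]
    is large for large x however small theta is, so no quadratic error bound is available there
    directly. On the rotated ray both the free and the exact solution decay exponentially, the power
    is absorbed by the decay, and the constants are uniform for theta in [0, 1]. No analyticity of
    solutions is used: the turn is cut into n equal steps, each of which changes exp(i phi) v'(0) by
    O(1/n^2), so the total change is zero. The ray of Euler's integral is turned by the same device,
    with an extra boundary term. Let m be u'(0)/u(0) for the outgoing solution. Matching with plane
    waves at 0 gives R = (1 - i m)/(1 + i m); since m = -i at theta = 0, the linear part of R is
    -(i/2)(m + i). The final error is O(theta^2), which lies within the claimed one because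
    min(1/alpha, 1) is at most 1. *)

Local Notation cder := (is_derive (K := R_AbsRing) (V := C_R_NormedModule)).

Lemma cder_iff (f : R -> C) (x : R) (l : C) :
  cder f x l <->
  is_derive (fun y => fst (f y)) x (fst l) /\ is_derive (fun y => snd (f y)) x (snd l).
Proof.
  split.
  - intros H; split.
    + apply (filterdiff_comp f fst (fun y => scal y l) fst H).
      apply filterdiff_linear, is_linear_fst.
    + apply (filterdiff_comp f snd (fun y => scal y l) snd H).
      apply filterdiff_linear, is_linear_snd.
  - intros [H1 H2].
    apply (filterdiff_ext (fun y => (fst (f y), snd (f y)))).
    { intros y; now destruct (f y). }
    apply (filterdiff_comp_2 (fun y => fst (f y)) (fun y => snd (f y)) (fun u v => (u, v))
             (fun y => scal y (fst l)) (fun y => scal y (snd l)) (fun u v => (u, v)) H1 H2).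
    apply (filterdiff_ext_lin (fun z : R * R => z) (fun z => z)).
    + apply (filterdiff_ext (fun z : R * R => z)); [now intros []|].
      apply filterdiff_id.
    + now intros [].
Qed.

Lemma cder_fst (f : R -> C) (x : R) l : cder f x l -> is_derive (fun y => fst (f y)) x (fst l).
Proof. intros H; apply cder_iff in H; tauto. Qed.

Lemma cder_snd (f : R -> C) (x : R) l : cder f x l -> is_derive (fun y => snd (f y)) x (snd l).
Proof. intros H; apply cder_iff in H; tauto. Qed.

Lemma is_derive_eq (f : R -> R) (x l l' : R) : is_derive f x l -> l = l' -> is_derive f x l'.
Proof. now intros H <-. Qed.

Lemma rder_ext (f g : R -> R) (x l : R) :
  (forall y, f y = g y) -> is_derive f x l -> is_derive g x l.
Proof. apply is_derive_ext. Qed.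

Lemma cder_eq (f : R -> C) (x : R) (l l' : C) : cder f x l -> l = l' -> cder f x l'.
Proof. now intros H <-. Qed.

Lemma cder_ext (f g : R -> C) (x : R) (l : C) : (forall y, f y = g y) -> cder f x l -> cder g x l.
Proof. intros E; apply is_derive_ext, E. Qed.

Lemma rder_const (c : R) x : is_derive (fun _ : R => c) x 0.
Proof. apply (is_derive_const (K := R_AbsRing) (V := R_NormedModule)). Qed.

Lemma rder_id (x : R) : is_derive (fun t : R => t) x 1.
Proof. apply (is_derive_id (K := R_AbsRing)). Qed.

Lemma cder_const (c : C) x : cder (fun _ => c) x (RtoC 0).
Proof. apply cder_iff; split; apply rder_const. Qed.

Lemma cder_plus (f g : R -> C) (x : R) (l m : C) :
  cder f x l -> cder g x m -> cder (fun y => f y + g y)%C x (l + m)%C.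
Proof.
  intros Hf Hg; apply cder_iff; split; simpl;
  apply (is_derive_plus (K := R_AbsRing) (V := R_NormedModule)).
  all: (now apply cder_fst) || (now apply cder_snd).
Qed.

Lemma cder_opp (f : R -> C) (x : R) (l : C) : cder f x l -> cder (fun y => - f y)%C x (- l)%C.
Proof.
  intros Hf; apply cder_iff; split; simpl;
  apply (is_derive_opp (K := R_AbsRing) (V := R_NormedModule)).
  all: (now apply cder_fst) || (now apply cder_snd).
Qed.

Lemma cder_minus (f g : R -> C) (x : R) (l m : C) :
  cder f x l -> cder g x m -> cder (fun y => f y - g y)%C x (l - m)%C.
Proof. intros Hf Hg; apply cder_plus; [|apply cder_opp]; assumption. Qed.

Lemma rder_mult (f g : R -> R) (x l m : R) :
  is_derive f x l -> is_derive g x m -> is_derive (fun y => f y * g y) x (l * g x + f x * m).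
Proof. intros Hf Hg; apply (is_derive_mult f g x l m Hf Hg), Rmult_comm. Qed.

Lemma rder_plus (f g : R -> R) (x l m : R) :
  is_derive f x l -> is_derive g x m -> is_derive (fun y => f y + g y) x (l + m).
Proof. apply (is_derive_plus (K := R_AbsRing) (V := R_NormedModule)). Qed.

Lemma rder_minus (f g : R -> R) (x l m : R) :
  is_derive f x l -> is_derive g x m -> is_derive (fun y => f y - g y) x (l - m).
Proof. apply (is_derive_minus (K := R_AbsRing) (V := R_NormedModule)). Qed.

Lemma rder_scal (c : R) (f : R -> R) (x l : R) :
  is_derive f x l -> is_derive (fun y => c * f y) x (c * l).
Proof. apply (is_derive_scal f x c l). Qed.

Lemma cder_mult (f g : R -> C) (x : R) (l m : C) :
  cder f x l -> cder g x m -> cder (fun y => f y * g y)%C x (l * g x + f x * m)%C.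
Proof.
  intros Hf Hg.
  pose proof (cder_fst _ _ _ Hf). pose proof (cder_snd _ _ _ Hf).
  pose proof (cder_fst _ _ _ Hg). pose proof (cder_snd _ _ _ Hg).
  apply cder_iff; split.
  - eapply is_derive_eq.
    + exact (rder_minus _ _ _ _ _ (rder_mult _ _ _ _ _ H H1) (rder_mult _ _ _ _ _ H0 H2)).
    + simpl; ring.
  - eapply is_derive_eq.
    + exact (rder_plus _ _ _ _ _ (rder_mult _ _ _ _ _ H H2) (rder_mult _ _ _ _ _ H0 H1)).
    + simpl; ring.
Qed.

Lemma cder_scal (c : C) (f : R -> C) (x : R) (l : C) :
  cder f x l -> cder (fun y => c * f y)%C x (c * l)%C.
Proof.
  intros Hf; eapply cder_eq; [apply cder_mult; [apply cder_const | exact Hf] |]; cbv beta; ring.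
Qed.

Lemma cder_RtoC (f : R -> R) (x : R) l : is_derive f x l -> cder (fun y => RtoC (f y)) x (RtoC l).
Proof. intros H; apply cder_iff; split; simpl; [exact H|apply rder_const]. Qed.

Lemma cder_Re (f : R -> C) (x : R) (l : C) : cder f x l -> is_derive (fun y => Re (f y)) x (Re l).
Proof. apply cder_fst. Qed.

Lemma cder_Cconj (f : R -> C) (x : R) (l : C) : cder f x l -> cder (fun y => Cconj (f y)) x (Cconj l).
Proof.
  intros H; apply cder_iff; split; simpl; [now apply cder_fst|].
  apply (is_derive_opp (K := R_AbsRing) (V := R_NormedModule)); now apply cder_snd.
Qed.

Lemma cder_continuous (f : R -> C) (x : R) (l : C) : cder f x l -> continuous (U := C_R_NormedModule) f x.
Proof. intros H; apply (ex_derive_continuous (V := C_R_NormedModule)); now exists l. Qed.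

(** * Monotonicity, mean value and Gronwall inequalities *)

Lemma incr_of_deriv (f f' : R -> R) a b : a <= b ->
  (forall t, a <= t <= b -> is_derive f t (f' t)) ->
  (forall t, a <= t <= b -> 0 <= f' t) -> f a <= f b.
Proof.
  intros [Hab| ->] Hd Hp; [|lra].
  destruct (MVT_cor2 f f' a b Hab) as [c [Hc Hc']].
  { intros c Hc; apply is_derive_Reals; auto. }
  assert (0 <= f' c * (b - a)) by (apply Rmult_le_pos; [apply Hp|]; lra). lra.
Qed.

Lemma Re_Cconj_mul (z : C) : Re (Cconj z * z) = Cmod z ^ 2.
Proof.
  unfold Cmod; rewrite pow2_sqrt; [|nra]. destruct z as [u v]; unfold Re; simpl; ring.
Qed.

Lemma Re_le_Cmod (z : C) : Rabs (Re z) <= Cmod z.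
Proof. generalize (Rmax_Cmod z), (Rmax_l (Rabs (fst z)) (Rabs (snd z))); unfold Re; lra. Qed.

Lemma Im_le_Cmod (z : C) : Rabs (Im z) <= Cmod z.
Proof. generalize (Rmax_Cmod z), (Rmax_r (Rabs (fst z)) (Rabs (snd z))); unfold Im; lra. Qed.

Lemma Cmod_Cconj (z : C) : Cmod (Cconj z) = Cmod z.
Proof. unfold Cmod; f_equal; destruct z; simpl; ring. Qed.

(* For real f this is the mean value inequality; the complex case reduces to
   the real part of [conj (f b - f a) * f]. *)
Lemma dominated_increment (f f' : R -> C) (g g' : R -> R) a b : a <= b ->
  (forall t, a <= t <= b -> cder f t (f' t)) ->
  (forall t, a <= t <= b -> is_derive g t (g' t)) ->
  (forall t, a <= t <= b -> Cmod (f' t) <= g' t) ->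
  Cmod (f b - f a) <= g b - g a.
Proof.
  intros Hab Hf Hg Hd.
  set (z := (f b - f a)%C).
  assert (H0 : g a <= g b).
  { apply (incr_of_deriv g g'); auto. intros t Ht.
    generalize (Cmod_ge_0 (f' t)), (Hd t Ht); lra. }
  destruct (Cmod_ge_0 z) as [Hz|Hz]; [|lra].
  assert (H : Cmod z * g a - Re (Cconj z * f a) <= Cmod z * g b - Re (Cconj z * f b)).
  { apply (incr_of_deriv (fun t => Cmod z * g t - Re (Cconj z * f t))
             (fun t => Cmod z * g' t - Re (Cconj z * f' t))); auto.
    - intros t Ht; apply rder_minus; [now apply rder_scal, Hg|].
      now apply cder_Re, cder_scal, Hf.
    - intros t Ht. generalize (Re_le_Cmod (Cconj z * f' t)), (Hd t Ht).
      rewrite Cmod_mult, Cmod_Cconj. intros H1 H2.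
      apply Rmult_le_compat_l with (r := Cmod z) in H2; [|lra].
      generalize (Rle_abs (Re (Cconj z * f' t))); lra. }
  assert (E : Re (Cconj z * f b) - Re (Cconj z * f a) = Cmod z ^ 2).
  { rewrite <- Re_Cconj_mul. unfold z, Re; simpl; ring. }
  assert (Cmod z * (Cmod z) <= Cmod z * (g b - g a)) by lra.
  apply Rmult_le_reg_l in H1; lra.
Qed.

Lemma rder_exp (c x : R) : is_derive (fun t => exp (c * t)) x (c * exp (c * x)).
Proof. auto_derive; [easy|ring]. Qed.

Lemma cder_Cmod2 (f : R -> C) (x : R) (l : C) :
  cder f x l -> is_derive (fun y => Cmod (f y) ^ 2) x (2 * Re (Cconj (f x) * l)).
Proof.
  intros H.
  apply (is_derive_ext (fun y => Re (Cconj (f y) * f y))).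
  { intros y; apply Re_Cconj_mul. }
  eapply is_derive_eq; [apply cder_Re, cder_mult; [apply cder_Cconj|]; exact H|].
  unfold Re; simpl; ring.
Qed.

(** The hypothesis makes [h t * exp (- L * |t|)] decrease away from 0 on both sides, so one
    statement serves both directions of time. *)
Lemma gronwall (h h' : R -> R) (X L : R) :
  (forall t, Rabs t <= X -> is_derive h t (h' t)) ->
  (forall t, Rabs t <= X -> Rabs (h' t) <= L * h t) ->
  forall x, Rabs x <= X -> h x <= h 0 * exp (L * Rabs x).
Proof.
  intros Hd Hb x Hx.
  assert (E1 : forall s, exp (- s) * exp s = 1).
  { intros s; rewrite <- exp_plus, Rplus_opp_l; apply exp_0. }
  destruct (Rle_dec 0 x) as [H0|H0].
  - rewrite Rabs_right in * by lra.
    assert (H : - h 0 * exp (- L * 0) <= - h x * exp (- L * x)).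
    { apply (incr_of_deriv (fun t => - h t * exp (- L * t))
              (fun t => - h' t * exp (- L * t) + - h t * (- L * exp (- L * t)))); [lra| |].
      - intros t Ht; apply (rder_mult (fun t => - h t) (fun t => exp (- L * t))); [|apply rder_exp].
        apply (is_derive_opp (K := R_AbsRing) (V := R_NormedModule)), Hd.
        rewrite Rabs_right; lra.
      - intros t Ht. assert (Ha : Rabs t <= X) by (rewrite Rabs_right; lra).
        specialize (Hb t Ha). generalize (Rle_abs (h' t)); intros.
        replace (_ + _) with ((L * h t - h' t) * exp (- L * t)) by ring.
        apply Rmult_le_pos; [lra | left; apply exp_pos]. }
    rewrite Rmult_0_r, exp_0 in H.
    specialize (E1 (L * x)). replace (- L * x) with (- (L * x)) in H by ring.
    replace (h x) with (h x * (exp (- (L * x)) * exp (L * x))) by (rewrite E1; ring).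
    rewrite <- Rmult_assoc. apply Rmult_le_compat_r; [left; apply exp_pos|lra].
  - rewrite Rabs_left in * by lra.
    assert (H : h x * exp (L * x) <= h 0 * exp (L * 0)).
    { apply (incr_of_deriv (fun t => h t * exp (L * t))
              (fun t => h' t * exp (L * t) + h t * (L * exp (L * t)))); [lra| |].
      - intros t Ht; apply (rder_mult h (fun t => exp (L * t))); [|apply rder_exp].
        apply Hd. apply Rabs_le; lra.
      - intros t Ht. assert (Ha : Rabs t <= X) by (apply Rabs_le; lra).
        specialize (Hb t Ha). generalize (Rabs_maj2 (h' t)); intros.
        replace (_ + _) with ((L * h t + h' t) * exp (L * t)) by ring.
        apply Rmult_le_pos; [lra | left; apply exp_pos]. }
    rewrite Rmult_0_r, exp_0 in H.
    specialize (E1 (- (L * x))). replace (L * - x) with (- (L * x)) by ring.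
    rewrite Ropp_involutive in E1.
    replace (h x) with (h x * (exp (L * x) * exp (- (L * x)))) by (rewrite E1; ring).
    rewrite <- Rmult_assoc. apply Rmult_le_compat_r; [left; apply exp_pos|lra].
Qed.

(** Gronwall for [|w|^2 + |w1|^2 + eps^2]: including the constant [eps^2] makes the differential
    inequality homogeneous although the equation has a source. The rate [M + 2] comes from bounding
    the products [2 a b], [2 M a b] and [2 b eps] by squares. *)
Lemma ode_stability (P r w w1 : R -> C) (X M eps : R) :
  (forall t, Rabs t <= X -> cder w t (w1 t)) ->
  (forall t, Rabs t <= X -> cder w1 t (P t * w t + r t)%C) ->
  (forall t, Rabs t <= X -> Cmod (P t) <= M) ->
  (forall t, Rabs t <= X -> Cmod (r t) <= eps) ->
  forall x, Rabs x <= X ->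
  Cmod (w x) ^ 2 + Cmod (w1 x) ^ 2 <=
  (Cmod (w 0) ^ 2 + Cmod (w1 0) ^ 2 + eps ^ 2) * exp ((M + 2) * Rabs x).
Proof.
  intros Hw Hw1 HP Hr x Hx.
  assert (H := gronwall (fun t => Cmod (w t) ^ 2 + Cmod (w1 t) ^ 2 + eps ^ 2)
    (fun t => 2 * Re (Cconj (w t) * w1 t) + 2 * Re (Cconj (w1 t) * (P t * w t + r t)) + 0)
    X (M + 2)).
  assert (H' : Cmod (w x) ^ 2 + Cmod (w1 x) ^ 2 + eps ^ 2 <=
    (Cmod (w 0) ^ 2 + Cmod (w1 0) ^ 2 + eps ^ 2) * exp ((M + 2) * Rabs x)).
  2: { generalize (pow2_ge_0 eps); lra. }
  apply H; auto.
  - intros t Ht; apply rder_plus; [apply rder_plus; apply cder_Cmod2; auto|apply rder_const].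
  - intros t Ht. specialize (HP t Ht). specialize (Hr t Ht).
    generalize (Re_le_Cmod (Cconj (w t) * w1 t)), (Re_le_Cmod (Cconj (w1 t) * (P t * w t + r t))).
    rewrite !Cmod_mult, !Cmod_Cconj.
    generalize (Cmod_triangle (P t * w t) (r t)). rewrite Cmod_mult.
    generalize (Cmod_ge_0 (w t)), (Cmod_ge_0 (w1 t)), (Cmod_ge_0 (P t)), (Cmod_ge_0 (r t)).
    set (A := Re (Cconj (w t) * w1 t)). set (B := Re (Cconj (w1 t) * (P t * w t + r t))).
    intros W W1 PP RR T HA HB.
    assert (HT : Rabs (2 * A + 2 * B + 0) <= 2 * Rabs A + 2 * Rabs B).
    { rewrite Rplus_0_r. eapply Rle_trans; [apply Rabs_triang|].
      rewrite !Rabs_mult, (Rabs_right 2) by lra. lra. }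
    set (a := Cmod (w t)) in *. set (b := Cmod (w1 t)) in *. set (p := Cmod (P t)) in *.
    assert (Rabs B <= b * (M * a + eps)).
    { eapply Rle_trans; [exact HB|]. apply Rmult_le_compat_l; [lra|].
      assert (p * a <= M * a) by (apply Rmult_le_compat_r; lra). lra. }
    assert (0 <= (1 + M) * (a - b) ^ 2) by (apply Rmult_le_pos; [lra | apply pow2_ge_0]).
    assert (0 <= (b - eps) ^ 2) by apply pow2_ge_0.
    assert (0 <= eps) by lra.
    assert (0 <= (M + 1) * eps ^ 2) by (apply Rmult_le_pos; [lra | apply pow2_ge_0]).
    assert (0 <= a ^ 2) by apply pow2_ge_0.
    nra.
Qed.

(** * Limits, continuity and primitives of complex-valued functions *)

Definition clim (z : nat -> C) : C :=
  (real (Lim_seq (fun n => fst (z n))), real (Lim_seq (fun n => snd (z n)))).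

Lemma Cmod_le_abs (z : C) : Cmod z <= Rabs (fst z) + Rabs (snd z).
Proof.
  unfold Cmod. apply Rsqr_incr_0_var; [|generalize (Rabs_pos (fst z)), (Rabs_pos (snd z)); lra].
  rewrite Rsqr_sqrt by nra. unfold Rsqr.
  rewrite <- (pow2_abs (fst z)), <- (pow2_abs (snd z)).
  generalize (Rabs_pos (fst z)), (Rabs_pos (snd z)); nra.
Qed.

(** [clim] is built on a total limit operator and is meaningful only for convergent sequences; a
    Cauchy rate gives convergence, and the same rate then bounds the distance to the limit. *)
Lemma clim_bound (z : nat -> C) (e : nat -> R) :
  is_lim_seq e 0 ->
  (forall k n, (k <= n)%nat -> Cmod (z n - z k)%C <= e k) ->
  forall k, Cmod (clim z - z k)%C <= e k.
Proof.
  intros He Hz.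
  assert (Hc : forall p : C -> R, (forall u, Rabs (p u) <= Cmod u) ->
     (forall u v, p (u - v)%C = p u - p v) ->
     is_lim_seq (fun n => p (z n)) (real (Lim_seq (fun n => p (z n))))).
  { intros p Hp Hm. apply Lim_seq_correct', ex_lim_seq_cauchy_corr.
    intros eps. assert (H2 : 0 < eps / 2) by (destruct eps; simpl; lra).
    apply is_lim_seq_spec in He. destruct (He (mkposreal _ H2)) as [N HN]. exists N.
    intros n m Hn Hm'. simpl in HN.
    replace (p (z n) - p (z m)) with ((p (z n) - p (z N)) - (p (z m) - p (z N))) by ring.
    rewrite <- (Hm (z n) (z N)), <- (Hm (z m) (z N)). specialize (HN N (Nat.le_refl _)). rewrite Rminus_0_r in HN.
    generalize (Rle_abs (e N)), (Hp (z n - z N)%C), (Hp (z m - z N)%C), (Hz N n Hn), (Hz N m Hm').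
    intros. unfold Rminus.
    eapply Rle_lt_trans; [apply Rabs_triang|]. rewrite Rabs_Ropp. lra. }
  assert (H1 := Hc fst Re_le_Cmod (fun u v => eq_refl)).
  assert (H2 := Hc snd Im_le_Cmod (fun u v => eq_refl)).
  intros k. apply le_epsilon; intros eps Heps.
  assert (H4 : 0 < eps / 2) by lra.
  apply is_lim_seq_spec in H1. apply is_lim_seq_spec in H2.
  destruct (H1 (mkposreal _ H4)) as [N1 HN1]. destruct (H2 (mkposreal _ H4)) as [N2 HN2].
  simpl in HN1, HN2.
  set (n := (k + N1 + N2)%nat).
  specialize (HN1 n ltac:(unfold n; lia)). specialize (HN2 n ltac:(unfold n; lia)).
  assert (Hk := Hz k n ltac:(unfold n; lia)).
  replace (clim z - z k)%C with ((clim z - z n) + (z n - z k))%C by ring.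
  eapply Rle_trans; [apply Cmod_triangle|].
  assert (Cmod (clim z - z n)%C <= eps); [|lra].
  eapply Rle_trans; [apply Cmod_le_abs|]. simpl.
  rewrite Rabs_minus_sym in HN1. rewrite Rabs_minus_sym in HN2.
  unfold Rminus in HN1, HN2. lra.
Qed.

Lemma ccont_iff (f : R -> C) (x : R) :
  continuous (U := C_R_NormedModule) f x <->
  forall eps, 0 < eps -> locally x (fun y => Cmod (f y - f x)%C < eps).
Proof.
  split.
  - intros H eps He. assert (H2 : 0 < eps / 2) by lra.
    assert (H' := proj1 (filterlim_locally _ _) H (mkposreal _ H2)).
    revert H'; apply filter_imp. intros y [H1 H3].
    eapply Rle_lt_trans; [apply Cmod_le_abs|].
    change (Rabs (fst (f y) - fst (f x)) < eps / 2) in H1.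
    change (Rabs (snd (f y) - snd (f x)) < eps / 2) in H3.
    unfold Rminus in H1, H3. simpl. lra.
  - intros H. apply filterlim_locally. intros [eps He].
    generalize (H eps He); apply filter_imp. intros y Hy.
    split.
    + change (Rabs (fst (f y) - fst (f x)) < eps).
      generalize (Re_le_Cmod (f y - f x)); unfold Re; simpl; unfold Rminus; lra.
    + change (Rabs (snd (f y) - snd (f x)) < eps).
      generalize (Im_le_Cmod (f y - f x)); unfold Im; simpl; unfold Rminus; lra.
Qed.

Local Notation ccont := (continuous (U := C_R_NormedModule)).

Lemma ccont_fst (f : R -> C) (x : R) : ccont f x -> continuous (fun y => fst (f y)) x.
Proof.
  intros H; apply (continuous_comp (U := R_UniformSpace) f fst x H).
  destruct (f x) as [u v]; apply (continuous_fst u v).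
Qed.

Lemma ccont_snd (f : R -> C) (x : R) : ccont f x -> continuous (fun y => snd (f y)) x.
Proof.
  intros H; apply (continuous_comp (U := R_UniformSpace) f snd x H).
  destruct (f x) as [u v]; apply (continuous_snd u v).
Qed.

Lemma ccont_mult (f g : R -> C) (x : R) :
  ccont f x -> ccont g x -> ccont (fun y => f y * g y)%C x.
Proof.
  intros Hf Hg.
  assert (H1 := ccont_fst f x Hf).
  assert (H2 := ccont_snd f x Hf).
  assert (H3 := ccont_fst g x Hg).
  assert (H4 := ccont_snd g x Hg).
  apply (continuous_comp_2 (fun y => fst (f y) * fst (g y) - snd (f y) * snd (g y))
      (fun y => fst (f y) * snd (g y) + snd (f y) * fst (g y)) (fun u v => (u, v)) x).
  - apply (continuous_minus (V := R_NormedModule)); apply (continuous_mult (K := R_AbsRing)); assumption.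
  - apply (continuous_plus (V := R_NormedModule)); apply (continuous_mult (K := R_AbsRing)); assumption.
  - apply (continuous_ext (fun z : R * R => z)); [now intros []|]. apply continuous_id.
Qed.

Definition prim (f : R -> C) (x : R) : C := RInt (V := C_R_CompleteNormedModule) f 0 x.

Lemma prim_0 f : prim f 0 = RtoC 0.
Proof. apply (RInt_point (V := C_R_CompleteNormedModule)). Qed.

Lemma cder_prim (f : R -> C) : (forall x, ccont f x) -> forall x, cder (prim f) x (f x).
Proof.
  intros Hf x. apply (is_derive_RInt (V := C_R_NormedModule) f (prim f) 0 x); [|apply Hf].
  apply filter_forall; intros y.
  apply (RInt_correct (V := C_R_CompleteNormedModule)).
  apply (ex_RInt_continuous (V := C_R_CompleteNormedModule)); intros; apply Hf.
Qed.

(** * Linear second-order equations *)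

(** The equation [u'' = P u] as a first-order system. The derivative is explicit data, so that
    initial slopes, Wronskians and energies can refer to it. *)
Definition solves (P u u1 : R -> C) : Prop :=
  (forall x, cder u x (u1 x)) /\ (forall x, cder u1 x (P x * u x)%C).

(** Integration gains a factor [1 / L] in the norm weighted by [exp (L * |x|)]; this is what makes
    the Picard map a contraction on intervals of any length. *)
Lemma exp_bound_of_deriv (F f : R -> C) (X N L : R) : 0 < L -> F 0 = RtoC 0 ->
  (forall t, Rabs t <= X -> cder F t (f t)) ->
  (forall t, Rabs t <= X -> Cmod (f t) <= N * exp (L * Rabs t)) ->
  forall x, Rabs x <= X -> Cmod (F x) <= N / L * exp (L * Rabs x).
Proof.
  intros HL F0 HF Hf x Hx.
  assert (HN : 0 <= N / L).
  { apply Rdiv_le_0_compat; [|lra].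
    assert (H0 : Rabs 0 <= X) by (rewrite Rabs_R0; generalize (Rabs_pos x); lra).
    generalize (Cmod_ge_0 (f 0)), (Hf 0 H0). rewrite Rabs_R0, Rmult_0_r, exp_0. lra. }
  destruct (Rle_dec 0 x) as [H0|H0].
  - rewrite (Rabs_right x) in * by lra.
    assert (H : Cmod (F x - F 0)%C <= N / L * exp (L * x) - N / L * exp (L * 0)).
    { apply (dominated_increment F f (fun t => N / L * exp (L * t))
              (fun t => N / L * (L * exp (L * t)))); [lra| | |].
      - intros t Ht; apply HF; rewrite Rabs_right; lra.
      - intros t Ht; apply rder_scal, rder_exp.
      - intros t Ht. assert (Ha : Rabs t <= X) by (rewrite Rabs_right; lra).
        specialize (Hf t Ha). rewrite Rabs_right in Hf by lra.
        replace (N / L * (L * exp (L * t))) with (N * exp (L * t)) by (field; lra). exact Hf. }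
    rewrite F0, Rmult_0_r, exp_0 in H.
    replace (F x - RtoC 0)%C with (F x) in H by ring. lra.
  - rewrite (Rabs_left x) in * by lra.
    assert (H : Cmod (F 0 - F x)%C <= - (N / L) * exp (- L * 0) - - (N / L) * exp (- L * x)).
    { apply (dominated_increment F f (fun t => - (N / L) * exp (- L * t))
              (fun t => - (N / L) * (- L * exp (- L * t)))); [lra| | |].
      - intros t Ht; apply HF; apply Rabs_le; lra.
      - intros t Ht; apply rder_scal, rder_exp.
      - intros t Ht. assert (Ha : Rabs t <= X) by (apply Rabs_le; lra).
        specialize (Hf t Ha). rewrite Rabs_left1 in Hf by lra.
        replace (- (N / L) * (- L * exp (- L * t))) with (N * exp (L * - t)).
        { exact Hf. }
        replace (- L * t) with (L * - t) by ring. field; lra. }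
    rewrite F0, Rmult_0_r, exp_0 in H.
    replace (RtoC 0 - F x)%C with (- F x)%C in H by ring. rewrite Cmod_opp in H.
    replace (- L * x) with (L * - x) in H by ring. lra.
Qed.

Lemma eq_of_cder (f g d : R -> C) : (forall x, cder f x (d x)) -> (forall x, cder g x (d x)) ->
  f 0 = g 0 -> forall x, f x = g x.
Proof.
  intros Hf Hg H0 x.
  assert (Z : Cmod (f x - g x)%C <= 0 / 1 * exp (1 * Rabs x)).
  { apply (exp_bound_of_deriv (fun t => f t - g t)%C (fun t => d t - d t)%C (Rabs x)); try lra.
    - rewrite H0; ring.
    - intros t _. now apply cder_minus.
    - intros t _. replace (d t - d t)%C with (RtoC 0) by ring. rewrite Cmod_0; lra. }
  assert (Z2 : Cmod (f x - g x)%C = 0).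
  { apply Rle_antisym; [|apply Cmod_ge_0]. unfold Rdiv in Z. rewrite !Rmult_0_l in Z. exact Z. }
  apply Cmod_eq_0 in Z2.
  replace (f x) with ((f x - g x) + g x)%C by ring. rewrite Z2; ring.
Qed.

Lemma ccont_const (c : C) (x : R) : ccont (fun _ => c) x.
Proof. apply (cder_continuous _ _ (RtoC 0)), cder_const. Qed.

Lemma cder_lin (z0 z1 : C) (x : R) : cder (fun t => z0 + z1 * RtoC t)%C x z1.
Proof.
  eapply cder_eq.
  - apply cder_plus; [apply cder_const|apply cder_scal, cder_RtoC, rder_id].
  - ring.
Qed.

Fixpoint picard (P : R -> C) (z0 z1 : C) (n : nat) (x : R) : C :=
  match n with
  | O => (z0 + z1 * RtoC x)%C
  | S n => (z0 + prim (fun t => z1 + prim (fun s => P s * picard P z0 z1 n s) t) x)%C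
  end.

Section Picard.
Variables (P : R -> C) (z0 z1 : C).
Hypothesis P_cont : forall x, ccont P x.

(** [inner] produces the derivative and [outer] the function, so that a fixed point of [outer]
    solves the initial value problem. *)
Let inner (u : R -> C) (t : R) : C := (z1 + prim (fun s => P s * u s) t)%C.
Let outer (u : R -> C) (x : R) : C := (z0 + prim (inner u) x)%C.

Lemma inner_der u : (forall x, ccont u x) -> forall x, cder (inner u) x (P x * u x)%C.
Proof.
  intros Hu x. eapply cder_eq; [apply cder_plus; [apply cder_const|]|].
  - apply (cder_prim (fun s => P s * u s)%C). intros y; apply ccont_mult; auto.
  - cbv beta; ring.
Qed.

Lemma outer_der u : (forall x, ccont u x) -> forall x, cder (outer u) x (inner u x).
Proof.
  intros Hu x. eapply cder_eq; [apply cder_plus; [apply cder_const|]|].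
  - apply (cder_prim (inner u)). intros y. eapply cder_continuous, inner_der, Hu.
  - cbv beta; ring.
Qed.

Lemma picard_cont n : forall x, ccont (picard P z0 z1 n) x.
Proof.
  induction n as [|n IH]; intros x; simpl.
  - eapply cder_continuous, cder_lin.
  - eapply cder_continuous, (outer_der (picard P z0 z1 n) IH).
Qed.

(** Two integrations gain [1 / L^2] and multiplication by [P] costs [M]; [M <= L^2 / 2] leaves the
    factor 1/2. *)
Lemma outer_contract (u v : R -> C) (X M L N : R) : 0 < L -> 0 <= M -> M <= L ^ 2 / 2 ->
  (forall x, ccont u x) -> (forall x, ccont v x) ->
  (forall t, Rabs t <= X -> Cmod (P t) <= M) ->
  (forall t, Rabs t <= X -> Cmod (u t - v t)%C <= N * exp (L * Rabs t)) ->
  forall x, Rabs x <= X -> Cmod (outer u x - outer v x)%C <= N / 2 * exp (L * Rabs x).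
Proof.
  intros HL HM HML Hu Hv HP Huv x Hx.
  assert (H1 : forall t, Rabs t <= X ->
     Cmod (inner u t - inner v t)%C <= M * N / L * exp (L * Rabs t)).
  { apply (exp_bound_of_deriv (fun t => inner u t - inner v t)%C
       (fun t => P t * u t - P t * v t)%C); auto.
    - unfold inner; rewrite !prim_0; ring.
    - intros t _. apply cder_minus; apply inner_der; auto.
    - intros t Ht. replace (P t * u t - P t * v t)%C with (P t * (u t - v t))%C by ring.
      rewrite Cmod_mult, Rmult_assoc.
      apply Rmult_le_compat; auto using Cmod_ge_0. }
  assert (H2 : Cmod (outer u x - outer v x)%C <= M * N / L / L * exp (L * Rabs x)).
  { apply (exp_bound_of_deriv (fun t => outer u t - outer v t)%C
       (fun t => inner u t - inner v t)%C X); auto.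
    - unfold outer; rewrite !prim_0; ring.
    - intros t _. apply cder_minus; apply outer_der; auto. }
  assert (HN : 0 <= N).
  { specialize (Huv 0). rewrite Rabs_R0, Rmult_0_r, exp_0 in Huv.
    generalize (Cmod_ge_0 (u 0 - v 0)%C), (Rabs_pos x); intros.
    assert (Cmod (u 0 - v 0)%C <= N * 1) by (apply Huv; lra). lra. }
  eapply Rle_trans; [exact H2|]. apply Rmult_le_compat_r; [left; apply exp_pos|].
  apply Rle_trans with (L ^ 2 / 2 * N / L / L); [|right; field; lra].
  unfold Rdiv. assert (0 < / L) by (apply Rinv_0_lt_compat; lra).
  repeat (apply Rmult_le_compat_r; [lra|]). unfold Rdiv in HML. nra.
Qed.

Hypothesis P_bound : forall X, exists M, forall t, Rabs t <= X -> Cmod (P t) <= M.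

Lemma picard_cauchy X : 0 <= X -> exists M L N, 0 < L /\ 0 <= M /\ M <= L ^ 2 / 2 /\ 0 <= N /\
  (forall t, Rabs t <= X -> Cmod (P t) <= M) /\
  forall x, Rabs x <= X -> forall k n, (k <= n)%nat ->
    Cmod (picard P z0 z1 n x - picard P z0 z1 k x)%C <= N * (1 / 2) ^ k * exp (L * Rabs x).
Proof.
  intros HX. destruct (P_bound X) as [M HM].
  assert (HM0 : 0 <= M).
  { eapply Rle_trans; [apply Cmod_ge_0|apply (HM 0)]. rewrite Rabs_R0; lra. }
  (* This [L] satisfies [M <= L^2 / 2]; [N] bounds the affine zeroth iterate on [[-X, X]]. *)
  set (L := 1 + 2 * M). set (N := Cmod z0 + Cmod z1 * X).
  assert (HL : 0 < L) by (unfold L; lra). assert (HML : M <= L ^ 2 / 2) by (unfold L; nra).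
  assert (Hge1 : forall x, 1 <= exp (L * Rabs x)).
  { intros x. rewrite <- exp_0.
    assert (H : 0 <= L * Rabs x) by (apply Rmult_le_pos; [lra|apply Rabs_pos]).
    destruct H as [H|H]; [left; apply exp_increasing, H|rewrite <- H; lra]. }
  assert (HN : 0 <= N).
  { unfold N. generalize (Cmod_ge_0 z0), (Rmult_le_pos _ _ (Cmod_ge_0 z1) HX); lra. }
  assert (B0 : forall x, Rabs x <= X -> Cmod (picard P z0 z1 0 x) <= N * exp (L * Rabs x)).
  { intros x Hx. simpl. apply Rle_trans with (N * 1).
    - eapply Rle_trans; [apply Cmod_triangle|]. rewrite Cmod_mult, Cmod_R.
      assert (Cmod z1 * Rabs x <= Cmod z1 * X) by (apply Rmult_le_compat_l; auto using Cmod_ge_0).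
      unfold N; lra.
    - apply Rmult_le_compat_l; auto. }
  assert (S1 : forall n x, Rabs x <= X ->
    Cmod (picard P z0 z1 (S n) x - picard P z0 z1 n x)%C <= N / 2 * (1 / 2) ^ n * exp (L * Rabs x)).
  { induction n as [|n IH]; intros x Hx.
    - assert (H := outer_contract (picard P z0 z1 0) (fun _ => RtoC 0) X M L N HL HM0 HML
        (picard_cont 0) (ccont_const _) HM).
      rewrite pow_O, Rmult_1_r.
      (* The zeroth iterate is the image of the zero function, so the base case is again an instance
         of the contraction. *)
      replace (picard P z0 z1 0 x) with (outer (fun _ => RtoC 0) x).
      { apply H; auto. intros t Ht.
        replace (picard P z0 z1 0 t - RtoC 0)%C with (picard P z0 z1 0 t) by ring. auto. }
      apply (eq_of_cder _ (picard P z0 z1 0) (fun _ => z1)).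
      + intros t. eapply cder_eq; [apply outer_der, ccont_const|].
        apply (eq_of_cder _ (fun _ => z1) (fun _ => RtoC 0)).
        * intros y. eapply cder_eq; [apply inner_der, ccont_const|]. cbv beta; ring.
        * intros y; apply cder_const.
        * unfold inner; rewrite prim_0; ring.
      + intros t; apply cder_lin.
      + unfold outer; simpl; rewrite prim_0; ring.
    - assert (H := outer_contract (picard P z0 z1 (S n)) (picard P z0 z1 n) X M L
        (N / 2 * (1 / 2) ^ n) HL HM0 HML (picard_cont _) (picard_cont _) HM IH x Hx).
      eapply Rle_trans; [exact H|]. right; simpl; field. }
  exists M, L, N. repeat split; auto.
  intros x Hx k n Hkn.
  (* The exact geometric partial sum lets the induction close; its second term is dropped only
     afterwards. *)
  assert (G : Cmod (picard P z0 z1 n x - picard P z0 z1 k x)%C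
     <= N * ((1 / 2) ^ k - (1 / 2) ^ n) * exp (L * Rabs x)).
  { induction Hkn as [|n Hkn IH].
    - replace (_ - _)%C with (RtoC 0) by ring. rewrite Cmod_0. right; ring.
    - replace (picard P z0 z1 (S n) x - picard P z0 z1 k x)%C with
       ((picard P z0 z1 (S n) x - picard P z0 z1 n x) + (picard P z0 z1 n x - picard P z0 z1 k x))%C by ring.
      eapply Rle_trans; [apply Cmod_triangle|].
      generalize (S1 n x Hx). simpl pow. intros S2.
      replace (N * ((1 / 2) ^ k - 1 / 2 * (1 / 2) ^ n) * exp (L * Rabs x)) with
       (N / 2 * (1 / 2) ^ n * exp (L * Rabs x) + N * ((1 / 2) ^ k - (1 / 2) ^ n) * exp (L * Rabs x)) by field.
      lra. }
  eapply Rle_trans; [exact G|]. apply Rmult_le_compat_r; [left; apply exp_pos|].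
  apply Rmult_le_compat_l; auto. assert (0 < (1 / 2) ^ n) by (apply pow_lt; lra). lra.
Qed.

Lemma geom_lim (c : R) : is_lim_seq (fun n => c * (1 / 2) ^ n) 0.
Proof.
  replace (Finite 0) with (Rbar_mult c 0) by (simpl; f_equal; ring).
  apply is_lim_seq_scal_l, is_lim_seq_geom. rewrite Rabs_right; lra.
Qed.

Lemma le_of_geom (a c : R) : (forall n, a <= c * (1 / 2) ^ n) -> a <= 0.
Proof.
  intros H. apply (is_lim_seq_le (fun _ => a) (fun n => c * (1 / 2) ^ n) a 0 H).
  - apply is_lim_seq_const.
  - apply geom_lim.
Qed.

Lemma ode_exists : exists u u1, solves P u u1 /\ u 0 = z0 /\ u1 0 = z1.
Proof.
  set (u := fun x => clim (fun n => picard P z0 z1 n x)).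
  assert (Hu : forall X, 0 <= X -> exists M L N, 0 < L /\ 0 <= M /\ M <= L ^ 2 / 2 /\ 0 <= N /\
     (forall t, Rabs t <= X -> Cmod (P t) <= M) /\
     forall x, Rabs x <= X -> forall k,
       Cmod (u x - picard P z0 z1 k x)%C <= N * (1 / 2) ^ k * exp (L * Rabs x)).
  { intros X HX. destruct (picard_cauchy X HX) as (M & L & N & H1 & H2 & H3 & H4 & H5 & H6).
    exists M, L, N; repeat split; auto. intros x Hx.
    apply (clim_bound (fun n => picard P z0 z1 n x) (fun k => N * (1 / 2) ^ k * exp (L * Rabs x))).
    - eapply is_lim_seq_ext; [|apply (geom_lim (N * exp (L * Rabs x)))]. intros; simpl; ring.
    - intros; apply H6; auto. }
  (* Continuity of the limit has to precede the fixed point equation, because the derivative rules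
     for [inner] and [outer] require a continuous argument. It is the uniform limit argument with
     thirds of [eps]. *)
  assert (Cu : forall x, ccont u x).
  { intros x. apply ccont_iff. intros eps Heps.
    destruct (Hu (Rabs x + 1) ltac:(generalize (Rabs_pos x); lra))
      as (M & L & N & HL & HM & HML & HN & HP & Hx).
    set (E := N * exp (L * (Rabs x + 1))).
    assert (Hk : exists k, E * (1 / 2) ^ k < eps / 3).
    { assert (G := geom_lim E). apply is_lim_seq_spec in G.
      assert (H3 : 0 < eps / 3) by lra.
      destruct (G (mkposreal _ H3)) as [k Hk]. exists k.
      specialize (Hk k (Nat.le_refl _)). simpl in Hk. rewrite Rminus_0_r in Hk.
      eapply Rle_lt_trans; [apply Rle_abs|exact Hk]. }
    destruct Hk as [k Hk].
    assert (Hb : forall y, Rabs y <= Rabs x + 1 -> Cmod (u y - picard P z0 z1 k y)%C < eps / 3).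
    { intros y Hy. eapply Rle_lt_trans; [|exact Hk]. eapply Rle_trans; [apply Hx, Hy|].
      unfold E. replace (N * exp (L * (Rabs x + 1)) * (1 / 2) ^ k) with
        (N * (1 / 2) ^ k * exp (L * (Rabs x + 1))) by ring.
      apply Rmult_le_compat_l; [apply Rmult_le_pos; [auto|apply pow_le; lra]|].
      assert (H : L * Rabs y <= L * (Rabs x + 1)) by (apply Rmult_le_compat_l; lra).
      destruct H as [H|H]; [left; apply exp_increasing, H|rewrite H; lra]. }
    assert (C1 := proj1 (ccont_iff _ _) (picard_cont k x) (eps / 3) ltac:(lra)).
    assert (C2 : locally x (fun y => Rabs y <= Rabs x + 1)).
    { exists (mkposreal 1 Rlt_0_1). intros y Hy.
      change (Rabs (y - x) < 1) in Hy.
      replace y with (x + (y - x)) by ring. eapply Rle_trans; [apply Rabs_triang|lra]. }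
    generalize (filter_and _ _ C1 C2). apply filter_imp. intros y [Y1 Y2].
    replace (u y - u x)%C with ((u y - picard P z0 z1 k y) +
      ((picard P z0 z1 k y - picard P z0 z1 k x) + - (u x - picard P z0 z1 k x)))%C by ring.
    eapply Rle_lt_trans; [apply Cmod_triangle|].
    generalize (Cmod_triangle (picard P z0 z1 k y - picard P z0 z1 k x) (- (u x - picard P z0 z1 k x))).
    rewrite Cmod_opp. generalize (Hb y Y2), (Hb x ltac:(lra)). lra. }
  assert (E : forall x, outer u x = u x).
  { intros x. destruct (Hu (Rabs x) (Rabs_pos x)) as (M & L & N & HL & HM & HML & HN & HP & Hx).
    assert (Z : Cmod (outer u x - u x)%C <= 0).
    { apply (le_of_geom _ (N * exp (L * Rabs x))). intros n.
      assert (H1 := outer_contract u (picard P z0 z1 n) (Rabs x) M L (N * (1 / 2) ^ n)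
        HL HM HML Cu (picard_cont n) HP (fun t Ht => Hx t Ht n) x (Rle_refl _)).
      assert (H2 := Hx x (Rle_refl _) (S n)).
      replace (outer u x - u x)%C with
        ((outer u x - outer (picard P z0 z1 n) x) + - (u x - picard P z0 z1 (S n) x))%C.
      2: { change (picard P z0 z1 (S n) x) with (outer (picard P z0 z1 n) x). ring. }
      eapply Rle_trans; [apply Cmod_triangle|]. rewrite Cmod_opp.
      simpl pow in H2. lra. }
    assert (Z2 : Cmod (outer u x - u x)%C = 0) by (apply Rle_antisym; [exact Z|apply Cmod_ge_0]).
    apply Cmod_eq_0 in Z2.
    replace (outer u x) with ((outer u x - u x) + u x)%C by ring. rewrite Z2; ring. }
  exists u, (inner u). split; [split|split].
  - intros x. apply (cder_ext (outer u) u); [exact E|]. apply outer_der, Cu.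
  - intros x. apply inner_der, Cu.
  - rewrite <- E. unfold outer; rewrite prim_0; ring.
  - unfold inner; rewrite prim_0; ring.
Qed.
End Picard.

(** * Decaying solutions of coercive equations *)

Lemma exp_le (x y : R) : x <= y -> exp x <= exp y.
Proof. intros [H|H]; [left; now apply exp_increasing|rewrite H; lra]. Qed.

(** Stands in for letting x tend to infinity. If [b < a], the remainder already falls below half the
    gap at the explicit point [c / d / r], since [exp (r * x) > 1 + r * x]. *)
Lemma le_of_exp_decay (a b c r : R) : 0 < r ->
  (forall x, 0 <= x -> a <= b + c * exp (- r * x)) -> a <= b.
Proof.
  intros Hr H. apply Rnot_lt_le; intros Hab.
  set (d := (a - b) / 2). assert (Hd : 0 < d) by (unfold d; lra).
  assert (Hc : 0 < c).
  { specialize (H 0 (Rle_refl 0)). rewrite Rmult_0_r, exp_0 in H. lra. }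
  set (x := c / d / r).
  assert (Hx : 0 < x) by (unfold x; repeat apply Rdiv_lt_0_compat; lra).
  specialize (H x (Rlt_le _ _ Hx)).
  assert (E : exp (r * x) * exp (- r * x) = 1).
  { rewrite <- exp_plus, <- exp_0. f_equal. ring. }
  assert (E2 : c / d < exp (r * x)).
  { apply Rlt_trans with (1 + r * x).
    - unfold x. replace (r * (c / d / r)) with (c / d) by (field; lra). lra.
    - apply exp_ineq1. apply Rgt_not_eq, Rmult_lt_0_compat; lra. }
  generalize (exp_pos (- r * x)); intros.
  assert (c / d * exp (- r * x) < 1) by (rewrite <- E; apply Rmult_lt_compat_r; lra).
  assert (c * exp (- r * x) < d).
  { replace (c * exp (- r * x)) with (d * (c / d * exp (- r * x))) by (field; lra).
    rewrite <- (Rmult_1_r d) at 3. apply Rmult_lt_compat_l; lra. }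
  unfold d in *; lra.
Qed.

Lemma exp_decay_small (c r eps : R) : 0 < r -> 0 < eps ->
  exists M, 0 <= M /\ forall x, M < x -> c * exp (- r * x) < eps.
Proof.
  intros Hr He. exists (Rabs c / eps / r). split.
  { repeat apply Rdiv_le_0_compat; auto. apply Rabs_pos. }
  intros x Hx.
  assert (H1 : Rabs c < eps * (r * x)).
  { apply Rmult_lt_compat_l with (r := eps * r) in Hx; [|apply Rmult_lt_0_compat; auto].
    replace (eps * r * (Rabs c / eps / r)) with (Rabs c) in Hx by (field; lra). lra. }
  assert (H2 : 1 + r * x <= exp (r * x)) by apply exp_ineq1_le.
  assert (H3 : exp (r * x) * exp (- r * x) = 1).
  { rewrite <- exp_plus, <- exp_0. f_equal. ring. }
  assert (Hp := exp_pos (- r * x)).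
  apply Rle_lt_trans with (Rabs c * exp (- r * x)).
  { apply Rmult_le_compat_r; [lra|apply Rle_abs]. }
  apply Rlt_le_trans with (eps * (r * x) * exp (- r * x)); [apply Rmult_lt_compat_r; auto|].
  apply Rle_trans with (eps * exp (r * x) * exp (- r * x)).
  - apply Rmult_le_compat_r; [lra|]. apply Rmult_le_compat_l; lra.
  - rewrite Rmult_assoc, H3. lra.
Qed.

Lemma exists_right_gt (f : R -> R) (d eta : R) : is_derive f 0 d -> 0 < d -> 0 < eta ->
  exists h, 0 < h < eta /\ f 0 < f h.
Proof.
  intros Hf Hd He. apply is_derive_Reals in Hf.
  destruct (Hf (d / 2) ltac:(lra)) as [[del Hdel] H]. simpl in H.
  set (h := Rmin del eta / 2).
  assert (Hh : 0 < h /\ h < del /\ h < eta).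
  { unfold h. generalize (Rmin_l del eta), (Rmin_r del eta), (Rmin_glb_lt _ _ _ Hdel He). lra. }
  exists h. split; [tauto|].
  specialize (H h ltac:(lra)). rewrite Rabs_right in H by lra.
  specialize (H ltac:(lra)). rewrite Rplus_0_l in H.
  apply Rabs_def2 in H. destruct H as [_ H].
  assert (H1 : 0 < (f h - f 0) / h) by lra.
  assert (H2 : 0 < (f h - f 0) / h * h) by (apply Rmult_lt_0_compat; lra).
  replace ((f h - f 0) / h * h) with (f h - f 0) in H2 by (field; lra). lra.
Qed.

Definition regular (P : R -> C) : Prop :=
  (forall x, ccont P x) /\ (forall X, exists M, forall t, Rabs t <= X -> Cmod (P t) <= M).

(** The growth rate [c / 2] allowed for [P] is half the decay rate [c] which the energy yields for
    solutions, so that [P v] still decays. [Cmod w <= 1] fixes the scale of [c]; in particular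
    [c <= 1]. *)
Definition coercive (w : C) (c B : R) (P : R -> C) : Prop :=
  0 < c /\ Cmod w <= 1 /\ c <= Re w /\
  (forall x, 0 <= x -> c <= Re (w * P x)) /\
  (forall x, 0 <= x -> Cmod (P x) <= B * exp (c / 2 * x)).

(** With [v 0 = 1] the slope [v1 0] is the Weyl m-function of the half-line, the quantity that
    determines the reflection coefficient. [K] and [r] are kept explicit because the limits in sigma
    and theta rest on their uniformity. *)
Definition weyl (K r : R) (P v v1 : R -> C) : Prop :=
  solves P v v1 /\ v 0 = RtoC 1 /\
  forall x, 0 <= x -> Cmod (v x) <= K * exp (- r * x) /\ Cmod (v1 x) <= K * exp (- r * x).

Definition energy (w : C) (v v1 : R -> C) (x : R) : R := Re (w * (v1 x * Cconj (v x))).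

(** The second derivative [q] is arbitrary because the Born remainder satisfies an equation with a
    source. *)
Lemma energy_der_gen (w : C) (v v1 : R -> C) (x : R) (q : C) :
  cder v x (v1 x) -> cder v1 x q ->
  is_derive (energy w v v1) x (Re (w * (q * Cconj (v x))) + Re w * Cmod (v1 x) ^ 2).
Proof.
  intros H H1. eapply is_derive_eq.
  - apply cder_Re, cder_scal, cder_mult; [exact H1|apply cder_Cconj, H].
  - rewrite <- Re_Cconj_mul. unfold Re; simpl; ring.
Qed.

Lemma energy_der (w : C) (P v v1 : R -> C) (x : R) : solves P v v1 ->
  is_derive (energy w v v1) x (Re (w * P x) * Cmod (v x) ^ 2 + Re w * Cmod (v1 x) ^ 2).
Proof.
  intros [H H1]. eapply is_derive_eq; [apply energy_der_gen; [apply H|apply H1]|].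
  rewrite <- (Re_Cconj_mul (v x)). unfold Re; simpl; ring.
Qed.

Lemma energy_abs (w : C) (v v1 : R -> C) (x : R) : Cmod w <= 1 ->
  Rabs (energy w v v1 x) <= Cmod (v x) * Cmod (v1 x).
Proof.
  intros Hw. eapply Rle_trans; [apply Re_le_Cmod|]. rewrite !Cmod_mult, Cmod_Cconj.
  generalize (Cmod_ge_0 (v x)), (Cmod_ge_0 (v1 x)). intros.
  assert (0 <= Cmod (v1 x) * Cmod (v x)) by (apply Rmult_le_pos; auto).
  assert (Cmod w * (Cmod (v1 x) * Cmod (v x)) <= 1 * (Cmod (v1 x) * Cmod (v x))).
  { apply Rmult_le_compat_r; auto. }
  lra.
Qed.

Lemma solves_lin (P u u1 v v1 : R -> C) (a : C) : solves P u u1 -> solves P v v1 ->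
  solves P (fun x => u x + a * v x)%C (fun x => u1 x + a * v1 x)%C.
Proof.
  intros [U U1] [V V1]; split; intros x.
  - apply cder_plus; [apply U|apply cder_scal, V].
  - eapply cder_eq; [apply cder_plus; [apply U1|apply cder_scal, V1]|ring].
Qed.

Lemma wronskian_const (P u u1 v v1 : R -> C) : solves P u u1 -> solves P v v1 ->
  forall x, (u x * v1 x - u1 x * v x)%C = (u 0 * v1 0 - u1 0 * v 0)%C.
Proof.
  intros [U U1] [V V1].
  apply (eq_of_cder (fun x => u x * v1 x - u1 x * v x)%C (fun _ => u 0 * v1 0 - u1 0 * v 0)%C
    (fun _ => RtoC 0)); auto.
  - intros x. eapply cder_eq.
    + apply cder_minus; apply cder_mult; [apply U|apply V1|apply U1|apply V].
    + cbv beta; ring.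
  - intros x; apply cder_const.
Qed.

Section Weyl.
Variables (w : C) (c B : R) (P : R -> C).
Hypothesis P_reg : regular P.
Hypothesis P_coer : coercive w c B P.

Lemma energy_der_ge (v v1 : R -> C) x : 0 <= x ->
  c * (Cmod (v x) ^ 2 + Cmod (v1 x) ^ 2) <= Re (w * P x) * Cmod (v x) ^ 2 + Re w * Cmod (v1 x) ^ 2.
Proof.
  intros Hx. destruct P_coer as (Hc & Hw & Hwc & HP & HB). specialize (HP x Hx).
  generalize (pow2_ge_0 (Cmod (v x))), (pow2_ge_0 (Cmod (v1 x))); nra.
Qed.

Lemma energy_incr (v v1 : R -> C) x y : solves P v v1 -> 0 <= x <= y ->
  energy w v v1 x <= energy w v v1 y.
Proof.
  intros Hv Hxy. eapply incr_of_deriv; [lra|intros t Ht; apply energy_der, Hv|].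
  intros t Ht; cbv beta. eapply Rle_trans; [|apply energy_der_ge; lra].
  destruct P_coer as (Hc & _).
  generalize (pow2_ge_0 (Cmod (v t))), (pow2_ge_0 (Cmod (v1 t))); nra.
Qed.

Lemma energy_der_ge_energy (v v1 : R -> C) x : 0 <= x ->
  2 * c * Rabs (energy w v v1 x) <= Re (w * P x) * Cmod (v x) ^ 2 + Re w * Cmod (v1 x) ^ 2.
Proof.
  intros Hx. eapply Rle_trans; [|apply energy_der_ge; lra].
  destruct P_coer as (Hc & Hw & _).
  generalize (energy_abs w v v1 x Hw), (pow2_ge_0 (Cmod (v x) - Cmod (v1 x))).
  intros; assert (2 * Rabs (energy w v v1 x) <= Cmod (v x) ^ 2 + Cmod (v1 x) ^ 2) by nra. nra.
Qed.

(** The energy vanishes at 0 and starts with slope [Re w > 0], hence is positive at some [h < 1];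
    from there on its derivative is at least [2 * c * f h]. Linear growth is enough to shrink the
    discs to a point. *)
Lemma energy_grows (s s1 : R -> C) : solves P s s1 -> s 0 = RtoC 0 -> s1 0 = RtoC 1 ->
  exists b, 0 < b /\ forall x, 1 <= x -> b * x <= energy w s s1 x.
Proof.
  intros Hs S0 S1. destruct P_coer as (Hc & Hw & Hwc & _).
  destruct (exists_right_gt (energy w s s1) (Re w) 1) as (h & Hh & Hf); try lra.
  { eapply is_derive_eq; [apply energy_der, Hs|]. rewrite S0, S1, Cmod_0, Cmod_1. ring. }
  assert (E0 : energy w s s1 0 = 0) by (unfold energy, Re; rewrite S0; simpl; ring).
  rewrite E0 in Hf. set (f := energy w s s1) in *.
  assert (G : forall x, h <= x -> f h + 2 * c * f h * (x - h) <= f x).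
  { intros x Hx.
    assert (f h - 2 * c * f h * h <= f x - 2 * c * f h * x); [|lra].
    eapply (incr_of_deriv (fun t => f t - 2 * c * f h * t)); [lra| |].
    - intros t Ht. apply rder_minus; [apply energy_der, Hs|apply rder_scal, rder_id].
    - intros t Ht. cbv beta.
      generalize (energy_der_ge_energy s s1 t ltac:(lra)).
      fold f. assert (f h <= f t) by (apply energy_incr; auto; lra).
      generalize (Rle_abs (f t)); intros. nra. }
  exists (Rmin (f h) (2 * c * f h)). split.
  - apply Rmin_glb_lt; [lra|]. apply Rmult_lt_0_compat; lra.
  - intros x Hx. generalize (Rmin_l (f h) (2 * c * f h)), (Rmin_r (f h) (2 * c * f h)).
    generalize (G x ltac:(lra)). set (b := Rmin _ _). intros.
    assert (b * (x - h) <= 2 * c * f h * (x - h)) by (apply Rmult_le_compat_r; lra).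
    assert (0 < b) by (apply Rmin_glb_lt; [lra|]; apply Rmult_lt_0_compat; lra).
    nra.
Qed.

(* Weyl disc: if [cc + mu * s] has nonpositive energy at [x], then [mu] is
   within distance [1 / energy s x] of [- cc x / s x]. *)
Lemma energy_disc (cc cc1 s s1 : R -> C) (mu : C) (x : R) :
  solves P cc cc1 -> solves P s s1 -> s 0 = RtoC 0 -> s1 0 = RtoC 1 ->
  cc 0 = RtoC 1 -> cc1 0 = RtoC 0 -> s x <> RtoC 0 ->
  let D := (mu + cc x / s x)%C in
  Rabs (energy w (fun t => cc t + mu * s t)%C (fun t => cc1 t + mu * s1 t)%C x
        - Cmod D ^ 2 * energy w s s1 x) <= Cmod D.
Proof.
  intros Hc Hs S0 S1 C0 C1 Hsx D.
  assert (W := wronskian_const P cc cc1 s s1 Hc Hs x). rewrite S0, S1, C0, C1 in W.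
  assert (E1 : (cc x + mu * s x)%C = (D * s x)%C) by (unfold D; field; auto).
  (* By the Wronskian identity the slope splits into [D * s1 x] and [- / s x]. The first part
     contributes [|D|^2] times the energy of [s], the second a cross term of size at most [|D|]. *)
  assert (E2 : (cc1 x + mu * s1 x)%C = (- / s x + D * s1 x)%C).
  { unfold D. assert (Z : (cc1 x)%C = ((cc x * s1 x - (RtoC 1 * RtoC 1 - RtoC 0 * RtoC 0)) / s x)%C).
    { rewrite <- W. field; auto. }
    rewrite Z. field; auto. }
  destruct P_coer as (_ & Hw & _).
  unfold energy. rewrite E1, E2.
  replace (Re (w * ((- / s x + D * s1 x) * Cconj (D * s x))) - Cmod D ^ 2 * Re (w * (s1 x * Cconj (s x))))
    with (Re (w * (- / s x * Cconj (D * s x)))).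
  - eapply Rle_trans; [apply Re_le_Cmod|].
    rewrite !Cmod_mult, Cmod_opp, Cmod_inv, Cmod_Cconj, Cmod_mult by auto.
    assert (Cmod (s x) <> 0) by (intros Z; apply Hsx, Cmod_eq_0, Z).
    replace (Cmod w * (/ Cmod (s x) * (Cmod D * Cmod (s x)))) with (Cmod w * Cmod D) by (field; auto).
    generalize (Cmod_ge_0 D); intros; nra.
  - rewrite <- Re_Cconj_mul. unfold Re. destruct (/ s x)%C. simpl. ring.
Qed.

(** The slope [mu n] imposes a Dirichlet condition at [X n], hence zero energy there and nonpositive
    energy on [[0, X n]]. The disc estimate at [X k] puts every later [mu n] within [/ f (X k)] of
    [mu k], so the slopes converge, and in the limit the energy is nonpositive on the whole
    half-line. *)
Lemma decaying_energy : exists v v1, solves P v v1 /\ v 0 = RtoC 1 /\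
  forall x, 0 <= x -> energy w v v1 x <= 0.
Proof.
  destruct P_reg as [Pc Pb].
  destruct (ode_exists P (RtoC 1) (RtoC 0) Pc Pb) as (cc & cc1 & Hcc & C0 & C1).
  destruct (ode_exists P (RtoC 0) (RtoC 1) Pc Pb) as (s & s1 & Hs & S0 & S1).
  destruct (energy_grows s s1 Hs S0 S1) as (b & Hb & Hgr).
  set (f := energy w s s1) in *.
  assert (Hpos : forall x, 1 <= x -> 0 < f x).
  { intros x Hx. apply Rlt_le_trans with (b * x); [apply Rmult_lt_0_compat; lra|auto]. }
  assert (Hsx : forall x, 1 <= x -> s x <> RtoC 0).
  { intros x Hx Z. specialize (Hpos x Hx). unfold f, energy, Re in Hpos. rewrite Z in Hpos.
    simpl in Hpos. lra. }
  (* The shift by one keeps [X n >= 1], where the lower bound of [energy_grows] applies. *)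
  set (X := fun n => INR (S n)).
  assert (HX : forall n, 1 <= X n).
  { intros n. unfold X. rewrite S_INR. generalize (pos_INR n); lra. }
  assert (HXm : forall k n, (k <= n)%nat -> X k <= X n).
  { intros k n Hkn. apply le_INR. lia. }
  set (mu := fun n => (- (cc (X n) / s (X n)))%C).
  set (v := fun m x => (cc x + m * s x)%C). set (v1 := fun m x => (cc1 x + m * s1 x)%C).
  assert (Hv : forall m, solves P (v m) (v1 m)) by (intros m; apply solves_lin; auto).
  assert (Disc : forall m n, Rabs (energy w (v m) (v1 m) (X n) - Cmod (m - mu n)%C ^ 2 * f (X n))
     <= Cmod (m - mu n)%C).
  { intros m n. assert (Z := energy_disc cc cc1 s s1 m (X n) Hcc Hs S0 S1 C0 C1 (Hsx _ (HX n))).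
    cbv zeta in Z. unfold mu. replace (m - - (cc (X n) / s (X n)))%C with (m + cc (X n) / s (X n))%C by ring.
    exact Z. }
  assert (Hmu : forall k n, (k <= n)%nat -> Cmod (mu n - mu k)%C <= / f (X k)).
  { intros k n Hkn.
    assert (E0 : energy w (v (mu n)) (v1 (mu n)) (X n) <= 0).
    { specialize (Disc (mu n) n). replace (mu n - mu n)%C with (RtoC 0) in Disc by ring.
      rewrite Cmod_0 in Disc. rewrite pow_ne_zero, Rmult_0_l, Rminus_0_r in Disc by lia.
      generalize (Rle_abs (energy w (v (mu n)) (v1 (mu n)) (X n))). lra. }
    assert (E1 : energy w (v (mu n)) (v1 (mu n)) (X k) <= energy w (v (mu n)) (v1 (mu n)) (X n)).
    { apply energy_incr; auto. generalize (HX k); split; [lra|auto]. }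
    specialize (Disc (mu n) k).
    set (d := Cmod (mu n - mu k)%C) in *.
    assert (F := Hpos _ (HX k)).
    apply Rabs_le_between in Disc.
    assert (d * (d * f (X k)) <= d * 1) by (generalize (pow2_ge_0 d); nra).
    destruct (Cmod_ge_0 (mu n - mu k)%C) as [Z|Z]; fold d in Z.
    - apply Rmult_le_reg_l in H; [|exact Z].
      apply Rmult_le_reg_r with (f (X k)); [exact F|]. rewrite Rinv_l; lra.
    - rewrite <- Z. left; apply Rinv_0_lt_compat, F. }
  assert (Hlim : is_lim_seq (fun k => / f (X k)) 0).
  { apply (is_lim_seq_le_le (fun _ => 0) _ (fun k => / (b * INR (S k)))).
    - intros k. assert (F := Hpos _ (HX k)). split; [left; apply Rinv_0_lt_compat, F|].
      apply Rinv_le_contravar; [|apply Hgr, HX].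
      apply Rmult_lt_0_compat; [auto|generalize (HX k); unfold X; lra].
    - apply is_lim_seq_const.
    - replace (Finite 0) with (Rbar_inv p_infty) by reflexivity.
      apply is_lim_seq_inv; [|easy].
      assert (Z := is_lim_seq_scal_l (fun k => INR (S k)) b p_infty).
      replace (Rbar_mult b p_infty) with p_infty in Z.
      + apply Z. apply -> is_lim_seq_incr_1. apply is_lim_seq_INR.
      + simpl. destruct (Rle_dec 0 b) as [H|H]; [|lra].
        destruct (Rle_lt_or_eq_dec 0 b H); [reflexivity|lra]. }
  set (m := clim mu).
  assert (Hm := clim_bound mu (fun k => / f (X k)) Hlim Hmu). fold m in Hm.
  exists (v m), (v1 m). split; [auto|]. split.
  { unfold v. rewrite C0, S0. ring. }
  intros x Hx.
  (* The energy at x is at most that at [X k], which is at most [d + d^2 * f (X k)] with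
     [d <= / f (X k)]. *)
  apply (is_lim_seq_le_loc (fun _ => energy w (v m) (v1 m) x) (fun k => 2 * / f (X k))
    (energy w (v m) (v1 m) x) 0).
  - destruct (nfloor_ex x Hx) as [n [_ Hn]].
    exists n. intros k Hk.
    assert (HxX : x <= X k).
    { unfold X. rewrite S_INR. apply le_INR in Hk. lra. }
    eapply Rle_trans; [apply (energy_incr _ _ x (X k)); auto|].
    specialize (Disc m k). specialize (Hm k). assert (F := Hpos _ (HX k)).
    set (d := Cmod (m - mu k)%C) in *.
    assert (D2 : d ^ 2 * f (X k) <= / f (X k)).
    { replace (/ f (X k)) with ((/ f (X k)) ^ 2 * f (X k)) by (field; lra).
      apply Rmult_le_compat_r; [lra|]. apply pow_incr; split; [apply Cmod_ge_0|exact Hm]. }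
    generalize (Rle_abs (energy w (v m) (v1 m) (X k) - d ^ 2 * f (X k))). lra.
  - apply is_lim_seq_const.
  - replace (Finite 0) with (Rbar_mult 2 0) by (simpl; f_equal; ring).
    apply is_lim_seq_scal_l, Hlim.
Qed.
End Weyl.

(** * Exponential decay with uniform constants *)

Lemma exp_decay_le (r s x : R) : r <= s -> 0 <= x -> exp (- s * x) <= exp (- r * x).
Proof. intros; apply exp_le; nra. Qed.

(** The quantity [c |v|^2 + f] is increasing: if it took a value [d > 0], then
    [f' >= c |v|^2 >= d - f >= d] from there on, and the energy f would become positive. Hence
    [c |v|^2 <= - f]. Moreover [f' >= - 2 c f] makes [- f] decay at rate [2 c] from
    [- f 0 <= |v1 0|]. *)
Lemma energy_controls_decay (w : C) (c B : R) (P v v1 : R -> C) :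
  coercive w c B P -> solves P v v1 -> v 0 = RtoC 1 ->
  (forall x, 0 <= x -> energy w v v1 x <= 0) ->
  forall x, 0 <= x -> Cmod (v x) <= sqrt (Cmod (v1 0) / c) * exp (- c * x).
Proof.
  intros Hco Hv V0 He x Hx.
  assert (Hco' := Hco). destruct Hco' as (Hc & Hw & Hwc & _).
  set (f := energy w v v1) in *.
  assert (H1 : c * Cmod (v x) ^ 2 + f x <= 0).
  { apply Rnot_lt_le; intros Hd. set (d := c * Cmod (v x) ^ 2 + f x) in *.
    assert (G : forall y, x <= y -> d <= c * Cmod (v y) ^ 2 + f y).
    { intros y Hy. apply (incr_of_deriv (fun t => c * Cmod (v t) ^ 2 + f t)
        (fun t => c * (2 * Re (Cconj (v t) * v1 t)) +
           (Re (w * P t) * Cmod (v t) ^ 2 + Re w * Cmod (v1 t) ^ 2))); [lra| |].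
      - intros t Ht. apply (rder_plus (fun t => c * Cmod (v t) ^ 2) f);
          [apply (rder_scal c (fun t => Cmod (v t) ^ 2)), cder_Cmod2, (proj1 Hv)|apply energy_der, Hv].
      - intros t Ht; cbv beta.
        generalize (energy_der_ge w c B P Hco v v1 t ltac:(lra)).
        generalize (Re_le_Cmod (Cconj (v t) * v1 t)). rewrite Cmod_mult, Cmod_Cconj. intros Hr Hg.
        generalize (Rabs_maj2 (Re (Cconj (v t) * v1 t))), (pow2_ge_0 (Cmod (v t) - Cmod (v1 t))); nra. }
    (* With slope at least [d], the energy is at least 1 at this point. *)
    set (y := x + (- f x + 1) / d).
    assert (Hxy : x <= y).
    { unfold y. generalize (He x Hx). intros.
      assert (0 < (- f x + 1) / d) by (apply Rdiv_lt_0_compat; lra). lra. }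
    assert (Z : f x - d * x <= f y - d * y).
    { eapply (incr_of_deriv (fun t => f t - d * t)); [lra| |].
      - intros t Ht. apply (rder_minus f (fun t => d * t)); [apply energy_der, Hv|apply rder_scal, rder_id].
      - intros t Ht; cbv beta. change one with 1.
        generalize (energy_der_ge w c B P Hco v v1 t ltac:(lra)), (G t ltac:(lra)), (He t ltac:(lra)).
        generalize (pow2_ge_0 (Cmod (v1 t))). nra. }
    assert (d * (y - x) = - f x + 1) by (unfold y; field; lra).
    generalize (He y ltac:(lra)). lra. }
  assert (H2 : f 0 * exp (2 * c * 0) <= f x * exp (2 * c * x)).
  { eapply (incr_of_deriv (fun t => f t * exp (2 * c * t))); [lra| |].
    - intros t Ht. apply (rder_mult f (fun t => exp (2 * c * t))); [apply energy_der, Hv|apply rder_exp].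
    - intros t Ht; cbv beta.
      generalize (energy_der_ge_energy w c B P Hco v v1 t ltac:(lra)). fold f.
      generalize (Rabs_maj2 (f t)), (exp_pos (2 * c * t)). intros.
      match goal with |- 0 <= ?u * ?e + _ =>
        replace (u * e + f t * (2 * c * e)) with (e * (u + 2 * c * f t)) by ring end.
      apply Rmult_le_pos; [lra|]. destruct Hco as (Hc0 & _). nra. }
  rewrite Rmult_0_r, exp_0 in H2.
  assert (H3 : - f 0 <= Cmod (v1 0)).
  { generalize (energy_abs w v v1 0 Hw), (Rabs_maj2 (f 0)). fold f. rewrite V0, Cmod_1. lra. }
  assert (E : exp (2 * c * x) = / exp (- c * x) ^ 2).
  { simpl. rewrite Rmult_1_r, <- exp_plus, <- exp_Ropp. f_equal; ring. }
  assert (Hp := exp_pos (- c * x)).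
  assert (H4 : c * Cmod (v x) ^ 2 <= Cmod (v1 0) * exp (- c * x) ^ 2).
  { rewrite E in H2. assert (0 < exp (- c * x) ^ 2) by (apply pow_lt; auto).
    apply Rmult_le_compat_r with (r := exp (- c * x) ^ 2) in H2; [|lra].
    rewrite Rmult_1_r, (Rmult_assoc (f x)), Rinv_l, Rmult_1_r in H2 by lra.
    apply Rmult_le_compat_r with (r := exp (- c * x) ^ 2) in H3; lra. }
  apply Rsqr_incr_0_var.
  - rewrite Rsqr_mult, Rsqr_sqrt, !Rsqr_pow2.
    + apply Rmult_le_reg_l with c; [lra|].
      replace (c * (Cmod (v1 0) / c * exp (- c * x) ^ 2)) with (Cmod (v1 0) * exp (- c * x) ^ 2) by (field; lra).
      exact H4.
    + apply Rdiv_le_0_compat; [apply Cmod_ge_0|lra].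
  - apply Rmult_le_pos; [apply sqrt_pos|lra].
Qed.

Lemma coercive_B_pos w c B P : coercive w c B P -> 0 <= B.
Proof.
  intros (_ & _ & _ & _ & H). specialize (H 0 (Rle_refl 0)).
  rewrite Rmult_0_r, exp_0 in H. generalize (Cmod_ge_0 (P 0)); lra.
Qed.

(** The slope at x is compared with the increment of v over [[x, x + 1]]. On that interval [v1]
    varies by at most [D], a bound for [P v] obtained from growth at rate [c / 2] against decay at
    rate [c]. *)
Lemma derivative_decay (c B S : R) (P v v1 : R -> C) : 0 < c -> 0 <= S -> 0 <= B ->
  (forall x, 0 <= x -> Cmod (P x) <= B * exp (c / 2 * x)) -> solves P v v1 ->
  (forall x, 0 <= x -> Cmod (v x) <= S * exp (- c * x)) ->
  forall x, 0 <= x -> Cmod (v1 x) <= (B + 2) * S * exp (- (c / 2) * x).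
Proof.
  intros Hc HS HB HP [Hv Hv1] Hd x Hx.
  set (D := B * S * exp (- (c / 2) * x)).
  assert (HD : 0 <= D).
  { unfold D. repeat apply Rmult_le_pos; auto. left; apply exp_pos. }
  assert (HD2 : forall t, x <= t -> Cmod (P t * v t)%C <= D).
  { intros t Ht. rewrite Cmod_mult.
    apply Rle_trans with (B * exp (c / 2 * t) * (S * exp (- c * t))).
    - apply Rmult_le_compat; auto using Cmod_ge_0; [apply HP|apply Hd]; lra.
    - replace (B * exp (c / 2 * t) * (S * exp (- c * t))) with (B * S * (exp (c / 2 * t) * exp (- c * t))) by ring.
      rewrite <- exp_plus. unfold D. apply Rmult_le_compat_l; [apply Rmult_le_pos; auto|].
      apply exp_le. nra. }
  assert (H1 : forall t, x <= t -> Cmod (v1 t - v1 x)%C <= D * t - D * x).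
  { intros t Ht. eapply (dominated_increment v1 _ (fun t => D * t) (fun t => D * 1)); auto.
    - intros y _; apply Hv1.
    - intros y _; apply rder_scal, rder_id.
    - intros y Hy; cbv beta. rewrite Rmult_1_r. apply HD2; lra. }
  assert (H2 : Cmod ((v (x + 1)%R - v1 x * RtoC (x + 1)%R) - (v x - v1 x * RtoC x))%C <= D * (x + 1) - D * x).
  { eapply (dominated_increment (fun t => v t - v1 x * RtoC t)%C (fun t => v1 t - v1 x * RtoC 1)%C
      (fun t => D * t) (fun t => D * 1)); [lra| | |].
    - intros y _. apply cder_minus; [apply Hv|]. apply cder_scal, cder_RtoC, rder_id.
    - intros y _; apply rder_scal, rder_id.
    - intros y Hy; cbv beta. rewrite Cmult_1_r. generalize (H1 y ltac:(lra)). nra. }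
  assert (E : (v1 x = (v (x + 1)%R - v x) + - ((v (x + 1)%R - v1 x * RtoC (x + 1)%R) - (v x - v1 x * RtoC x)))%C).
  { rewrite RtoC_plus. ring. }
  rewrite E. eapply Rle_trans; [apply Cmod_triangle|]. rewrite Cmod_opp.
  assert (H3 : Cmod (v (x + 1)%R - v x)%C <= 2 * S * exp (- (c / 2) * x)).
  { eapply Rle_trans; [apply Cmod_triangle|]. rewrite Cmod_opp.
    generalize (Hd x Hx), (Hd (x + 1) ltac:(lra)).
    assert (exp (- c * (x + 1)) <= exp (- (c / 2) * x)) by (apply exp_le; nra).
    assert (exp (- c * x) <= exp (- (c / 2) * x)) by (apply exp_le; nra). nra. }
  unfold D in *. nra.
Qed.

Lemma weyl_exists (c B : R) : exists K, forall w P, regular P -> coercive w c B P ->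
  exists v v1, weyl K (c / 2) P v v1.
Proof.
  (* An a priori bound for [m = |v1 0|], since the decay estimate bounds v only through m. It solves
     [m <= 1 + S * (1 + B)] with [c * S^2 = m], using [S * (1 + B) <= m / 2 + (1 + B)^2 / (2 c)]. *)
  set (M0 := 2 + (1 + B) ^ 2 / c).
  (* The absolute value appears because the constant is fixed before any [P], and it is coercivity
     of [P] that yields [0 <= B]. *)
  exists ((Rabs B + 2) * sqrt (M0 / c)). intros w P Hreg Hco.
  destruct (decaying_energy w c B P Hreg Hco) as (v & v1 & Hv & V0 & He).
  assert (Hd := energy_controls_decay w c B P v v1 Hco Hv V0 He).
  assert (HB := coercive_B_pos _ _ _ _ Hco).
  assert (Hco' := Hco). destruct Hco' as (Hc & Hw & Hwc & HP & HPB).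
  set (m := Cmod (v1 0)) in *. set (S := sqrt (m / c)) in *.
  assert (Hm : 0 <= m) by apply Cmod_ge_0.
  assert (HS : 0 <= S) by apply sqrt_pos.
  assert (HS2 : c * S ^ 2 = m).
  { unfold S. rewrite pow2_sqrt; [field; lra|]. apply Rdiv_le_0_compat; lra. }
  assert (Hd1 := derivative_decay c B S P v v1 Hc HS HB HPB Hv Hd).
  assert (Hc1 : c <= 1).
  { generalize (Re_le_Cmod w), (Rle_abs (Re w)); lra. }
  (* The Wronskian of v and exp (-x) bounds v1 0 by a multiple of its square root. *)
  assert (Hm1 : Cmod (v 0 + v1 0)%C <= S * (1 + B)).
  { apply (le_of_exp_decay _ _ ((B + 3) * S) 1 Rlt_0_1). intros x Hx.
    replace (- (1) * x) with (- 1 * x) by ring.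
    assert (Hv' := Hv). destruct Hv' as [D0 D1].
    assert (Hde : forall t, is_derive (fun t => - exp (- 1 * t)) t (exp (- 1 * t))).
    { intros t; auto_derive; [easy|ring]. }
    assert (H : Cmod (RtoC (- exp (- 1 * x)) * (v x + v1 x) - RtoC (- exp (- 1 * 0)) * (v 0 + v1 0))%C <=
      - (S * (1 + B)) * exp (- 1 * x) - - (S * (1 + B)) * exp (- 1 * 0)).
    { eapply (dominated_increment (fun t => RtoC (- exp (- 1 * t)) * (v t + v1 t))%C
        (fun t => RtoC (exp (- 1 * t)) * ((RtoC 1 - P t) * v t))%C
        (fun t => - (S * (1 + B)) * exp (- 1 * t))); [lra| | |].
      - intros t Ht. eapply cder_eq.
        + apply cder_mult; [apply cder_RtoC, Hde|apply cder_plus; [apply D0|apply D1]].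
        + cbv beta. rewrite RtoC_opp. ring.
      - intros t Ht. apply rder_scal, rder_exp.
      - intros t Ht; cbv beta. rewrite !Cmod_mult, Cmod_R, Rabs_right by (left; apply exp_pos).
        assert (Cmod (RtoC 1 - P t)%C * Cmod (v t) <= S * (1 + B)); [|generalize (exp_pos (- 1 * t)); nra].
        assert (Cmod (RtoC 1 - P t)%C <= 1 + B * exp (c / 2 * t)).
        { eapply Rle_trans; [apply Cmod_triangle|]. rewrite Cmod_opp, Cmod_1.
          generalize (HPB t ltac:(lra)); lra. }
        eapply Rle_trans.
        { apply Rmult_le_compat; [apply Cmod_ge_0|apply Cmod_ge_0|exact H|apply Hd; lra]. }
        assert (E1 : exp (- c * t) <= 1) by (rewrite <- exp_0; apply exp_le; nra).
        assert (E2 : exp (c / 2 * t) * exp (- c * t) <= 1).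
        { rewrite <- exp_plus, <- exp_0; apply exp_le; nra. }
        replace ((1 + B * exp (c / 2 * t)) * (S * exp (- c * t))) with
          (S * (exp (- c * t) + B * (exp (c / 2 * t) * exp (- c * t)))) by ring.
        apply Rmult_le_compat_l; [auto|]. nra. }
    rewrite Rmult_0_r, exp_0 in H.
    replace (v 0 + v1 0)%C with ((RtoC (- exp (- 1 * x)) * (v x + v1 x) - RtoC (-(1)) * (v 0 + v1 0)) +
       RtoC (exp (- 1 * x)) * (v x + v1 x))%C.
    2: { rewrite !RtoC_opp. ring. }
    eapply Rle_trans; [apply Cmod_triangle|]. rewrite Cmod_mult, Cmod_R, Rabs_right by (left; apply exp_pos).
    assert (Hvx : Cmod (v x + v1 x)%C <= (B + 3) * S).
    { eapply Rle_trans; [apply Cmod_triangle|]. generalize (Hd x Hx), (Hd1 x Hx).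
      assert (exp (- c * x) <= 1) by (rewrite <- exp_0; apply exp_le; nra).
      assert (exp (- (c / 2) * x) <= 1) by (rewrite <- exp_0; apply exp_le; nra).
      assert (0 <= (B + 2) * S) by (apply Rmult_le_pos; lra). nra. }
    assert (0 <= S * (1 + B)) by (apply Rmult_le_pos; lra).
    assert (Hp := exp_pos (- 1 * x)).
    apply Rmult_le_compat_l with (r := exp (- 1 * x)) in Hvx; [|lra].
    assert (0 <= S * (1 + B) * exp (- 1 * x)) by (apply Rmult_le_pos; lra). lra. }
  assert (Hm2 : m <= M0).
  { assert (m <= 1 + S * (1 + B)).
    { unfold m. replace (v1 0) with ((v 0 + v1 0) + - v 0)%C by ring.
      eapply Rle_trans; [apply Cmod_triangle|]. rewrite Cmod_opp, V0, Cmod_1, <- V0. lra. }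
    assert (S * (1 + B) <= c * S ^ 2 / 2 + (1 + B) ^ 2 / c / 2).
    { apply Rminus_le_0.
      replace (c * S ^ 2 / 2 + (1 + B) ^ 2 / c / 2 - S * (1 + B)) with ((c * S - (1 + B)) ^ 2 / (2 * c)) by (field; lra).
      apply Rdiv_le_0_compat; [apply pow2_ge_0|lra]. }
    unfold M0. lra. }
  assert (HSK : S <= sqrt (M0 / c)).
  { apply sqrt_le_1_alt. apply Rmult_le_compat_r; [left; apply Rinv_0_lt_compat|]; lra. }
  exists v, v1. split; [auto|split; [auto|]]. intros x Hx.
  rewrite (Rabs_right B) by lra.
  assert (Hk : (B + 2) * S <= (B + 2) * sqrt (M0 / c)) by (apply Rmult_le_compat_l; lra).
  assert (Hex : exp (- c * x) <= exp (- (c / 2) * x)) by (apply exp_le; nra).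
  assert (He0 := exp_pos (- (c / 2) * x)).
  split.
  - eapply Rle_trans; [apply Hd, Hx|].
    apply Rmult_le_compat; [auto|left; apply exp_pos| |auto].
    eapply Rle_trans; [|exact Hk]. nra.
  - eapply Rle_trans; [apply Hd1, Hx|]. apply Rmult_le_compat_r; lra.
Qed.

(* Integrate the Wronskian of v and the approximate solution g. *)
Lemma weyl_residual (K r : R) (P v v1 g g1 g2 : R -> C) (G eps : R) : 0 < r ->
  weyl K r P v v1 ->
  (forall x, cder g x (g1 x)) -> (forall x, cder g1 x (g2 x)) ->
  (forall x, 0 <= x -> Cmod (g x) <= G /\ Cmod (g1 x) <= G) ->
  (forall x, 0 <= x -> Cmod (g2 x - P x * g x)%C <= eps) ->
  Cmod (v1 0 * g 0 - g1 0)%C <= K * eps / r.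
Proof.
  intros Hr ([D0 D1] & V0 & Hd) Hg Hg1 HG Heps.
  assert (HK : 0 <= K).
  { destruct (Hd 0 (Rle_refl 0)) as [H _]. rewrite Rmult_0_r, exp_0 in H.
    generalize (Cmod_ge_0 (v 0)); lra. }
  assert (He : 0 <= eps).
  { eapply Rle_trans; [apply Cmod_ge_0|apply (Heps 0 (Rle_refl 0))]. }
  apply (le_of_exp_decay _ _ (2 * K * G) r Hr). intros x Hx.
  assert (H : Cmod ((v x * g1 x - v1 x * g x) - (v 0 * g1 0 - v1 0 * g 0))%C <=
    - (K * eps / r) * exp (- r * x) - - (K * eps / r) * exp (- r * 0)).
  { eapply (dominated_increment (fun t => v t * g1 t - v1 t * g t)%C
      (fun t => v t * (g2 t - P t * g t))%C
      (fun t => - (K * eps / r) * exp (- r * t))); [lra| | |].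
    - intros t Ht. eapply cder_eq.
      + apply cder_minus; apply cder_mult; [apply D0|apply Hg1|apply D1|apply Hg].
      + cbv beta; ring.
    - intros t Ht; apply rder_scal, rder_exp.
    - intros t Ht; cbv beta. rewrite Cmod_mult.
      replace (- (K * eps / r) * (- r * exp (- r * t))) with (K * exp (- r * t) * eps) by (field; lra).
      apply Rmult_le_compat; auto using Cmod_ge_0; [apply Hd|apply Heps]; lra. }
  rewrite Rmult_0_r, exp_0 in H.
  replace (v1 0 * g 0 - g1 0)%C with
    (((v x * g1 x - v1 x * g x) - (v 0 * g1 0 - v1 0 * g 0)) + - (v x * g1 x - v1 x * g x))%C.
  2: { rewrite V0. ring. }
  eapply Rle_trans; [apply Cmod_triangle|]. rewrite Cmod_opp.
  assert (H1 : Cmod (v x * g1 x - v1 x * g x)%C <= 2 * K * G * exp (- r * x)).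
  { eapply Rle_trans; [apply Cmod_triangle|]. rewrite Cmod_opp, !Cmod_mult.
    destruct (Hd x Hx) as [Ha Hb]. destruct (HG x Hx) as [Hc' Hd'].
    assert (Cmod (v x) * Cmod (g1 x) <= K * exp (- r * x) * G) by (apply Rmult_le_compat; auto using Cmod_ge_0).
    assert (Cmod (v1 x) * Cmod (g x) <= K * exp (- r * x) * G) by (apply Rmult_le_compat; auto using Cmod_ge_0).
    lra. }
  assert (0 <= K * eps / r * exp (- r * x)).
  { apply Rmult_le_pos; [apply Rdiv_le_0_compat; [apply Rmult_le_pos; auto|lra]|left; apply exp_pos]. }
  lra.
Qed.

(** * Power potentials *)

Lemma cis_plus (s t : R) : cis (s + t) = (cis s * cis t)%C.
Proof. unfold cis; rewrite cos_plus, sin_plus; apply injective_projections; simpl; ring. Qed.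

Lemma cis_0 : cis 0 = RtoC 1.
Proof. unfold cis; rewrite cos_0, sin_0; reflexivity. Qed.

Lemma Cmod_cis (t : R) : Cmod (cis t) = 1.
Proof.
  unfold Cmod, cis; simpl fst; simpl snd. rewrite <- sqrt_1. f_equal.
  rewrite <- (sin2_cos2 t). unfold Rsqr. ring.
Qed.

Lemma cis_neq_0 (t : R) : cis t <> RtoC 0.
Proof. intros H. generalize (Cmod_cis t). rewrite H, Cmod_0. lra. Qed.

Lemma cis_inv (t : R) : (cis t * cis (- t))%C = RtoC 1.
Proof. rewrite <- cis_plus, Rplus_opp_r; apply cis_0. Qed.

Lemma cder_cis (c x : R) : cder (fun t => cis (c * t)) x (Ci * RtoC c * cis (c * x))%C.
Proof.
  apply cder_iff; unfold cis; simpl; split; auto_derive; auto; ring.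
Qed.

Lemma cis_lipschitz (c d : R) : 0 <= d -> Cmod (cis (c * d) - RtoC 1)%C <= Rabs c * d.
Proof.
  intros Hd. rewrite <- cis_0.
  replace (cis 0) with (cis (c * 0)) by (now rewrite Rmult_0_r).
  replace (Rabs c * d) with (Rabs c * d - Rabs c * 0) by ring.
  eapply (dominated_increment (fun t => cis (c * t)) _ (fun t => Rabs c * t) (fun t => Rabs c * 1)); auto.
  - intros t _; apply cder_cis.
  - intros t _; apply rder_scal, rder_id.
  - intros t _; cbv beta. rewrite !Cmod_mult, Cmod_cis, Cmod_Ci, Cmod_R. lra.
Qed.

Lemma cis_taylor (c d : R) : 0 <= d ->
  Cmod (cis (c * d) - (RtoC 1 + Ci * RtoC (c * d)))%C <= c ^ 2 * d ^ 2.
Proof.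
  intros Hd.
  assert (H : Cmod ((cis (c * d) - (RtoC 1 + Ci * RtoC c * RtoC d)) - (cis (c * 0) - (RtoC 1 + Ci * RtoC c * RtoC 0)))%C
    <= c ^ 2 * d * d - c ^ 2 * d * 0).
  { eapply (dominated_increment (fun t => cis (c * t) - (RtoC 1 + Ci * RtoC c * RtoC t))%C
     _ (fun t => c ^ 2 * d * t) (fun t => c ^ 2 * d * 1)); auto.
    - intros t _. apply cder_minus; [apply cder_cis|apply cder_lin].
    - intros t _; apply rder_scal, rder_id.
    - intros t Ht; cbv beta.
      replace (Ci * RtoC c * cis (c * t) - Ci * RtoC c)%C with (Ci * RtoC c * (cis (c * t) - RtoC 1))%C by ring.
      rewrite !Cmod_mult, Cmod_Ci, Cmod_R, <- (pow2_abs c).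
      generalize (cis_lipschitz c t ltac:(lra)), (Rabs_pos c). intros.
      apply Rle_trans with (1 * Rabs c * (Rabs c * t)); [apply Rmult_le_compat_l; lra|].
      replace (1 * Rabs c * (Rabs c * t)) with (Rabs c ^ 2 * t) by ring.
      rewrite Rmult_1_r. apply Rmult_le_compat_l; [apply pow2_ge_0|lra]. }
  rewrite Rmult_0_r, cis_0 in H. rewrite RtoC_mult.
  replace (cis (c * d) - (RtoC 1 + Ci * (RtoC c * RtoC d)))%C with
    (cis (c * d) - (RtoC 1 + Ci * RtoC c * RtoC d) - (RtoC 1 - (RtoC 1 + Ci * RtoC c * RtoC 0)))%C by ring.
  eapply Rle_trans; [exact H|]. right; ring.
Qed.

Definition cexp (z : C) : C := (RtoC (exp (Re z)) * cis (Im z))%C.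

Lemma Cmod_cexp (z : C) : Cmod (cexp z) = exp (Re z).
Proof.
  unfold cexp. rewrite Cmod_mult, Cmod_cis, Cmod_R, Rabs_right; [ring|left; apply exp_pos].
Qed.

Lemma cder_cexp (z : R -> C) (x : R) (l : C) : cder z x l ->
  cder (fun t => cexp (z t)) x (l * cexp (z x))%C.
Proof.
  intros H. assert (H1 := cder_fst _ _ _ H). assert (H2 := cder_snd _ _ _ H).
  apply cder_iff; unfold cexp, cis, Re, Im; simpl; split.
  - apply (rder_ext (fun y => exp (fst (z y)) * cos (snd (z y)))); [intros; ring|].
    eapply is_derive_eq.
    + apply (rder_mult (fun y => exp (fst (z y))) (fun y => cos (snd (z y)))).
      * apply (is_derive_comp exp (fun y => fst (z y))); [apply is_derive_exp|exact H1].
      * apply (is_derive_comp cos (fun y => snd (z y))); [apply is_derive_cos|exact H2].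
    + unfold scal; simpl; unfold mult; simpl. ring.
  - apply (rder_ext (fun y => exp (fst (z y)) * sin (snd (z y)))); [intros; ring|].
    eapply is_derive_eq.
    + apply (rder_mult (fun y => exp (fst (z y))) (fun y => sin (snd (z y)))).
      * apply (is_derive_comp exp (fun y => fst (z y))); [apply is_derive_exp|exact H1].
      * apply (is_derive_comp sin (fun y => snd (z y))); [apply is_derive_sin|exact H2].
    + unfold scal; simpl; unfold mult; simpl. ring.
Qed.

(** * Powers of the positive part *)

Local Notation ppp := pos_part_pow.

Lemma ppp_pos (x p : R) : 0 < x -> ppp x p = Rpower x p.
Proof. intros H; unfold ppp; destruct (Rlt_dec 0 x); [reflexivity|lra]. Qed.

Lemma ppp_nonpos (x p : R) : x <= 0 -> ppp x p = 0.
Proof. intros H; unfold ppp; destruct (Rlt_dec 0 x); [lra|reflexivity]. Qed.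

Lemma ppp_ge_0 (x p : R) : 0 <= ppp x p.
Proof. unfold ppp; destruct (Rlt_dec 0 x); [left; apply exp_pos|lra]. Qed.

Lemma ppp_mono (x y p : R) : 0 <= p -> x <= y -> ppp x p <= ppp y p.
Proof.
  intros Hp Hxy. destruct (Rlt_dec 0 x) as [H|H].
  - rewrite !ppp_pos by lra. apply Rle_Rpower_l; lra.
  - rewrite (ppp_nonpos x) by lra. apply ppp_ge_0.
Qed.

Lemma ppp_mult (x p : R) : x * ppp x p = ppp x (p + 1).
Proof.
  destruct (Rlt_dec 0 x) as [H|H].
  - rewrite !ppp_pos, Rpower_plus, Rpower_1 by lra. ring.
  - rewrite !ppp_nonpos by lra. ring.
Qed.

Lemma ppp_small (p eps : R) : 0 < p -> 0 < eps ->
  locally 0 (fun y => ppp y p < eps).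
Proof.
  intros Hp He. exists (mkposreal _ (exp_pos (ln eps / p))). intros y Hy.
  change (Rabs (y - 0) < exp (ln eps / p)) in Hy. rewrite Rminus_0_r in Hy.
  destruct (Rlt_dec 0 y) as [H|H]; [|rewrite ppp_nonpos; lra].
  rewrite ppp_pos by auto. rewrite Rabs_right in Hy by lra.
  unfold Rpower. replace eps with (exp (ln eps)) by (now apply exp_ln). apply exp_increasing.
  assert (Hl : ln y < ln eps / p) by (rewrite <- (ln_exp (ln eps / p)); apply ln_increasing; auto).
  apply Rmult_lt_compat_l with (r := p) in Hl; [|auto].
  replace (p * (ln eps / p)) with (ln eps) in Hl by (field; lra). exact Hl.
Qed.

(** The exponent is [p + 1] with [p > 0] so that the derivative exists at 0 too, where the
    difference quotient is [ppp h p]. *)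
Lemma ppp_der (x p : R) : 0 < p -> is_derive (fun y => ppp y (p + 1)) x ((p + 1) * ppp x p).
Proof.
  intros Hp. destruct (Rtotal_order x 0) as [H|[->|H]].
  - rewrite (ppp_nonpos x) by lra. rewrite Rmult_0_r.
    apply (is_derive_ext_loc (fun _ => 0)); [|apply rder_const].
    assert (Hx : 0 < - x) by lra. exists (mkposreal _ Hx). intros y Hy.
    change (Rabs (y - x) < - x) in Hy. apply Rabs_def2 in Hy. rewrite ppp_nonpos; lra.
  - rewrite (ppp_nonpos 0) by lra. rewrite Rmult_0_r.
    apply is_derive_Reals. intros eps Heps.
    destruct (ppp_small p eps Hp Heps) as [d Hd]. exists d. intros h Hh0 Hh.
    rewrite Rplus_0_l, (ppp_nonpos 0), !Rminus_0_r, <- ppp_mult by lra.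
    replace (h * ppp h p / h) with (ppp h p) by (field; auto).
    rewrite Rabs_right by (apply Rle_ge, ppp_ge_0). apply Hd.
    change (Rabs (h - 0) < d). now rewrite Rminus_0_r.
  - rewrite (ppp_pos x) by lra.
    apply (is_derive_ext_loc (fun y => Rpower y (p + 1))).
    + exists (mkposreal _ H). intros y Hy.
      change (Rabs (y - x) < x) in Hy. apply Rabs_def2 in Hy. rewrite ppp_pos; lra.
    + apply is_derive_Reals. replace p with (p + 1 - 1) at 2 by ring.
      now apply derivable_pt_lim_power.
Qed.

Lemma ppp_cont (x p : R) : 0 < p -> continuous (fun y => ppp y p) x.
Proof.
  intros Hp. destruct (Rtotal_order x 0) as [H|[->|H]].
  - apply (continuous_ext_loc _ (fun _ => 0)); [|apply continuous_const].
    assert (Hx : 0 < - x) by lra. exists (mkposreal _ Hx). intros y Hy.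
    change (Rabs (y - x) < - x) in Hy. apply Rabs_def2 in Hy. rewrite ppp_nonpos; lra.
  - apply filterlim_locally. intros eps.
    generalize (ppp_small p eps Hp (cond_pos eps)). apply filter_imp. intros y Hy.
    change (Rabs (ppp y p - ppp 0 p) < eps). rewrite (ppp_nonpos 0), Rminus_0_r by lra.
    rewrite Rabs_right by (apply Rle_ge, ppp_ge_0). exact Hy.
  - apply (continuous_ext_loc _ (fun y => Rpower y p)).
    + exists (mkposreal _ H). intros y Hy.
      change (Rabs (y - x) < x) in Hy. apply Rabs_def2 in Hy. rewrite ppp_pos; lra.
    + apply (ex_derive_continuous (V := R_NormedModule)). exists (p * Rpower x (p - 1)).
      apply is_derive_Reals. now apply derivable_pt_lim_power.
Qed.

Lemma ln_le_sub (x : R) : 0 < x -> ln x <= x - 1.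
Proof.
  intros H. generalize (exp_ineq1_le (ln x)). rewrite exp_ln by auto. lra.
Qed.

(** The inequality [ln z <= z - 1] at [z = eps * y / p] gives [p * ln y <= p * ln (p / eps) + eps *
    y - p]. *)
Lemma ppp_exp_bound (p eps : R) : 0 < p -> 0 < eps ->
  exists E, 0 < E /\ forall y, 0 <= y -> ppp y p <= E * exp (eps * y).
Proof.
  intros Hp He. exists (exp (p * ln (p / eps))). split; [apply exp_pos|]. intros y Hy.
  destruct (Rlt_dec 0 y) as [H|H].
  - rewrite ppp_pos by auto. unfold Rpower. rewrite <- exp_plus. apply exp_le.
    assert (Hq : 0 < p / eps) by (apply Rdiv_lt_0_compat; lra).
    assert (Hz : 0 < y / (p / eps)) by (apply Rdiv_lt_0_compat; lra).
    generalize (ln_le_sub _ Hz). unfold Rdiv at 1. rewrite ln_mult, ln_Rinv; auto.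
    2: { apply Rinv_0_lt_compat; auto. }
    intros Hl. apply Rmult_le_compat_l with (r := p) in Hl; [|lra].
    replace (p * (y / (p / eps) - 1)) with (eps * y - p) in Hl by (field; lra). lra.
  - rewrite ppp_nonpos by lra. apply Rmult_le_pos; left; apply exp_pos.
Qed.

(** * Potentials with coefficients in a sector *)

Definition pot (alpha : R) (a b : C) (x : R) : C := (a + b * RtoC (ppp x alpha))%C.

Lemma ccont_RtoC (f : R -> R) (x : R) : continuous f x -> ccont (fun y => RtoC (f y)) x.
Proof.
  intros H. apply ccont_iff. intros eps He.
  assert (H' := proj1 (filterlim_locally _ _) H (mkposreal _ He)).
  revert H'. apply filter_imp. intros y Hy. change (Rabs (f y - f x) < eps) in Hy.
  rewrite <- RtoC_minus, Cmod_R. exact Hy.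
Qed.

Lemma Cmod_pot (alpha : R) (a b : C) (x : R) :
  Cmod (pot alpha a b x) <= Cmod a + Cmod b * ppp x alpha.
Proof.
  unfold pot. eapply Rle_trans; [apply Cmod_triangle|].
  rewrite Cmod_mult, Cmod_R, Rabs_right by (apply Rle_ge, ppp_ge_0). lra.
Qed.

Lemma pot_regular (alpha : R) (a b : C) : 0 < alpha -> regular (pot alpha a b).
Proof.
  intros Ha; split.
  - intros x. unfold pot.
    apply (continuous_plus (U := R_UniformSpace) (V := C_R_NormedModule) (fun _ => a)
      (fun y => (b * RtoC (ppp y alpha))%C)); [apply ccont_const|].
    apply (ccont_mult (fun _ => b)); [apply ccont_const|].
    apply ccont_RtoC. now apply ppp_cont.
  - intros X. exists (Cmod a + Cmod b * ppp X alpha). intros t Ht.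
    eapply Rle_trans; [apply Cmod_pot|].
    apply Rplus_le_compat_l, Rmult_le_compat_l; [apply Cmod_ge_0|].
    apply ppp_mono; [lra|]. generalize (Rle_abs t); lra.
Qed.

Lemma sin_ge_of_between (e x : R) : 0 <= e <= PI / 2 -> e <= x <= PI - e -> sin e <= sin x.
Proof.
  intros He Hx. destruct (Rle_dec x (PI / 2)) as [H|H].
  - apply sin_incr_1; lra.
  - replace (sin x) with (sin (PI - x)) by (apply sin_PI_x).
    apply sin_incr_1; lra.
Qed.

Lemma Re_RtoC_cis (r s : R) (t : R) : Re (cis t * (RtoC r * cis s)) = r * cos (t + s).
Proof. rewrite cos_plus. unfold Re; simpl; ring. Qed.

(** [p] and [q] measure the turn of the coefficients away from the negative axis, the undamped
    oscillatory case. For [w = cis (eta - PI / 2)] the real parts of [w], [w a] and [w b] are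
    [sin eta], [ra * sin (p - eta)] and [rb * sin (q - eta)]; the ranges make the second at least
    [sin eta] and the third nonnegative. *)
Lemma pot_weyl (alpha eta A : R) : 0 < alpha -> 0 < eta < PI / 2 -> exists K,
  forall ra p rb q, 1 <= ra <= A -> 0 <= rb <= A ->
  2 * eta <= p <= PI -> eta <= q <= PI + eta ->
  exists v v1, weyl K (sin eta / 2)
    (pot alpha (RtoC ra * cis (PI - p)) (RtoC rb * cis (PI - q))) v v1.
Proof.
  intros Ha He.
  assert (Hs : 0 < sin eta) by (apply sin_gt_0; lra).
  destruct (ppp_exp_bound alpha (sin eta / 2) Ha ltac:(lra)) as (E & HE & HEb).
  destruct (weyl_exists (sin eta) (A * (1 + E))) as [K HK].
  exists K. intros ra p rb q Hra Hrb Hp Hq.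
  apply (HK (cis (eta - PI / 2))); [now apply pot_regular|].
  assert (Hw : forall s, cos (eta - PI / 2 + (PI - s)) = sin (s - eta)).
  { intros s. rewrite <- cos_shift. f_equal. field. }
  split; [auto|split; [rewrite Cmod_cis; lra|split; [|split]]].
  - right. unfold Re, cis; simpl. rewrite <- cos_neg, <- cos_shift. f_equal. field.
  - intros x Hx. unfold pot. rewrite Cmult_plus_distr_l.
    replace (cis (eta - PI / 2) * (RtoC rb * cis (PI - q) * RtoC (ppp x alpha)))%C with
      (cis (eta - PI / 2) * (RtoC (rb * ppp x alpha) * cis (PI - q)))%C by (rewrite RtoC_mult; ring).
    match goal with |- _ <= Re (?u + ?v) => change (Re (u + v)) with (Re u + Re v) end.
    rewrite !Re_RtoC_cis, !Hw.
    assert (sin eta <= sin (p - eta)) by (apply sin_ge_of_between; lra).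
    assert (0 <= sin (q - eta)) by (apply sin_ge_0; lra).
    assert (0 <= rb * ppp x alpha * sin (q - eta)).
    { repeat apply Rmult_le_pos; auto; [lra|apply ppp_ge_0]. }
    nra.
  - intros x Hx. eapply Rle_trans; [apply Cmod_pot|].
    rewrite !Cmod_mult, !Cmod_cis, !Cmod_R, !Rabs_right by lra.
    specialize (HEb x Hx). assert (1 <= exp (sin eta / 2 * x)) by (rewrite <- exp_0; apply exp_le; nra).
    assert (rb * ppp x alpha <= A * (E * exp (sin eta / 2 * x))).
    { apply Rmult_le_compat; try lra. apply ppp_ge_0. }
    nra.
Qed.

(** Over n + 1 equal steps the quadratic errors add up to [C0 * (r - l)^2 / (n + 1)], which tends to
    0; for [A0 = 0] this is constancy from a vanishing derivative. [T] is a relation because its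
    values come from existence statements; the step estimate with [x = y] makes it single-valued. *)
Lemma chain_bound (T : R -> C -> Prop) (l r A0 C0 : R) : l <= r -> 0 <= C0 ->
  (forall x, l <= x <= r -> exists z, T x z) ->
  (forall x y z w, l <= x -> x <= y -> y <= r -> T x z -> T y w ->
     Cmod (w - z)%C <= A0 * (y - x) + C0 * (y - x) ^ 2) ->
  forall z w, T l z -> T r w -> Cmod (w - z)%C <= A0 * (r - l).
Proof.
  intros Hlr HC Htot Hstep z w Hz Hw.
  assert (Hn : forall n, Cmod (w - z)%C <= A0 * (r - l) + C0 * (r - l) ^ 2 * / INR (S n)).
  { intros n. assert (HN : 0 < INR (S n)) by (apply lt_0_INR; lia).
    set (h := (r - l) / INR (S n)).
    assert (Hh : 0 <= h) by (apply Rdiv_le_0_compat; lra).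
    assert (Hind : forall k, (k <= S n)%nat -> forall u, T (l + INR k * h) u ->
       Cmod (u - z)%C <= INR k * (A0 * h + C0 * h ^ 2)).
    { induction k as [|k IH]; intros Hk u Hu.
      - simpl in Hu. rewrite Rmult_0_l, Rplus_0_r in Hu.
        generalize (Hstep l l z u ltac:(lra) ltac:(lra) Hlr Hz Hu). simpl. lra.
      - assert (Hk1 : INR (S k) * h <= r - l).
        { replace (r - l) with (INR (S n) * h) by (unfold h; field; lra).
          apply Rmult_le_compat_r; [auto|apply le_INR; lia]. }
        rewrite S_INR in *. assert (0 <= INR k * h) by (apply Rmult_le_pos; auto using pos_INR).
        destruct (Htot (l + INR k * h)) as [u' Hu']; [lra|].
        specialize (IH ltac:(lia) u' Hu').
        assert (Hs := Hstep (l + INR k * h) (l + (INR k + 1) * h) u' u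
           ltac:(lra) ltac:(lra) ltac:(lra) Hu' Hu).
        replace (u - z)%C with ((u - u') + (u' - z))%C by ring.
        eapply Rle_trans; [apply Cmod_triangle|].
        replace (l + (INR k + 1) * h - (l + INR k * h)) with h in Hs by ring. lra. }
    specialize (Hind (S n) (Nat.le_refl _) w).
    assert (E : l + INR (S n) * h = r) by (unfold h; field; lra).
    rewrite E in Hind. eapply Rle_trans; [apply Hind, Hw|].
    right. unfold h; field; lra. }
  apply Rnot_lt_le; intros Hlt.
  set (D := C0 * (r - l) ^ 2) in *.
  assert (HD : 0 <= D) by (apply Rmult_le_pos; [auto|apply pow2_ge_0]).
  set (e := Cmod (w - z)%C - A0 * (r - l)) in *. assert (He : 0 < e) by (unfold e; lra).
  destruct (nfloor_ex (D / e)) as [n [_ Hn2]]; [apply Rdiv_le_0_compat; lra|].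
  specialize (Hn n). rewrite S_INR in Hn.
  assert (0 < INR n + 1) by (generalize (pos_INR n); lra).
  assert (H1 : e <= D * / (INR n + 1)) by (unfold e; lra).
  apply Rmult_le_compat_r with (r := INR n + 1) in H1; [|lra].
  rewrite Rmult_assoc, Rinv_l, Rmult_1_r in H1 by lra.
  apply Rmult_lt_compat_r with (r := e) in Hn2; [|lra].
  replace (D / e * e) with D in Hn2 by (field; lra). lra.
Qed.

(** * Complex scaling *)

Lemma poly_exp_bound (alpha r : R) : 0 < alpha -> 0 < r -> exists E, 0 < E /\
  forall x, 0 <= x -> (1 + x) * (1 + ppp x alpha) * exp (- r * x) <= E.
Proof.
  intros Ha Hr. destruct (ppp_exp_bound alpha (r / 2) Ha ltac:(lra)) as (E & HE & Hb).
  exists ((1 + 2 / r) * (1 + E)).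
  assert (H2r : 0 < 2 / r) by (apply Rdiv_lt_0_compat; lra).
  split; [apply Rmult_lt_0_compat; lra|].
  intros x Hx. specialize (Hb x Hx).
  assert (He : 1 <= exp (r / 2 * x)) by (rewrite <- exp_0; apply exp_le; nra).
  assert (Hx1 : 1 + x <= (1 + 2 / r) * exp (r / 2 * x)).
  { assert (1 + r / 2 * x <= exp (r / 2 * x)) by apply exp_ineq1_le.
    assert (x <= 2 / r * exp (r / 2 * x)).
    { replace x with (2 / r * (r / 2 * x)) at 1 by (field; lra).
      apply Rmult_le_compat_l; lra. }
    lra. }
  assert (Hp1 : 1 + ppp x alpha <= (1 + E) * exp (r / 2 * x)) by lra.
  assert (Hm : (1 + x) * (1 + ppp x alpha) <= (1 + 2 / r) * exp (r / 2 * x) * ((1 + E) * exp (r / 2 * x))).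
  { apply Rmult_le_compat; try lra. generalize (ppp_ge_0 x alpha); lra. }
  apply Rmult_le_compat_r with (r := exp (- r * x)) in Hm; [|left; apply exp_pos].
  eapply Rle_trans; [exact Hm|]. right.
  assert (E1 : exp (r / 2 * x) * exp (r / 2 * x) * exp (- r * x) = 1).
  { rewrite <- !exp_plus, <- exp_0. f_equal. field. }
  transitivity ((1 + 2 / r) * (1 + E) * (exp (r / 2 * x) * exp (r / 2 * x) * exp (- r * x))).
  - ring.
  - rewrite E1; ring.
Qed.

Lemma weyl_K_pos K r P v v1 : weyl K r P v v1 -> 1 <= K.
Proof.
  intros (_ & V0 & H). destruct (H 0 (Rle_refl 0)) as [H0 _].
  rewrite V0, Cmod_1, Rmult_0_r, exp_0 in H0. lra.
Qed.

Lemma Cmod_Ci_R_mult (x : R) (z : C) : 0 <= x -> Cmod (Ci * RtoC x * z)%C = x * Cmod z.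
Proof. intros H. rewrite !Cmod_mult, Cmod_Ci, Cmod_R, Rabs_right; lra. Qed.

(* [v - i d x v'] approximates the solution rotated to [v (exp (- i d) x)]. *)
Lemma scaling_step (alpha r K A : R) : 0 < alpha -> 0 < r -> exists C0, 0 <= C0 /\
  forall a b v v1 u u1 d, Cmod a <= A -> Cmod b <= A -> 0 <= d ->
  weyl K r (pot alpha a b) v v1 ->
  weyl K r (pot alpha (a * cis (- (2) * d)) (b * cis (- (alpha + 2) * d))) u u1 ->
  Cmod (u1 0 - v1 0 * (RtoC 1 - Ci * RtoC d))%C <= C0 * d ^ 2.
Proof.
  intros Ha Hr. destruct (poly_exp_bound alpha r Ha Hr) as (E & HE & Hpe).
  exists (Rabs (K * ((alpha + 2) ^ 2 * A * (K * E)) / r)). split; [apply Rabs_pos|].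
  intros a b v v1 u u1 d HaA HbA Hd Hv Hu.
  assert (HK := weyl_K_pos _ _ _ _ _ Hv).
  assert (HA : 0 <= A) by (generalize (Cmod_ge_0 a); lra).
  destruct Hv as ([D0 D1] & V0 & Hdec).
  set (P := pot alpha a b) in *.
  set (Q := pot alpha (a * cis (- (2) * d)) (b * cis (- (alpha + 2) * d))) in *.
  (* [- Ci * dP] is the derivative of the rotated potential with respect to the angle, at angle
     0. *)
  set (dP := fun x => (RtoC 2 * a + RtoC (alpha + 2) * b * RtoC (ppp x alpha))%C).
  set (id := (Ci * RtoC d)%C).
  (* The power [alpha + 1] makes this product differentiable at 0 even where the potential itself is
     not. *)
  set (xP := fun x => (a * RtoC x + b * RtoC (ppp x (alpha + 1)))%C).
  assert (HxP : forall x, xP x = (RtoC x * P x)%C).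
  { intros x. unfold xP, P, pot. rewrite <- ppp_mult, RtoC_mult. ring. }
  assert (DxP : forall x, cder xP x (a + RtoC (alpha + 1) * b * RtoC (ppp x alpha))%C).
  { intros x. eapply cder_eq.
    - apply cder_plus; apply cder_scal, cder_RtoC; [apply rder_id|apply ppp_der, Ha].
    - rewrite RtoC_mult. ring. }
  set (g := fun x => (v x - id * (RtoC x * v1 x))%C).
  set (g1 := fun x => (v1 x - id * (v1 x + xP x * v x))%C).
  set (g2 := fun x => (P x * v x - id * (dP x * v x + xP x * v1 x))%C).
  assert (Dg : forall x, cder g x (g1 x)).
  { intros x. eapply cder_eq.
    - apply cder_minus; [apply D0|]. apply cder_scal, cder_mult; [apply cder_RtoC, rder_id|apply D1].
    - unfold g1. rewrite HxP. fold P. ring. }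
  assert (Dg1 : forall x, cder g1 x (g2 x)).
  { intros x. eapply cder_eq.
    - apply cder_minus; [apply D1|]. apply cder_scal, cder_plus; [apply D1|].
      apply cder_mult; [apply DxP|apply D0].
    - unfold g2, dP. fold P. unfold P, pot. rewrite !RtoC_plus. ring. }
  assert (Hw : forall x, 0 <= x -> (Cmod (v x) + x * Cmod (v1 x)) * (1 + ppp x alpha) <= K * E).
  { intros x Hx. destruct (Hdec x Hx) as [H0 H1]. specialize (Hpe x Hx).
    apply Rle_trans with ((1 + x) * (K * exp (- r * x)) * (1 + ppp x alpha)).
    - apply Rmult_le_compat_r; [generalize (ppp_ge_0 x alpha); lra|].
      apply Rmult_le_compat_l with (r := x) in H1; lra.
    - replace ((1 + x) * (K * exp (- r * x)) * (1 + ppp x alpha)) with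
        (K * ((1 + x) * (1 + ppp x alpha) * exp (- r * x))) by ring.
      apply Rmult_le_compat_l; lra. }
  assert (Hvb : forall x, 0 <= x -> Cmod (v x) <= K /\ Cmod (v1 x) <= K /\ x * Cmod (v1 x) <= K * E).
  { intros x Hx. destruct (Hdec x Hx) as [H0 H1].
    assert (exp (- r * x) <= 1) by (rewrite <- exp_0; apply exp_le; nra).
    assert (0 < exp (- r * x)) by apply exp_pos.
    split; [nra|]. split; [nra|]. specialize (Hw x Hx).
    generalize (ppp_ge_0 x alpha), (Cmod_ge_0 (v x)), (Rmult_le_pos _ _ Hx (Cmod_ge_0 (v1 x))). nra. }
  assert (Hxpv : forall x, 0 <= x -> Cmod (xP x * v x)%C <= A * (K * E)).
  { intros x Hx. rewrite HxP, !Cmod_mult, Cmod_R, Rabs_right by lra.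
    assert (HP : Cmod (P x) <= A * (1 + ppp x alpha)).
    { eapply Rle_trans; [apply Cmod_pot|]. generalize (ppp_ge_0 x alpha); nra. }
    destruct (Hdec x Hx) as [H0 _]. specialize (Hpe x Hx).
    apply Rle_trans with ((1 + x) * (A * (1 + ppp x alpha)) * (K * exp (- r * x))).
    - apply Rmult_le_compat; auto using Cmod_ge_0.
      + apply Rmult_le_pos; auto using Cmod_ge_0.
      + apply Rmult_le_compat; auto using Cmod_ge_0. lra.
    - replace ((1 + x) * (A * (1 + ppp x alpha)) * (K * exp (- r * x))) with
        (A * (K * ((1 + x) * (1 + ppp x alpha) * exp (- r * x)))) by ring.
      apply Rmult_le_compat_l; [auto|]. apply Rmult_le_compat_l; lra. }
  assert (H2 := cis_taylor (- (2)) d Hd). assert (H3 := cis_taylor (- (alpha + 2)) d Hd).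
  assert (L2 := cis_lipschitz (- (2)) d Hd). assert (L3 := cis_lipschitz (- (alpha + 2)) d Hd).
  rewrite Rabs_left in L2, L3 by lra.
  assert (Hres : forall x, 0 <= x -> Cmod (g2 x - Q x * g x)%C <= (alpha + 2) ^ 2 * A * (K * E) * d ^ 2).
  { intros x Hx.
    set (e1 := cis (- (2) * d)) in *. set (e2 := cis (- (alpha + 2) * d)) in *.
    assert (Hp := ppp_ge_0 x alpha). set (p := ppp x alpha) in *.
    (* [R1] is a second-order Taylor remainder in d; [R2] is only first-order but meets another
       factor d in the residual. *)
    set (R1 := (a * - (e1 - (RtoC 1 + Ci * RtoC (- (2) * d))) +
                b * RtoC p * - (e2 - (RtoC 1 + Ci * RtoC (- (alpha + 2) * d))))%C).
    set (R2 := (a * - (e1 - RtoC 1) + b * RtoC p * - (e2 - RtoC 1))%C).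
    replace (g2 x - Q x * g x)%C with (R1 * v x + - (id * (RtoC x * (R2 * v1 x))))%C.
    2: { unfold g2, g, R1, R2, dP. rewrite HxP. unfold P, Q, pot, id. fold p.
         rewrite !RtoC_mult, !RtoC_opp, !RtoC_plus. ring. }
    assert (HR1 : Cmod R1 <= (alpha + 2) ^ 2 * A * d ^ 2 * (1 + p)).
    { unfold R1. eapply Rle_trans; [apply Cmod_triangle|].
      rewrite !Cmod_mult, !Cmod_opp, Cmod_R, (Rabs_right p) by lra.
      assert (Hd2 := pow2_ge_0 d).
      assert (Z1 : Cmod (e1 - (RtoC 1 + Ci * RtoC (- (2) * d)))%C <= (alpha + 2) ^ 2 * d ^ 2).
      { eapply Rle_trans; [exact H2|]. apply Rmult_le_compat_r; [auto|nra]. }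
      assert (Z2 : Cmod (e2 - (RtoC 1 + Ci * RtoC (- (alpha + 2) * d)))%C <= (alpha + 2) ^ 2 * d ^ 2).
      { eapply Rle_trans; [exact H3|]. right; ring. }
      replace ((alpha + 2) ^ 2 * A * d ^ 2 * (1 + p)) with
        (A * ((alpha + 2) ^ 2 * d ^ 2) + A * p * ((alpha + 2) ^ 2 * d ^ 2)) by ring.
      apply Rplus_le_compat; apply Rmult_le_compat; auto using Cmod_ge_0.
      - apply Rmult_le_pos; auto using Cmod_ge_0.
      - apply Rmult_le_compat_r; auto. }
    assert (HR2 : Cmod R2 <= (alpha + 2) ^ 2 * A * d * (1 + p)).
    { unfold R2. eapply Rle_trans; [apply Cmod_triangle|].
      rewrite !Cmod_mult, !Cmod_opp, Cmod_R, (Rabs_right p) by lra.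
      assert (Z1 : Cmod (e1 - RtoC 1)%C <= (alpha + 2) ^ 2 * d).
      { eapply Rle_trans; [exact L2|]. apply Rmult_le_compat_r; [auto|nra]. }
      assert (Z2 : Cmod (e2 - RtoC 1)%C <= (alpha + 2) ^ 2 * d).
      { eapply Rle_trans; [exact L3|]. apply Rmult_le_compat_r; [auto|nra]. }
      replace ((alpha + 2) ^ 2 * A * d * (1 + p)) with
        (A * ((alpha + 2) ^ 2 * d) + A * p * ((alpha + 2) ^ 2 * d)) by ring.
      apply Rplus_le_compat; apply Rmult_le_compat; auto using Cmod_ge_0.
      - apply Rmult_le_pos; auto using Cmod_ge_0.
      - apply Rmult_le_compat_r; auto. }
    eapply Rle_trans; [apply Cmod_triangle|]. rewrite Cmod_opp. unfold id.
    rewrite Cmod_Ci_R_mult by auto. rewrite !Cmod_mult, Cmod_R, Rabs_right by lra.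
    specialize (Hw x Hx). fold p in Hw.
    assert (Q1 : Cmod R1 * Cmod (v x) <= (alpha + 2) ^ 2 * A * d ^ 2 * (1 + p) * Cmod (v x)).
    { apply Rmult_le_compat_r; auto using Cmod_ge_0. }
    assert (Q2 : d * (x * (Cmod R2 * Cmod (v1 x))) <= d * (x * ((alpha + 2) ^ 2 * A * d * (1 + p) * Cmod (v1 x)))).
    { apply Rmult_le_compat_l; [auto|]. apply Rmult_le_compat_l; [auto|].
      apply Rmult_le_compat_r; auto using Cmod_ge_0. }
    apply Rle_trans with ((alpha + 2) ^ 2 * A * d ^ 2 * ((Cmod (v x) + x * Cmod (v1 x)) * (1 + p))).
    - lra.
    - replace ((alpha + 2) ^ 2 * A * (K * E) * d ^ 2) with ((alpha + 2) ^ 2 * A * d ^ 2 * (K * E)) by ring.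
      apply Rmult_le_compat_l; [|exact Hw].
      apply Rmult_le_pos; [apply Rmult_le_pos; [apply pow2_ge_0|auto]|apply pow2_ge_0]. }
  assert (HG : forall x, 0 <= x -> Cmod (g x) <= K + d * (K + K * E + A * (K * E)) /\
                                   Cmod (g1 x) <= K + d * (K + K * E + A * (K * E))).
  { intros x Hx. destruct (Hvb x Hx) as (B1 & B2 & B3). specialize (Hxpv x Hx).
    assert (0 <= K * E) by (apply Rmult_le_pos; lra).
    assert (0 <= A * (K * E)) by (apply Rmult_le_pos; lra).
    split.
    - unfold g. eapply Rle_trans; [apply Cmod_triangle|]. rewrite Cmod_opp. unfold id.
      rewrite Cmod_Ci_R_mult, Cmod_mult, Cmod_R, Rabs_right by lra.
      apply Rplus_le_compat; [auto|]. apply Rmult_le_compat_l; lra.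
    - unfold g1. eapply Rle_trans; [apply Cmod_triangle|]. rewrite Cmod_opp. unfold id.
      rewrite Cmod_Ci_R_mult by lra.
      apply Rplus_le_compat; [auto|]. apply Rmult_le_compat_l; [auto|].
      eapply Rle_trans; [apply Cmod_triangle|]. lra. }
  assert (Z := weyl_residual K r Q u u1 g g1 g2 _ _ Hr Hu Dg Dg1 HG Hres).
  assert (E1 : g 0 = RtoC 1) by (unfold g; rewrite V0; ring).
  assert (E2 : g1 0 = (v1 0 * (RtoC 1 - Ci * RtoC d))%C) by (unfold g1; rewrite HxP; unfold id; ring).
  rewrite E1, E2, Cmult_1_r in Z.
  eapply Rle_trans; [exact Z|].
  replace (K * ((alpha + 2) ^ 2 * A * (K * E) * d ^ 2) / r) with
    (K * ((alpha + 2) ^ 2 * A * (K * E)) / r * d ^ 2) by (field; lra).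
  apply Rmult_le_compat_r; [apply pow2_ge_0|apply Rle_abs].
Qed.

(** The quantity [cis t * w1 0] has zero derivative in the angle t: a step d multiplies the slope by
    [1 - i d] up to [O(d^2)], and [cis d] undoes this to the same order. The common [K] and [r] at
    all intermediate angles make the error constant uniform, so [chain_bound] applies with
    [A0 = 0]. *)
Lemma scaling_invariance (alpha r K phi : R) (a b : C) (v v1 u u1 : R -> C) :
  0 < alpha -> 0 < r -> 0 <= phi ->
  (forall t, 0 <= t <= phi -> exists w w1,
     weyl K r (pot alpha (a * cis (- (2) * t)) (b * cis (- (alpha + 2) * t))) w w1) ->
  weyl K r (pot alpha a b) v v1 ->
  weyl K r (pot alpha (a * cis (- (2) * phi)) (b * cis (- (alpha + 2) * phi))) u u1 ->
  v1 0 = (cis phi * u1 0)%C.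
Proof.
  intros Ha Hr Hphi Hex Hv Hu.
  set (A := Cmod a + Cmod b).
  assert (HaA : Cmod a <= A) by (unfold A; generalize (Cmod_ge_0 b); lra).
  assert (HbA : Cmod b <= A) by (unfold A; generalize (Cmod_ge_0 a); lra).
  destruct (scaling_step alpha r K A Ha Hr) as (C0 & HC0 & Hstep).
  assert (HK := weyl_K_pos _ _ _ _ _ Hv).
  set (T := fun t z => exists w w1,
     weyl K r (pot alpha (a * cis (- (2) * t)) (b * cis (- (alpha + 2) * t))) w w1 /\
     z = (cis t * w1 0)%C).
  assert (Z : Cmod (cis phi * u1 0 - v1 0)%C <= 0 * (phi - 0)).
  { apply (chain_bound T 0 phi 0 (C0 + K)); [auto|lra| | | |].
    - intros t Ht. destruct (Hex t Ht) as (w & w1 & Hw). exists (cis t * w1 0)%C, w, w1. auto.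
    - intros x y z w Hx Hxy Hy (p & p1 & Hp & ->) (q & q1 & Hq & ->).
      set (d := y - x). assert (Hd : 0 <= d) by (unfold d; lra).
      assert (Hs := Hstep (a * cis (- (2) * x))%C (b * cis (- (alpha + 2) * x))%C p p1 q q1 d).
      rewrite !Cmod_mult, !Cmod_cis, !Rmult_1_r in Hs.
      rewrite <- !Cmult_assoc, <- !cis_plus in Hs.
      replace (- (2) * x + - (2) * d) with (- (2) * y) in Hs by (unfold d; ring).
      replace (- (alpha + 2) * x + - (alpha + 2) * d) with (- (alpha + 2) * y) in Hs by (unfold d; ring).
      specialize (Hs HaA HbA Hd Hp Hq).
      replace (cis y) with (cis x * cis d)%C by (rewrite <- cis_plus; f_equal; unfold d; ring).
      assert (Ht := cis_taylor (-1) d Hd).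
      assert (Hi := cis_inv d).
      replace (cis x * cis d * q1 0 - cis x * p1 0)%C with
        (cis x * (cis d * ((q1 0 - p1 0 * (RtoC 1 - Ci * RtoC d)) + p1 0 * ((RtoC 1 - Ci * RtoC d) - cis (- d)))))%C.
      2: { replace (cis x * p1 0)%C with (cis x * p1 0 * (cis d * cis (- d)))%C by (rewrite Hi; ring). ring. }
      rewrite !Cmod_mult, !Cmod_cis, !Rmult_1_l, Rmult_0_l, Rplus_0_l.
      eapply Rle_trans; [apply Cmod_triangle|]. rewrite Cmod_mult. fold d.
      replace (-1 * d) with (- d) in Ht by ring.
      assert (Ht' : Cmod (RtoC 1 - Ci * RtoC d - cis (- d))%C <= d ^ 2).
      { rewrite <- Cmod_opp.
        replace (- (RtoC 1 - Ci * RtoC d - cis (- d)))%C with (cis (- d) - (RtoC 1 + Ci * RtoC (- d)))%C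
          by (rewrite RtoC_opp; ring). lra. }
      assert (Hp1 : Cmod (p1 0) <= K).
      { destruct Hp as (_ & _ & Hp). destruct (Hp 0 (Rle_refl 0)) as [_ H].
        rewrite Rmult_0_r, exp_0 in H. lra. }
      assert (Cmod (p1 0) * Cmod (RtoC 1 - Ci * RtoC d - cis (- d))%C <= K * d ^ 2).
      { apply Rmult_le_compat; auto using Cmod_ge_0. }
      lra.
    - exists v, v1. split; [|rewrite cis_0; ring].
      rewrite !Rmult_0_r, cis_0, !Cmult_1_r. exact Hv.
    - exists u, u1. auto. }
  rewrite Rmult_0_l in Z.
  assert (Z2 : Cmod (cis phi * u1 0 - v1 0)%C = 0) by (apply Rle_antisym; [exact Z|apply Cmod_ge_0]).
  apply Cmod_eq_0 in Z2.
  replace (v1 0) with (cis phi * u1 0 - (cis phi * u1 0 - v1 0))%C by ring. rewrite Z2; ring.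
Qed.

(** * The Gamma integral on a ray *)

Lemma exp_mult_INR (s : R) (n : nat) : exp (s * INR n) = exp s ^ n.
Proof.
  induction n as [|n IH]; [simpl; now rewrite Rmult_0_r, exp_0|].
  rewrite S_INR, Rmult_plus_distr_l, exp_plus, IH, Rmult_1_r. simpl; ring.
Qed.

(** The limit is taken along the integers; a large integer beyond x carries the estimate over to
    real x. *)
Lemma exp_decay_limit (F : R -> C) (c r : R) : 0 < r ->
  (forall x y, 0 <= x <= y -> Cmod (F y - F x)%C <= c * exp (- r * x)) ->
  exists L, forall x, 0 <= x -> Cmod (F x - L)%C <= c * exp (- r * x).
Proof.
  intros Hr H.
  assert (He : is_lim_seq (fun n => c * exp (- r * INR n)) 0).
  { apply (is_lim_seq_ext (fun n => c * exp (- r) ^ n)).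
    { intros n; now rewrite exp_mult_INR. }
    replace (Finite 0) with (Rbar_mult c 0) by (simpl; f_equal; ring).
    apply is_lim_seq_scal_l, is_lim_seq_geom.
    rewrite Rabs_right by (left; apply exp_pos). rewrite <- exp_0. apply exp_increasing; lra. }
  set (z := fun n => F (INR n)).
  assert (Hz := clim_bound z _ He).
  assert (Hz' : forall k, Cmod (clim z - z k)%C <= c * exp (- r * INR k)).
  { apply Hz. intros k n Hkn. apply H. split; [apply pos_INR|apply le_INR, Hkn]. }
  exists (clim z). intros x Hx. apply le_epsilon; intros eps Heps.
  apply is_lim_seq_spec in He. destruct (He (mkposreal _ Heps)) as [N HN]. simpl in HN.
  destruct (nfloor_ex x Hx) as [m [_ Hm]].
  set (n := (N + S m)%nat). specialize (HN n ltac:(unfold n; lia)). rewrite Rminus_0_r in HN.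
  assert (HxN : x <= INR n).
  { unfold n. rewrite plus_INR, S_INR. generalize (pos_INR N); lra. }
  assert (H1 := H x (INR n) (conj Hx HxN)). specialize (Hz' n).
  replace (F x - clim z)%C with (- (z n - F x) + - (clim z - z n))%C by (unfold z; ring).
  eapply Rle_trans; [apply Cmod_triangle|]. rewrite !Cmod_opp. unfold z at 1.
  generalize (Rle_abs (c * exp (- r * INR n))). lra.
Qed.

(** Because [alpha > 0] the integrand extends continuously by 0 to the origin. One primitive from 0
    then settles both ends of the improper integral: continuity at 0 and an exponentially attained
    limit at infinity. *)
Lemma Gamma_primitive (alpha : R) : 0 < alpha -> exists (L : R -> R) (c : R), 0 <= c /\ L 0 = 0 /\
  (forall x, is_derive L x (ppp x alpha * exp (- x))) /\
  forall x, 0 <= x -> Rabs (L x - Gamma (alpha + 1)) <= c * exp (- (1 / 2) * x).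
Proof.
  intros Ha.
  assert (Hc : forall x, ccont (fun t => RtoC (ppp t alpha * exp (- t))) x).
  { intros x. apply ccont_RtoC. apply (continuous_mult (K := R_AbsRing)); [now apply ppp_cont|].
    apply (ex_derive_continuous (V := R_NormedModule)). auto_derive; auto. }
  set (F := prim (fun t => RtoC (ppp t alpha * exp (- t)))).
  assert (DF := cder_prim _ Hc). fold F in DF.
  assert (DL : forall x, is_derive (fun x => fst (F x)) x (ppp x alpha * exp (- x))).
  { intros x. apply (cder_fst _ _ _ (DF x)). }
  assert (F0 : F 0 = RtoC 0) by apply prim_0.
  destruct (ppp_exp_bound alpha (1 / 2) Ha ltac:(lra)) as (E & HE & Hb).
  destruct (exp_decay_limit F (2 * E) (1 / 2) ltac:(lra)) as [l Hl].
  { intros x y Hxy.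
    apply Rle_trans with (- (2 * E) * exp (- (1 / 2) * y) - - (2 * E) * exp (- (1 / 2) * x)).
    - apply (dominated_increment F (fun t => RtoC (ppp t alpha * exp (- t)))
        (fun t => - (2 * E) * exp (- (1 / 2) * t))
        (fun t => - (2 * E) * (- (1 / 2) * exp (- (1 / 2) * t)))); [lra| | |].
      + intros t _; apply DF.
      + intros t _; apply rder_scal, rder_exp.
      + intros t Ht. rewrite Cmod_R, Rabs_right.
        * specialize (Hb t ltac:(lra)).
          replace (- (1 / 2) * t) with (1 / 2 * t + - t) by field. rewrite exp_plus.
          generalize (exp_pos (- t)). nra.
        * apply Rle_ge, Rmult_le_pos; [apply ppp_ge_0|left; apply exp_pos].
    - generalize (exp_pos (- (1 / 2) * y)); nra. }
  assert (Hl' : forall x, 0 <= x -> Rabs (fst (F x) - fst l) <= 2 * E * exp (- (1 / 2) * x)).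
  { intros x Hx. eapply Rle_trans; [|apply Hl, Hx]. apply (Re_le_Cmod (F x - l)%C). }
  assert (HG : Gamma (alpha + 1) = fst l).
  { unfold Gamma. replace (alpha + 1 - 1) with alpha by ring.
    apply is_RInt_gen_unique. intros Q [eps HQ].
    unfold filtermapi.
    assert (Heps : 0 < eps / 2) by (destruct eps; simpl; lra).
    assert (C0 : continuous (fun x => fst (F x)) 0).
    { apply (ex_derive_continuous (V := R_NormedModule)). eexists; apply DL. }
    assert (N0 := proj1 (filterlim_locally _ _) C0 (mkposreal _ Heps)).
    destruct N0 as [d Hd].
    assert (Hinf : Rbar_locally p_infty (fun b => 0 < b /\ Rabs (fst (F b) - fst l) < eps / 2)).
    { destruct (exp_decay_small (2 * E) (1 / 2) (eps / 2) ltac:(lra) Heps) as (M & HM & H).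
      exists M. intros x Hx. split; [lra|].
      eapply Rle_lt_trans; [apply Hl'; lra|apply H, Hx]. }
    apply (Filter_prod _ _ _ (fun a => 0 < a /\ Rabs (fst (F a)) < eps / 2)
      (fun b => 0 < b /\ Rabs (fst (F b) - fst l) < eps / 2)).
    - exists d. intros y Hy Hy0. split; [auto|]. specialize (Hd y Hy).
      change (Rabs (fst (F y) - fst (F 0)) < eps / 2) in Hd. rewrite F0 in Hd.
      simpl in Hd. now rewrite Rminus_0_r in Hd.
    - exact Hinf.
    - intros a b [Ha0 Ha1] [Hb0 Hb1]. simpl.
      exists (fst (F b) - fst (F a)). split.
      + apply (is_RInt_ext (fun t => ppp t alpha * exp (- t))).
        { intros x Hx. rewrite ppp_pos; [reflexivity|].
          eapply Rlt_trans; [|apply (proj1 Hx)]. apply Rmin_glb_lt; auto. }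
        apply (is_RInt_derive (V := R_CompleteNormedModule) (fun x => fst (F x))).
        * intros x _; apply DL.
        * intros x _. apply (continuous_mult (K := R_AbsRing)); [now apply ppp_cont|].
          apply (ex_derive_continuous (V := R_NormedModule)). auto_derive; auto.
      + apply HQ. change (Rabs (fst (F b) - fst (F a) - fst l) < eps).
        replace (fst (F b) - fst (F a) - fst l) with ((fst (F b) - fst l) + - fst (F a)) by ring.
        eapply Rle_lt_trans; [apply Rabs_triang|]. rewrite Rabs_Ropp. lra. }
  exists (fun x => fst (F x)), (2 * E). split; [lra|]. split; [now rewrite F0|].
  split; [exact DL|]. rewrite HG. exact Hl'.
Qed.

(* [psi] is, up to the factor [y^(beta-1)], the integrand of Gamma on the ray
   of angle [s]; [psi1] and [psi2] are its derivatives in [s]. *)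
Definition psi (beta y s : R) : C := (cis (beta * s) * cexp (RtoC (-2 * y) * cis (1 * s)))%C.
Definition psi1 (beta y s : R) : C := (Ci * (RtoC beta + RtoC (-2 * y) * cis (1 * s)) * psi beta y s)%C.
Definition psi2 (beta y s : R) : C :=
  (RtoC (2 * y) * cis (1 * s) * psi beta y s
   + Ci * (RtoC beta + RtoC (-2 * y) * cis (1 * s)) * psi1 beta y s)%C.

Lemma psi_der beta y s : cder (psi beta y) s (psi1 beta y s).
Proof.
  eapply cder_eq.
  - apply cder_mult; [apply cder_cis|]. apply cder_cexp, cder_scal, cder_cis.
  - unfold psi1, psi. cbv beta. ring.
Qed.

Lemma psi1_der beta y s : cder (psi1 beta y) s (psi2 beta y s).
Proof.
  assert (HC : (Ci * Ci)%C = RtoC (-1)) by (apply injective_projections; simpl; ring).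
  eapply cder_eq.
  - apply cder_mult; [|apply psi_der]. apply cder_scal, cder_plus; [apply cder_const|].
    apply cder_scal, cder_cis.
  - unfold psi2. cbv beta.
    replace (Ci * (RtoC 0 + RtoC (-2 * y) * (Ci * RtoC 1 * cis (1 * s))))%C with
      ((Ci * Ci) * (RtoC (-2 * y) * cis (1 * s)))%C by ring.
    rewrite HC. replace (RtoC (2 * y)) with (RtoC (-1) * RtoC (-2 * y))%C; [ring|].
    rewrite <- RtoC_mult. f_equal. ring.
Qed.

Lemma psi_abs beta y s : Cmod (psi beta y s) = exp (-2 * y * cos s).
Proof.
  unfold psi. rewrite Cmod_mult, Cmod_cis, Cmod_cexp, Rmult_1_l. f_equal.
  unfold Re; simpl. rewrite Rmult_1_l. ring.
Qed.

Lemma psi_taylor beta y x s t : 0 < beta -> 0 <= y <= x -> 0 <= s <= t -> t <= PI / 2 ->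
  Cmod (psi beta y t - psi beta y s - psi1 beta y s * RtoC (t - s))%C
  <= ((beta + 2 * x) ^ 2 + 2 * x) * (t - s) ^ 2.
Proof.
  intros Hb Hy Hs Ht. set (D := (beta + 2 * x) ^ 2 + 2 * x).
  assert (Hpsi : forall u, 0 <= u <= PI / 2 -> Cmod (psi beta y u) <= 1).
  { intros u Hu. rewrite psi_abs, <- exp_0. apply exp_le.
    assert (0 <= cos u) by (apply cos_ge_0; lra). nra. }
  assert (Hcoef : forall u, Cmod (Ci * (RtoC beta + RtoC (-2 * y) * cis (1 * u)))%C <= beta + 2 * x).
  { intros u. rewrite Cmod_mult, Cmod_Ci, Rmult_1_l. eapply Rle_trans; [apply Cmod_triangle|].
    rewrite Cmod_mult, Cmod_cis, !Cmod_R, (Rabs_right beta), (Rabs_left1 (-2 * y)) by lra. lra. }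
  assert (H2 : forall u, 0 <= u <= PI / 2 -> Cmod (psi2 beta y u) <= D).
  { intros u Hu. unfold psi2. eapply Rle_trans; [apply Cmod_triangle|].
    assert (E1 : Cmod (RtoC (2 * y) * cis (1 * u) * psi beta y u)%C <= 2 * x).
    { rewrite !Cmod_mult, Cmod_cis, Cmod_R, Rabs_right by lra.
      specialize (Hpsi u Hu). generalize (Cmod_ge_0 (psi beta y u)). nra. }
    assert (E2 : Cmod (psi1 beta y u) <= beta + 2 * x).
    { unfold psi1. rewrite Cmod_mult. specialize (Hcoef u). specialize (Hpsi u Hu).
      rewrite <- (Rmult_1_r (beta + 2 * x)). apply Rmult_le_compat; auto using Cmod_ge_0. }
    rewrite (Cmod_mult (Ci * _)).
    assert (Cmod (Ci * (RtoC beta + RtoC (-2 * y) * cis (1 * u)))%C * Cmod (psi1 beta y u)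
      <= (beta + 2 * x) * (beta + 2 * x)) by (apply Rmult_le_compat; auto using Cmod_ge_0).
    unfold D. lra. }
  assert (H1 : forall u, s <= u <= t -> Cmod (psi1 beta y u - psi1 beta y s)%C <= D * u - D * s).
  { intros u Hu. apply (dominated_increment (psi1 beta y) (psi2 beta y) (fun t => D * t) (fun t => D * 1)); [lra| | |].
    - intros; apply psi1_der.
    - intros; apply rder_scal, rder_id.
    - intros v Hv. rewrite Rmult_1_r. apply H2. lra. }
  replace (psi beta y t - psi beta y s - psi1 beta y s * RtoC (t - s))%C with
    ((psi beta y t - psi1 beta y s * RtoC t) - (psi beta y s - psi1 beta y s * RtoC s))%C
    by (rewrite RtoC_minus; ring).
  replace (D * (t - s) ^ 2) with (D * (t - s) * t - D * (t - s) * s) by ring.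
  apply (dominated_increment (fun u => psi beta y u - psi1 beta y s * RtoC u)%C
     (fun u => psi1 beta y u - psi1 beta y s * RtoC 1)%C
     (fun u => D * (t - s) * u) (fun u => D * (t - s) * 1)); [lra| | |].
  - intros u _. apply cder_minus; [apply psi_der|]. apply cder_scal, cder_RtoC, rder_id.
  - intros; apply rder_scal, rder_id.
  - intros u Hu. rewrite Cmult_1_r, Rmult_1_r. eapply Rle_trans; [apply H1, Hu|].
    assert (0 <= D) by (unfold D; generalize (pow2_ge_0 (beta + 2 * x)); lra). nra.
Qed.

(* The ray is turned at a fixed radius [x], where the error is the integral over
   the arc of radius [x]; this avoids differentiating an improper integral. *)
Lemma gamma_rotated (alpha tau : R) : 0 < alpha -> 0 <= tau < PI / 2 -> exists c, 0 <= c /\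
  forall F : R -> C, F 0 = RtoC 0 ->
  (forall y, cder F y (RtoC (ppp y alpha) * cexp (RtoC (-2 * y) * cis tau))%C) ->
  forall x, 0 <= x ->
  Cmod (F x - cis (- (alpha + 1) * tau) * RtoC (Gamma (alpha + 1) / Rpower 2 (alpha + 1)))%C
    <= c * exp (- cos tau * x).
Proof.
  intros Ha Ht. set (beta := alpha + 1).
  assert (Hcos : 0 < cos tau) by (apply cos_gt_0; lra).
  assert (Hcos1 : cos tau <= 1) by apply COS_bound.
  destruct (Gamma_primitive alpha Ha) as (L & c0 & Hc0 & L0 & DL & HL).
  assert (H2b : 0 < Rpower 2 beta) by apply exp_pos.
  destruct (ppp_exp_bound beta (cos tau) ltac:(unfold beta; lra) Hcos) as (E & HE & HEb).
  exists (tau * E + c0 / Rpower 2 beta). split.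
  { apply Rplus_le_le_0_compat; [apply Rmult_le_pos; lra|apply Rdiv_le_0_compat; lra]. }
  intros F F0 DF x Hx.
  (* The value at s is the integral of [z^alpha * exp (-2 z)] along the ray of angle s up to radius
     [x]; [cis (beta * s)] comes from [z^alpha dz]. *)
  set (T := fun s z => exists I, I 0 = RtoC 0 /\
    (forall y, cder I y (RtoC (ppp y alpha) * cexp (RtoC (-2 * y) * cis (1 * s)))%C) /\
    z = (cis (beta * s) * I x)%C).
  (* At angle 0 the substitution of [2 * y] reduces to the primitive for Gamma. *)
  set (I0 := fun y => RtoC (/ Rpower 2 beta * L (2 * y))).
  assert (HT0 : T 0 (I0 x)).
  { exists I0. split; [|split].
    - unfold I0. rewrite Rmult_0_r, L0, Rmult_0_r. reflexivity.
    - intros y. eapply cder_eq.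
      + apply cder_RtoC, rder_scal.
        apply (is_derive_comp L (fun y => 2 * y)); [apply DL|]. apply rder_scal, rder_id.
      + unfold scal; simpl; unfold mult; simpl. rewrite Rmult_0_r, cis_0.
        unfold cexp. replace (Im (RtoC (-2 * y) * RtoC 1)) with 0 by (unfold Im; simpl; ring).
        replace (Re (RtoC (-2 * y) * RtoC 1)) with (- (2 * y)) by (unfold Re; simpl; ring).
        rewrite cis_0, Cmult_1_r, <- RtoC_mult. f_equal.
        destruct (Rlt_dec 0 y) as [Hy|Hy].
        * rewrite !ppp_pos by lra.
          rewrite <- Rpower_mult_distr by lra. unfold beta. rewrite Rpower_plus, Rpower_1 by lra.
          field. apply Rgt_not_eq, exp_pos.
        * rewrite !ppp_nonpos by lra. ring.
    - rewrite Rmult_0_r, cis_0. ring. }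
  assert (HT1 : T tau (cis (beta * tau) * F x)%C).
  { exists F. split; [auto|split; [|auto]]. intros y. rewrite Rmult_1_l. apply DF. }
  (* Bound for the arc of radius [x] per unit angle; the cosine is smallest at the final angle
     [tau]. *)
  set (bd := ppp x beta * exp (-2 * x * cos tau)).
  set (D := (beta + 2 * x) ^ 2 + 2 * x).
  assert (HD : 0 <= D) by (unfold D; generalize (pow2_ge_0 (beta + 2 * x)); lra).
  assert (Z : Cmod (cis (beta * tau) * F x - I0 x)%C <= bd * (tau - 0)).
  { apply (chain_bound T 0 tau bd (x * (ppp x alpha * D))); auto; [lra| | |].
    - apply Rmult_le_pos; [auto|]. apply Rmult_le_pos; [apply ppp_ge_0|auto].
    - intros s Hs. exists (cis (beta * s) * prim (fun y => RtoC (ppp y alpha) * cexp (RtoC (-2 * y) * cis (1 * s))) x)%C.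
      eexists. split; [|split; [|reflexivity]]; [apply prim_0|].
      apply cder_prim. intros y. apply ccont_mult; [apply ccont_RtoC; now apply ppp_cont|].
      eapply cder_continuous, cder_cexp, cder_mult; [|apply cder_const].
      apply cder_RtoC, rder_scal, rder_id.
    - intros s t z w Hs Hst Htt (I & I_0 & DI & ->) (J & J_0 & DJ & ->).
      set (id := (Ci * RtoC (t - s))%C).
      (* The first-order term in the angle integrates exactly, since the y-derivative of
         [Ci * y^beta * psi] is [y^alpha * psi1]. It leaves the boundary term at [x], and only the
         Taylor remainder stays under the integral. *)
      set (G := fun y => (cis (beta * t) * J y - cis (beta * s) * I y - id * (RtoC (ppp y beta) * psi beta y s))%C).
      assert (DG : forall y, cder G y (RtoC (ppp y alpha) *
         (psi beta y t - psi beta y s - psi1 beta y s * RtoC (t - s)))%C).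
      { intros y. eapply cder_eq.
        - apply cder_minus; [apply cder_minus; apply cder_scal; [apply DJ|apply DI]|].
          apply cder_scal, cder_mult; [apply cder_RtoC, ppp_der, Ha|].
          unfold psi. apply cder_scal, cder_cexp, cder_mult; [|apply cder_const].
          apply cder_RtoC, rder_scal, rder_id.
        - cbv beta. unfold psi1, psi, id, beta. rewrite <- ppp_mult.
          rewrite !RtoC_mult. ring. }
      assert (G0 : G 0 = RtoC 0).
      { unfold G. rewrite I_0, J_0, ppp_nonpos by lra. ring. }
      assert (HG : Cmod (G x - G 0)%C <= ppp x alpha * D * (t - s) ^ 2 * x - ppp x alpha * D * (t - s) ^ 2 * 0).
      { apply (dominated_increment G (fun y => RtoC (ppp y alpha) *
           (psi beta y t - psi beta y s - psi1 beta y s * RtoC (t - s)))%C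
          (fun y => ppp x alpha * D * (t - s) ^ 2 * y)
          (fun y => ppp x alpha * D * (t - s) ^ 2 * 1)); auto.
        - intros y _; apply rder_scal, rder_id.
        - intros y Hy; cbv beta. rewrite Cmod_mult, Cmod_R, Rabs_right by (apply Rle_ge, ppp_ge_0).
          rewrite Rmult_1_r, Rmult_assoc. apply Rmult_le_compat; auto using Cmod_ge_0, ppp_ge_0.
          + apply ppp_mono; lra.
          + apply psi_taylor; unfold beta; lra. }
      rewrite G0, Rmult_0_r, Rminus_0_r in HG.
      replace (cis (beta * t) * J x - cis (beta * s) * I x)%C with
        ((G x - RtoC 0) + id * (RtoC (ppp x beta) * psi beta x s))%C by (unfold G; ring).
      eapply Rle_trans; [apply Cmod_triangle|].
      unfold id. rewrite Cmod_Ci_R_mult by lra.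
      rewrite Cmod_mult, Cmod_R, Rabs_right, psi_abs by (apply Rle_ge, ppp_ge_0).
      assert (Hcs : cos tau <= cos s) by (apply cos_decr_1; lra).
      assert (Hbd : ppp x beta * exp (-2 * x * cos s) <= bd).
      { unfold bd. apply Rmult_le_compat_l; [apply ppp_ge_0|]. apply exp_le. nra. }
      apply Rmult_le_compat_l with (r := t - s) in Hbd; [|lra]. lra. }
  assert (HI0 : Cmod (I0 x - RtoC (Gamma beta / Rpower 2 beta))%C <= c0 / Rpower 2 beta * exp (- cos tau * x)).
  { unfold I0. rewrite <- RtoC_minus, Cmod_R.
    replace (/ Rpower 2 beta * L (2 * x) - Gamma beta / Rpower 2 beta) with
      (/ Rpower 2 beta * (L (2 * x) - Gamma beta)) by (field; lra).
    rewrite Rabs_mult, Rabs_right by (left; apply Rinv_0_lt_compat, H2b).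
    specialize (HL (2 * x) ltac:(lra)). fold beta in HL.
    replace (c0 / Rpower 2 beta * exp (- cos tau * x)) with (/ Rpower 2 beta * (c0 * exp (- cos tau * x))) by (field; lra).
    apply Rmult_le_compat_l; [left; apply Rinv_0_lt_compat, H2b|].
    eapply Rle_trans; [exact HL|]. apply Rmult_le_compat_l; [auto|]. apply exp_le. nra. }
  assert (Hbd : bd <= E * exp (- cos tau * x)).
  { unfold bd. specialize (HEb x Hx).
    apply Rmult_le_compat_r with (r := exp (-2 * x * cos tau)) in HEb; [|left; apply exp_pos].
    eapply Rle_trans; [exact HEb|]. rewrite Rmult_assoc, <- exp_plus. right; do 2 f_equal. ring. }
  replace (F x - cis (- beta * tau) * RtoC (Gamma beta / Rpower 2 beta))%C with
    (cis (- beta * tau) * ((cis (beta * tau) * F x - I0 x) + (I0 x - RtoC (Gamma beta / Rpower 2 beta))))%C.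
  2: { replace (- beta * tau) with (- (beta * tau)) by ring.
       transitivity ((cis (beta * tau) * cis (- (beta * tau))) * F x - cis (- (beta * tau)) * RtoC (Gamma beta / Rpower 2 beta))%C; [ring|].
       rewrite cis_inv. ring. }
  rewrite Cmod_mult, Cmod_cis, Rmult_1_l. eapply Rle_trans; [apply Cmod_triangle|].
  rewrite Rminus_0_r in Z. apply Rmult_le_compat_r with (r := tau) in Hbd; lra.
Qed.

(** * Born approximation *)

(** The decaying solution at [theta = 0] on the rotated ray, where the constant coefficient is the
    square of [cis tau]. *)
Definition free (tau x : R) : C := cexp (RtoC (- x) * cis tau).

Lemma free_der (tau x : R) : cder (free tau) x (- cis tau * free tau x)%C.
Proof.
  eapply cder_eq.
  - apply cder_cexp, cder_mult; [|apply cder_const].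
    apply cder_RtoC. apply (is_derive_opp (K := R_AbsRing) (V := R_NormedModule)), rder_id.
  - cbv beta. unfold free. change (opp 1) with (- (1)). rewrite RtoC_opp. ring.
Qed.

Lemma free_abs (tau x : R) : Cmod (free tau x) = exp (- cos tau * x).
Proof. unfold free. rewrite Cmod_cexp. f_equal. unfold Re; simpl; ring. Qed.

Lemma free_0 (tau : R) : free tau 0 = RtoC 1.
Proof.
  unfold free, cexp. rewrite Ropp_0.
  replace (Re _) with 0 by (unfold Re; simpl; ring).
  replace (Im _) with 0 by (unfold Im; simpl; ring).
  rewrite exp_0, cis_0. ring.
Qed.

Lemma free_sqr (tau x : R) : (free tau x * free tau x)%C = cexp (RtoC (-2 * x) * cis tau).
Proof.
  unfold free, cexp.
  replace (Re (RtoC (-2 * x) * cis tau)) with (Re (RtoC (- x) * cis tau) + Re (RtoC (- x) * cis tau)) by (unfold Re; simpl; ring).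
  replace (Im (RtoC (-2 * x) * cis tau)) with (Im (RtoC (- x) * cis tau) + Im (RtoC (- x) * cis tau)) by (unfold Im; simpl; ring).
  rewrite exp_plus, cis_plus, RtoC_mult. ring.
Qed.

Lemma ppp_free_bound (alpha tau : R) : 0 < alpha -> 0 < cos tau -> exists N, 0 < N /\
  forall x, 0 <= x -> ppp x alpha * Cmod (free tau x) <= N * exp (- (cos tau / 2) * x).
Proof.
  intros Ha Hc. destruct (ppp_exp_bound alpha (cos tau / 2) Ha ltac:(lra)) as (E & HE & Hb).
  exists E. split; [auto|]. intros x Hx. rewrite free_abs.
  specialize (Hb x Hx). apply Rmult_le_compat_r with (r := exp (- cos tau * x)) in Hb; [|left; apply exp_pos].
  eapply Rle_trans; [exact Hb|]. rewrite Rmult_assoc, <- exp_plus. right; do 2 f_equal. field.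
Qed.

Section Born.
Variables (alpha tau c r K : R) (w b : C).
Hypothesis Ha : 0 < alpha.
Hypothesis Hcos : 0 < cos tau.
Hypothesis Hr : 0 < r.
Hypothesis Hc : 0 < c.
Hypothesis Hw : Cmod w <= 1.
Hypothesis Hwc : c <= Re w.
Hypothesis Hwa : c <= Re (w * (cis tau * cis tau)).
Hypothesis Hwb : 0 <= Re (w * b).

Let P (theta : R) : R -> C := pot alpha (cis tau * cis tau) (RtoC theta * b).

(** These bounds carry no factor [theta]; they serve to make the energy of the Born remainder vanish
    at infinity. *)
Lemma born_decay (theta : R) (v v1 : R -> C) : weyl K r (P theta) v v1 ->
  let r0 := Rmin r (cos tau) in 0 < r0 /\ forall x, 0 <= x ->
  Cmod (v x - free tau x)%C <= (K + 1) * exp (- r0 * x) /\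
  Cmod (v1 x + cis tau * free tau x)%C <= (K + 1) * exp (- r0 * x).
Proof.
  intros Hv r0. assert (HK := weyl_K_pos _ _ _ _ _ Hv). destruct Hv as (_ & _ & Hd).
  assert (H1 : r0 <= r) by apply Rmin_l. assert (H2 : r0 <= cos tau) by apply Rmin_r.
  split; [apply Rmin_glb_lt; auto|]. intros x Hx. destruct (Hd x Hx) as [D0 D1].
  assert (E1 : exp (- r * x) <= exp (- r0 * x)) by (apply exp_decay_le; auto).
  assert (E2 : exp (- cos tau * x) <= exp (- r0 * x)) by (apply exp_decay_le; auto).
  split.
  - eapply Rle_trans; [apply Cmod_triangle|]. rewrite Cmod_opp, free_abs. nra.
  - eapply Rle_trans; [apply Cmod_triangle|]. rewrite Cmod_mult, Cmod_cis, free_abs. nra.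
Qed.

(** The difference [y = v - free] vanishes at 0 and has a source of order [theta]. The term [h]
    added to the energy f compensates the source: [f + h] increases and is asymptotically at most 0,
    hence [f + h <= 0], while [f + h - c / 2 |y|^2] increases from [- theta^2 * S2]. Together these
    bound [|y|]. *)
Lemma born_pointwise : exists S, 0 <= S /\ forall theta v v1, 0 <= theta ->
  weyl K r (P theta) v v1 -> forall x, 0 <= x -> Cmod (v x - free tau x)%C <= S * theta.
Proof.
  destruct (ppp_free_bound alpha tau Ha Hcos) as (N0 & HN0 & Hpf).
  set (N := Cmod b * N0). set (rho := cos tau / 2). fold rho in Hpf.
  assert (Hrho : 0 < rho) by (unfold rho; lra).
  assert (HN : 0 <= N) by (apply Rmult_le_pos; [apply Cmod_ge_0|lra]).
  set (S2 := N ^ 2 / (4 * c * rho)).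
  assert (HS2 : 0 <= S2).
  { apply Rdiv_le_0_compat; [apply pow2_ge_0|]. apply Rmult_lt_0_compat; lra. }
  exists (sqrt (2 / c * S2)). split; [apply sqrt_pos|].
  intros theta v v1 Hth Hv x Hx.
  assert (HK := weyl_K_pos _ _ _ _ _ Hv).
  destruct (born_decay theta v v1 Hv) as [Hr0 Hdec]. set (r0 := Rmin r (cos tau)) in *.
  destruct Hv as ([D0 D1] & V0 & _).
  set (y := fun x => (v x - free tau x)%C) in *.
  set (y1 := fun x => (v1 x + cis tau * free tau x)%C) in *.
  set (src := fun x => (RtoC theta * b * (RtoC (ppp x alpha) * free tau x))%C).
  assert (Dy : forall x, cder y x (y1 x)).
  { intros t. eapply cder_eq; [apply cder_minus; [apply D0|apply free_der]|]. unfold y1; ring. }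
  assert (Dy1 : forall x, cder y1 x (P theta x * y x + src x)%C).
  { intros t. eapply cder_eq; [apply cder_plus; [apply D1|apply cder_scal, free_der]|].
    unfold y, src, P, pot. ring. }
  set (f := energy w y y1).
  set (f' := fun x => Re (w * ((P theta x * y x + src x) * Cconj (y x))) + Re w * Cmod (y1 x) ^ 2).
  assert (Df : forall x, is_derive f x (f' x)).
  { intros t. apply energy_der_gen; auto. }
  assert (Hf' : forall x, 0 <= x -> c / 2 * (Cmod (y x) ^ 2 + Cmod (y1 x) ^ 2)
       - theta ^ 2 * N ^ 2 / (2 * c) * exp (- (2 * rho) * x) <= f' x).
  { intros t Ht. unfold f'.
    replace (Re (w * ((P theta t * y t + src t) * Cconj (y t)))) with
      (Re (w * P theta t) * Cmod (y t) ^ 2 + Re (w * (src t * Cconj (y t))))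
      by (rewrite <- Re_Cconj_mul; unfold Re; simpl; ring).
    assert (HP : c <= Re (w * P theta t)).
    { unfold P, pot.
      replace (Re (w * (cis tau * cis tau + RtoC theta * b * RtoC (ppp t alpha)))) with
       (Re (w * (cis tau * cis tau)) + theta * ppp t alpha * Re (w * b))
       by (unfold Re; simpl; ring).
      assert (0 <= theta * ppp t alpha * Re (w * b)).
      { repeat apply Rmult_le_pos; auto. apply ppp_ge_0. }
      lra. }
    assert (Hsrc : Cmod (src t) <= theta * N * exp (- rho * t)).
    { unfold src. rewrite !Cmod_mult, !Cmod_R, !Rabs_right by (try apply Rle_ge, ppp_ge_0; lra).
      specialize (Hpf t Ht). unfold N.
      replace (theta * (Cmod b * N0) * exp (- rho * t)) with (theta * Cmod b * (N0 * exp (- rho * t))) by ring.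
      apply Rmult_le_compat_l; [|exact Hpf]. apply Rmult_le_pos; [auto|apply Cmod_ge_0]. }
    assert (Hre : - (theta * N * exp (- rho * t) * Cmod (y t)) <= Re (w * (src t * Cconj (y t)))).
    { generalize (Re_le_Cmod (w * (src t * Cconj (y t)))), (Rabs_maj2 (Re (w * (src t * Cconj (y t))))).
      rewrite !Cmod_mult, Cmod_Cconj. intros R1 R2.
      assert (Cmod w * (Cmod (src t) * Cmod (y t)) <= 1 * (theta * N * exp (- rho * t) * Cmod (y t))).
      { apply Rmult_le_compat; auto using Cmod_ge_0.
        - apply Rmult_le_pos; apply Cmod_ge_0.
        - apply Rmult_le_compat_r; auto using Cmod_ge_0. }
      lra. }
    assert (Hex : exp (- (2 * rho) * t) = exp (- rho * t) ^ 2).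
    { simpl. rewrite Rmult_1_r, <- exp_plus. f_equal. ring. }
    rewrite Hex. set (e := exp (- rho * t)) in *.
    assert (Young : theta * N * e * Cmod (y t) <= c / 2 * Cmod (y t) ^ 2 + theta ^ 2 * N ^ 2 / (2 * c) * e ^ 2).
    { apply Rminus_le_0.
      replace (c / 2 * Cmod (y t) ^ 2 + theta ^ 2 * N ^ 2 / (2 * c) * e ^ 2 - theta * N * e * Cmod (y t))
        with ((c * Cmod (y t) - theta * N * e) ^ 2 / (2 * c)) by (field; lra).
      apply Rdiv_le_0_compat; [apply pow2_ge_0|lra]. }
    generalize (pow2_ge_0 (Cmod (y t))), (pow2_ge_0 (Cmod (y1 t))). nra. }
  (* The derivative of [h] is exactly the term that Young's inequality leaves from the source; this
     determines [S2]. *)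
  set (h := fun x => - (theta ^ 2 * S2) * exp (- (2 * rho) * x)).
  set (h' := fun x => - (theta ^ 2 * S2) * (- (2 * rho) * exp (- (2 * rho) * x))).
  assert (Dh : forall x, is_derive h x (h' x)).
  { intros t. apply rder_scal, rder_exp. }
  assert (Hh' : forall x, h' x = theta ^ 2 * N ^ 2 / (2 * c) * exp (- (2 * rho) * x)).
  { intros t. unfold h', S2. field. lra. }
  assert (Hup : forall x, 0 <= x -> f x + h x <= 0).
  { intros t Ht. apply (le_of_exp_decay _ _ ((K + 1) ^ 2) r0 Hr0). intros s Hs.
    assert (Hinc : f t + h t <= f (t + s) + h (t + s)).
    { apply (incr_of_deriv (fun x => f x + h x) (fun x => f' x + h' x)); [lra| |].
      - intros u _. apply rder_plus; auto.
      - intros u Hu. rewrite Hh'. specialize (Hf' u ltac:(lra)).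
        generalize (pow2_ge_0 (Cmod (y u))), (pow2_ge_0 (Cmod (y1 u))). nra. }
    assert (Hh0 : h (t + s) <= 0).
    { unfold h. assert (0 <= theta ^ 2 * S2) by (apply Rmult_le_pos; [apply pow2_ge_0|auto]).
      generalize (exp_pos (- (2 * rho) * (t + s))). nra. }
    destruct (Hdec (t + s) ltac:(lra)) as [B0 B1]. fold (y (t + s)) in B0. fold (y1 (t + s)) in B1.
    assert (Hf : f (t + s) <= Cmod (y (t + s)) * Cmod (y1 (t + s))).
    { eapply Rle_trans; [apply Rle_abs|]. apply energy_abs, Hw. }
    assert (Hprod : Cmod (y (t + s)) * Cmod (y1 (t + s)) <= (K + 1) * exp (- r0 * (t + s)) * ((K + 1) * exp (- r0 * (t + s)))).
    { apply Rmult_le_compat; auto using Cmod_ge_0. }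
    assert (He1 : exp (- r0 * (t + s)) <= exp (- r0 * s)) by (apply exp_le; nra).
    assert (He2 : exp (- r0 * (t + s)) <= 1) by (rewrite <- exp_0; apply exp_le; nra).
    assert (Hp := exp_pos (- r0 * (t + s))).
    assert (exp (- r0 * (t + s)) * exp (- r0 * (t + s)) <= exp (- r0 * s)) by nra.
    assert (0 <= (K + 1) ^ 2) by apply pow2_ge_0.
    replace ((K + 1) * exp (- r0 * (t + s)) * ((K + 1) * exp (- r0 * (t + s)))) with
      ((K + 1) ^ 2 * (exp (- r0 * (t + s)) * exp (- r0 * (t + s)))) in Hprod by ring.
    assert ((K + 1) ^ 2 * (exp (- r0 * (t + s)) * exp (- r0 * (t + s))) <= (K + 1) ^ 2 * exp (- r0 * s)).
    { apply Rmult_le_compat_l; auto. }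
    lra. }
  assert (Hlow : f 0 + h 0 - c / 2 * Cmod (y 0) ^ 2 <= f x + h x - c / 2 * Cmod (y x) ^ 2).
  { apply (incr_of_deriv (fun x => f x + h x - c / 2 * Cmod (y x) ^ 2)
      (fun x => f' x + h' x - c / 2 * (2 * Re (Cconj (y x) * y1 x)))); [auto| |].
    - intros u _. apply (rder_minus (fun x => f x + h x) (fun x => c / 2 * Cmod (y x) ^ 2)).
      + apply rder_plus; auto.
      + apply (rder_scal (c / 2) (fun x => Cmod (y x) ^ 2)), cder_Cmod2; auto.
    - intros u Hu. rewrite Hh'. specialize (Hf' u ltac:(lra)).
      generalize (Re_le_Cmod (Cconj (y u) * y1 u)), (Rle_abs (Re (Cconj (y u) * y1 u))).
      rewrite Cmod_mult, Cmod_Cconj. intros.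
      generalize (pow2_ge_0 (Cmod (y u) - Cmod (y1 u))). nra. }
  assert (Y0 : y 0 = RtoC 0) by (unfold y; rewrite V0, free_0; ring).
  assert (f0 : f 0 = 0) by (unfold f, energy, Re; rewrite Y0; simpl; ring).
  assert (h0 : h 0 = - (theta ^ 2 * S2)) by (unfold h; rewrite Rmult_0_r, exp_0; ring).
  rewrite f0, h0, Y0, Cmod_0 in Hlow. specialize (Hup x Hx).
  fold (y x).
  assert (Hfin : Cmod (y x) ^ 2 <= 2 / c * S2 * theta ^ 2).
  { apply Rmult_le_reg_l with (c / 2); [lra|].
    replace (c / 2 * (2 / c * S2 * theta ^ 2)) with (theta ^ 2 * S2) by (field; lra). lra. }
  assert (H2c : 0 <= 2 / c * S2).
  { apply Rmult_le_pos; [apply Rdiv_le_0_compat; lra|auto]. }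
  apply Rsqr_incr_0_var; [|apply Rmult_le_pos; [apply sqrt_pos|auto]].
  rewrite Rsqr_mult, Rsqr_sqrt, !Rsqr_pow2 by auto. exact Hfin.
Qed.

(** [W] is the Wronskian of [v] and [free]. Adding [theta * b * F] reduces its derivative to
    [theta * b * (v - free)] times a decaying factor, which is [O(theta^2)] by [born_pointwise]. [J]
    enters only as the limit of [F], so its value can be computed separately. *)
Lemma born (J : C) (cJ rJ : R) : 0 < rJ ->
  (forall F : R -> C, F 0 = RtoC 0 ->
    (forall y, cder F y (RtoC (ppp y alpha) * cexp (RtoC (-2 * y) * cis tau))%C) ->
    forall x, 0 <= x -> Cmod (F x - J)%C <= cJ * exp (- rJ * x)) ->
  exists C1, forall theta v v1, 0 <= theta -> weyl K r (P theta) v v1 ->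
    Cmod (v1 0 + cis tau + RtoC theta * b * J)%C <= C1 * theta ^ 2.
Proof.
  intros HrJ HJ.
  destruct born_pointwise as (S & HS & Hpt).
  destruct (ppp_free_bound alpha tau Ha Hcos) as (N0 & HN0 & Hpf).
  set (rho := cos tau / 2). fold rho in Hpf.
  assert (Hrho : 0 < rho) by (unfold rho; lra).
  set (M := Cmod b * N0 * S / rho).
  exists M. intros theta v v1 Hth Hv.
  specialize (Hpt theta v v1 Hth Hv).
  assert (HK := weyl_K_pos _ _ _ _ _ Hv).
  destruct Hv as ([D0 D1] & V0 & Hd).
  set (F := prim (fun y => RtoC (ppp y alpha) * cexp (RtoC (-2 * y) * cis tau))%C).
  assert (DF : forall y, cder F y (RtoC (ppp y alpha) * cexp (RtoC (-2 * y) * cis tau))%C).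
  { apply cder_prim. intros y. apply ccont_mult; [apply ccont_RtoC; now apply ppp_cont|].
    eapply cder_continuous, cder_cexp, cder_mult; [|apply cder_const].
    apply cder_RtoC, rder_scal, rder_id. }
  specialize (HJ F (prim_0 _) DF).
  set (W := fun x => (- (cis tau * v x + v1 x) * free tau x)%C).
  set (X := fun x => (W x + RtoC theta * b * F x)%C).
  assert (DX : forall x, cder X x (- (RtoC theta * b * (v x - free tau x) * (RtoC (ppp x alpha) * free tau x)))%C).
  { intros x. eapply cder_eq.
    - apply cder_plus; [|apply cder_scal, DF].
      apply cder_mult; [|apply free_der]. apply cder_opp, cder_plus; [apply cder_scal, D0|apply D1].
    - cbv beta. rewrite <- free_sqr. unfold P, pot. ring. }
  assert (HM : 0 <= M * theta ^ 2).
  { unfold M. apply Rmult_le_pos; [|apply pow2_ge_0]. apply Rdiv_le_0_compat; [|auto].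
    apply Rmult_le_pos; [apply Rmult_le_pos; [apply Cmod_ge_0|lra]|auto]. }
  assert (HX : forall x, 0 <= x -> Cmod (X x - X 0)%C <= M * theta ^ 2).
  { intros x Hx.
    apply Rle_trans with (- (M * theta ^ 2) * exp (- rho * x) - - (M * theta ^ 2) * exp (- rho * 0)).
    - eapply (dominated_increment X _ (fun t => - (M * theta ^ 2) * exp (- rho * t))
        (fun t => - (M * theta ^ 2) * (- rho * exp (- rho * t)))); [auto| | |].
      + intros t _; apply DX.
      + intros t _; apply rder_scal, rder_exp.
      + intros t Ht; cbv beta. rewrite Cmod_opp, (Cmod_mult (RtoC theta * b * _)), (Cmod_mult (RtoC theta * b)).
        rewrite !Cmod_mult, !Cmod_R, !Rabs_right by (try apply Rle_ge, ppp_ge_0; lra).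
        specialize (Hpf t ltac:(lra)). specialize (Hpt t ltac:(lra)).
        replace (- (M * theta ^ 2) * (- rho * exp (- rho * t))) with
          (theta * Cmod b * (S * theta) * (N0 * exp (- rho * t))) by (unfold M; field; lra).
        apply Rmult_le_compat; auto.
        * repeat apply Rmult_le_pos; auto using Cmod_ge_0.
        * apply Rmult_le_pos; auto using Cmod_ge_0, ppp_ge_0.
        * apply Rmult_le_compat_l; [|auto]. apply Rmult_le_pos; auto using Cmod_ge_0.
    - rewrite Rmult_0_r, exp_0. generalize (exp_pos (- rho * x)). nra. }
  assert (HF0 : F 0 = RtoC 0) by apply prim_0.
  set (r0 := Rmin (cos tau) rJ).
  assert (Hr0 : 0 < r0) by (apply Rmin_glb_lt; auto).
  apply (le_of_exp_decay _ _ (2 * K + theta * Cmod b * Rabs cJ) r0 Hr0). intros x Hx.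
  replace (v1 0 + cis tau + RtoC theta * b * J)%C with
    ((X x - X 0) + (- W x + - (RtoC theta * b * (F x - J))))%C.
  2: { unfold X, W. rewrite HF0, V0, free_0. ring. }
  eapply Rle_trans; [apply Cmod_triangle|].
  apply Rplus_le_compat; [apply HX, Hx|].
  eapply Rle_trans; [apply Cmod_triangle|]. rewrite !Cmod_opp.
  assert (E1 : exp (- cos tau * x) <= exp (- r0 * x)) by (apply exp_decay_le; [apply Rmin_l|auto]).
  assert (E2 : exp (- rJ * x) <= exp (- r0 * x)) by (apply exp_decay_le; [apply Rmin_r|auto]).
  assert (HW : Cmod (W x) <= 2 * K * exp (- r0 * x)).
  { unfold W. rewrite Cmod_mult, Cmod_opp, free_abs. destruct (Hd x Hx) as [H0 H1].
    assert (exp (- r * x) <= 1) by (rewrite <- exp_0; apply exp_le; nra).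
    assert (Cmod (cis tau * v x + v1 x)%C <= 2 * K).
    { eapply Rle_trans; [apply Cmod_triangle|]. rewrite Cmod_mult, Cmod_cis. nra. }
    apply Rmult_le_compat; auto using Cmod_ge_0. left; apply exp_pos. }
  assert (HFJ : Cmod (RtoC theta * b * (F x - J))%C <= theta * Cmod b * Rabs cJ * exp (- r0 * x)).
  { rewrite !Cmod_mult, Cmod_R, Rabs_right by lra. rewrite Rmult_assoc, (Rmult_assoc (theta * _)), Rmult_assoc.
    apply Rmult_le_compat_l; [auto|]. apply Rmult_le_compat_l; [apply Cmod_ge_0|].
    eapply Rle_trans; [apply HJ, Hx|].
    assert (cJ * exp (- rJ * x) <= Rabs cJ * exp (- rJ * x)).
    { apply Rmult_le_compat_r; [left; apply exp_pos|apply Rle_abs]. }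
    assert (Rabs cJ * exp (- rJ * x) <= Rabs cJ * exp (- r0 * x)).
    { apply Rmult_le_compat_l; [apply Rabs_pos|auto]. }
    lra. }
  lra.
Qed.
End Born.

(** * Limiting absorption *)

(** At this angle the undamped coefficient of [x^alpha] has made a quarter turn, from [- theta] to
    [i * theta]. Since [phi0 < PI / 4], there is room for the further turn [2 s], at most [PI / 2],
    due to damping. *)
Definition phi0 (alpha : R) : R := PI / (2 * (alpha + 2)).

Lemma phi0_spec alpha : 0 < alpha ->
  0 < phi0 alpha < PI / 4 /\ (alpha + 2) * phi0 alpha = PI / 2.
Proof.
  intros Ha. assert (HPI := PI_RGT_0).
  assert (E : (alpha + 2) * phi0 alpha = PI / 2) by (unfold phi0; field; lra).
  assert (H : 0 < phi0 alpha) by (apply Rdiv_lt_0_compat; lra).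
  repeat split; auto. nra.
Qed.

Definition damped (sigma : R) : C := (RtoC 1 + Ci * RtoC sigma)%C.

Definition helm (alpha theta : R) (k : C) : R -> C :=
  pot alpha (- (k * k)) (- (k * k) * RtoC theta).

Definition rot (alpha theta : R) (k : C) (phi : R) : R -> C :=
  pot alpha (- (k * k) * cis (- (2) * phi)) (- (k * k) * RtoC theta * cis (- (alpha + 2) * phi)).

Lemma is_solution_iff alpha theta k u :
  is_solution k (slowness2 alpha theta) u <-> exists u1, solves (helm alpha theta k) u u1.
Proof.
  assert (E : forall x, helm alpha theta k x = (- (k * k) * RtoC (slowness2 alpha theta x))%C).
  { intros x. unfold helm, pot, slowness2. rewrite RtoC_plus, RtoC_mult. ring. }
  split.
  - intros (u1 & u2 & H1 & H2 & H3). exists u1. split; [exact H1|].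
    intros x. eapply cder_eq; [apply H2|]. rewrite E.
    replace (u2 x) with ((u2 x + k * k * RtoC (slowness2 alpha theta x) * u x) -
      k * k * RtoC (slowness2 alpha theta x) * u x)%C by ring.
    rewrite H3. ring.
  - intros (u1 & H1 & H2). exists u1, (fun x => helm alpha theta k x * u x)%C.
    split; [exact H1|]. split; [exact H2|]. intros x. rewrite E. ring.
Qed.

(** Here [s = atan (- sigma)] is minus the argument of [damped sigma], and [rho2 = 1 + sigma^2];
    [-1 <= sigma] gives both upper bounds. *)
Lemma damped_polar sigma : -1 <= sigma <= 0 -> exists s rho2,
  0 <= s <= PI / 4 /\ (sigma < 0 -> 0 < s) /\ 1 <= rho2 <= 2 /\
  (- (damped sigma * damped sigma) = RtoC rho2 * cis (PI - 2 * s))%C.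
Proof.
  intros Hs. set (s := atan (- sigma)).
  assert (Hb := atan_bound (- sigma)). fold s in Hb.
  assert (Ht : tan s = - sigma) by apply tan_atan.
  assert (Hc : 0 < cos s) by (apply cos_gt_0; lra).
  assert (H0 : sigma < 0 -> 0 < s).
  { intros H. rewrite <- atan_0. apply atan_increasing. lra. }
  exists s, (1 + sigma ^ 2). repeat split.
  - destruct (Req_dec sigma 0) as [E|E]; [|left; apply H0; lra].
    right. unfold s. rewrite E, Ropp_0, atan_0. reflexivity.
  - rewrite <- atan_1. unfold s. destruct (Req_dec sigma (-1)) as [E|E].
    + right. f_equal. rewrite E. ring.
    + left. apply atan_increasing. lra.
  - exact H0.
  - generalize (pow2_ge_0 sigma); lra.
  - nra.
  - assert (Es : sigma = - (sin s / cos s)) by (change (sin s / cos s) with (tan s); lra).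
    assert (E1 : 1 + sigma ^ 2 = / (cos s * cos s)).
    { rewrite Es. replace (1 + (- (sin s / cos s)) ^ 2) with ((cos s * cos s + sin s * sin s) / (cos s * cos s)) by (field; lra).
      generalize (sin2_cos2 s). unfold Rsqr. intros Z.
      replace (cos s * cos s + sin s * sin s) with 1 by lra. field; lra. }
    rewrite E1. unfold damped, cis. rewrite Rtrigo_facts.cos_pi_minus, Rtrigo_facts.sin_pi_minus, cos_2a, sin_2a, Es.
    apply injective_projections; simpl; field; lra.
Qed.

Lemma rot_polar alpha theta phi s rho2 (k : C) :
  (- (k * k) = RtoC rho2 * cis (PI - 2 * s))%C ->
  rot alpha theta k phi = pot alpha (RtoC rho2 * cis (PI - (2 * s + 2 * phi)))
    (RtoC (rho2 * theta) * cis (PI - (2 * s + (alpha + 2) * phi))).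
Proof.
  intros E. unfold rot. rewrite E.
  replace (PI - (2 * s + 2 * phi)) with ((PI - 2 * s) + - (2) * phi) by ring.
  replace (PI - (2 * s + (alpha + 2) * phi)) with ((PI - 2 * s) + - (alpha + 2) * phi) by ring.
  rewrite !cis_plus, RtoC_mult. f_equal; ring.
Qed.

(** The turns at [phi0] are [2 s + 2 phi0] and [2 s + PI / 2], so [eta = phi0] is admissible down to
    [s = 0], the undamped case. *)
Lemma rot_weyl alpha : 0 < alpha -> exists K, forall theta sigma,
  0 <= theta <= 1 -> -1 <= sigma <= 0 ->
  exists z z1, weyl K (sin (phi0 alpha) / 2) (rot alpha theta (damped sigma) (phi0 alpha)) z z1.
Proof.
  intros Ha. destruct (phi0_spec alpha Ha) as [Hphi Heq].
  destruct (pot_weyl alpha (phi0 alpha) 2 Ha ltac:(lra)) as [K HK].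
  exists K. intros theta sigma Hth Hs.
  destruct (damped_polar sigma Hs) as (s & rho2 & Hs1 & _ & Hrho & E).
  rewrite (rot_polar _ _ _ _ _ _ E).
  apply HK; try lra. nra.
Qed.

(** The choice [eta = s] is admissible at every angle of the sector, but tends to 0 with sigma;
    these constants serve to transport the slope at fixed sigma. *)
Lemma sector_weyl alpha sigma : 0 < alpha -> -1 <= sigma < 0 -> exists K r, 0 < r /\
  forall theta phi, 0 <= theta <= 1 -> 0 <= phi <= phi0 alpha ->
  exists z z1, weyl K r (rot alpha theta (damped sigma) phi) z z1.
Proof.
  intros Ha Hs. destruct (phi0_spec alpha Ha) as [Hphi Heq].
  destruct (damped_polar sigma ltac:(lra)) as (s & rho2 & Hs1 & Hs0 & Hrho & E).
  specialize (Hs0 (proj2 Hs)).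
  destruct (pot_weyl alpha s 2 Ha ltac:(lra)) as [K HK].
  exists K, (sin s / 2). split.
  { assert (0 < sin s) by (apply sin_gt_0; lra). lra. }
  intros theta phi Hth Hp. rewrite (rot_polar _ _ _ _ _ _ E).
  assert (0 <= (alpha + 2) * phi) by (apply Rmult_le_pos; lra).
  assert ((alpha + 2) * phi <= PI / 2) by (rewrite <- Heq; apply Rmult_le_compat_l; lra).
  apply HK; try lra. nra.
Qed.

Lemma rot_0 alpha theta k : rot alpha theta k 0 = helm alpha theta k.
Proof. unfold rot, helm. rewrite !Rmult_0_r, cis_0. f_equal; ring. Qed.

(** The second solution has zero residual as a test function for the first. The constants may
    differ, which allows bounds depending on sigma to be traded for uniform ones. *)
Lemma weyl_unique K r K' r' P v v1 u u1 : 0 < r -> 0 < r' ->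
  weyl K r P v v1 -> weyl K' r' P u u1 -> v1 0 = u1 0.
Proof.
  intros Hr Hr' Hv Hu. assert (HK' := weyl_K_pos _ _ _ _ _ Hu).
  destruct Hu as ([D0 D1] & U0 & Hd).
  assert (Z := weyl_residual K r P v v1 u u1 (fun x => P x * u x)%C K' 0 Hr Hv D0 D1).
  rewrite U0 in Z.
  assert (Z' : Cmod (v1 0 * RtoC 1 - u1 0)%C <= K * 0 / r).
  { apply Z.
    - intros x Hx. destruct (Hd x Hx) as [H0 H1].
      assert (exp (- r' * x) <= 1) by (rewrite <- exp_0; apply exp_le; nra).
      split; nra.
    - intros x _. replace (_ - _)%C with (RtoC 0) by ring. rewrite Cmod_0; lra. }
  rewrite Rmult_0_r in Z'. unfold Rdiv in Z'. rewrite Rmult_0_l in Z'.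
  assert (Z2 : Cmod (v1 0 * RtoC 1 - u1 0)%C = 0) by (apply Rle_antisym; [exact Z'|apply Cmod_ge_0]).
  apply Cmod_eq_0 in Z2.
  replace (v1 0) with ((v1 0 * RtoC 1 - u1 0) + u1 0)%C by ring. rewrite Z2. ring.
Qed.

Lemma damped_sqr_diff sigma : -1 <= sigma <= 0 ->
  Cmod (damped sigma * damped sigma - RtoC 1)%C <= 3 * Rabs sigma.
Proof.
  intros Hs. unfold damped.
  replace ((RtoC 1 + Ci * RtoC sigma) * (RtoC 1 + Ci * RtoC sigma) - RtoC 1)%C with
    (RtoC sigma * (RtoC 2 * Ci + - RtoC sigma))%C
    by (apply injective_projections; simpl; ring).
  rewrite Cmod_mult, Cmod_R, Rmult_comm. apply Rmult_le_compat_r; [apply Rabs_pos|].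
  eapply Rle_trans; [apply Cmod_triangle|].
  rewrite Cmod_mult, Cmod_opp, Cmod_Ci, !Cmod_R, Rabs_right, Rabs_left1 by lra. lra.
Qed.

Lemma damped_0 : damped 0 = RtoC 1.
Proof. unfold damped. ring. Qed.

(** Inserted into the damped equation, the undamped solution leaves a residual with the factor
    [k^2 - 1 = O(sigma)]; its decay absorbs the power. *)
Lemma rot_lipschitz alpha K r : 0 < alpha -> 0 < r -> exists C0, forall theta sigma phi z z1 y y1,
  0 <= theta <= 1 -> -1 <= sigma <= 0 ->
  weyl K r (rot alpha theta (damped sigma) phi) z z1 ->
  weyl K r (rot alpha theta (RtoC 1) phi) y y1 ->
  Cmod (z1 0 - y1 0)%C <= C0 * Rabs sigma.
Proof.
  intros Ha Hr. destruct (poly_exp_bound alpha r Ha Hr) as (E & HE & Hpe).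
  exists (K * (3 * (K * E)) / r). intros theta sigma phi z z1 y y1 Hth Hs Hz Hy.
  assert (HK := weyl_K_pos _ _ _ _ _ Hy).
  destruct Hy as ([D0 D1] & Y0 & Hd).
  assert (Z := weyl_residual K r _ z z1 y y1 _ K (3 * (K * E) * Rabs sigma) Hr Hz D0 D1).
  rewrite Y0, Cmult_1_r in Z.
  replace (K * (3 * (K * E)) / r * Rabs sigma) with (K * (3 * (K * E) * Rabs sigma) / r) by (field; lra).
  apply Z.
  - intros x Hx. destruct (Hd x Hx) as [H0 H1].
    assert (exp (- r * x) <= 1) by (rewrite <- exp_0; apply exp_le; nra).
    split; nra.
  - intros x Hx. set (k := damped sigma) in *.
    replace (rot alpha theta (RtoC 1) phi x * y x - rot alpha theta k phi x * y x)%C with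
      ((k * k - RtoC 1) * ((cis (- (2) * phi) + RtoC (theta * ppp x alpha) * cis (- (alpha + 2) * phi)) * y x))%C.
    2: { unfold rot, pot. rewrite RtoC_mult. ring. }
    rewrite !Cmod_mult.
    assert (Hp := ppp_ge_0 x alpha).
    assert (H1 : Cmod (cis (- (2) * phi) + RtoC (theta * ppp x alpha) * cis (- (alpha + 2) * phi))%C <= 1 + ppp x alpha).
    { eapply Rle_trans; [apply Cmod_triangle|].
      rewrite Cmod_mult, !Cmod_cis, Cmod_R, Rabs_right by (apply Rle_ge, Rmult_le_pos; lra). nra. }
    destruct (Hd x Hx) as [H0 _]. specialize (Hpe x Hx).
    assert (H2 : Cmod (cis (- (2) * phi) + RtoC (theta * ppp x alpha) * cis (- (alpha + 2) * phi))%C * Cmod (y x) <= K * E).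
    { apply Rle_trans with ((1 + ppp x alpha) * (K * exp (- r * x))).
      - apply Rmult_le_compat; auto using Cmod_ge_0.
      - assert (Hex := exp_pos (- r * x)).
        assert (0 <= x * ((1 + ppp x alpha) * exp (- r * x))) by (apply Rmult_le_pos; [auto|apply Rmult_le_pos; lra]).
        replace ((1 + ppp x alpha) * (K * exp (- r * x))) with (K * ((1 + ppp x alpha) * exp (- r * x))) by ring.
        apply Rmult_le_compat_l; lra. }
    replace (3 * (K * E) * Rabs sigma) with (3 * Rabs sigma * (K * E)) by ring.
    apply Rmult_le_compat; auto using Cmod_ge_0.
    + apply Rmult_le_pos; apply Cmod_ge_0.
    + now apply damped_sqr_diff.
Qed.

(* V solves the damped problem on the unrotated ray; by scaling invariance V1 0
   can be read off at the angle phi0, where the limit sigma -> 0 is regular. *)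
Lemma limiting_absorption alpha : 0 < alpha -> exists K, forall theta, 0 <= theta <= 1 ->
  exists y y1, weyl K (sin (phi0 alpha) / 2) (rot alpha theta (RtoC 1) (phi0 alpha)) y y1 /\
  exists C0, forall sigma, -1 <= sigma < 0 -> exists K' r' V V1, 0 < r' /\
    weyl K' r' (helm alpha theta (damped sigma)) V V1 /\
    Cmod (V1 0 - cis (phi0 alpha) * y1 0)%C <= C0 * Rabs sigma.
Proof.
  intros Ha. destruct (phi0_spec alpha Ha) as [Hphi Heq].
  assert (Hr : 0 < sin (phi0 alpha) / 2).
  { assert (0 < sin (phi0 alpha)) by (apply sin_gt_0; lra). lra. }
  destruct (rot_weyl alpha Ha) as [K HK]. exists K. intros theta Hth.
  destruct (HK theta 0 Hth ltac:(lra)) as (y & y1 & Hy). rewrite damped_0 in Hy.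
  exists y, y1. split; [exact Hy|].
  destruct (rot_lipschitz alpha K _ Ha Hr) as [C0 HC].
  exists C0. intros sigma Hs.
  destruct (HK theta sigma Hth ltac:(lra)) as (z & z1 & Hz).
  destruct (sector_weyl alpha sigma Ha Hs) as (K' & r' & Hr' & Hsec).
  destruct (Hsec theta 0 Hth ltac:(lra)) as (V & V1 & HV). rewrite rot_0 in HV.
  destruct (Hsec theta (phi0 alpha) Hth ltac:(lra)) as (u & u1 & Hu).
  exists K', r', V, V1. split; [auto|split; [auto|]].
  assert (E1 : V1 0 = (cis (phi0 alpha) * u1 0)%C).
  { eapply scaling_invariance; [exact Ha|exact Hr'|lra| |exact HV|exact Hu].
    intros t Ht. apply (Hsec theta t Hth Ht). }
  (* [u] comes with constants depending on sigma and [z] with uniform ones; both decay for the same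
     equation, so their slopes agree. *)
  rewrite E1, (weyl_unique _ _ _ _ _ _ _ _ _ Hr' Hr Hu Hz).
  replace (cis (phi0 alpha) * z1 0 - cis (phi0 alpha) * y1 0)%C with
    (cis (phi0 alpha) * (z1 0 - y1 0))%C by ring.
  rewrite Cmod_mult, Cmod_cis, Rmult_1_l.
  eapply HC; [exact Hth| |exact Hz|exact Hy]. lra.
Qed.

(** [U] tends to 0, but nothing is known about [U1] at infinity. Since [(U V)' = 2 U V1 - W] for the
    constant Wronskian [W], integration over [[x, x + 1]] bounds [W] through [U], [V] and [V1]
    alone. *)
Lemma decaying_is_weyl K r P V V1 U U1 : 0 < r -> weyl K r P V V1 -> solves P U U1 ->
  filterlim U (Rbar_locally p_infty) (locally (RtoC 0)) ->
  U1 0 = (V1 0 * U 0)%C.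
Proof.
  intros Hr HV HU Hlim.
  assert (HK := weyl_K_pos _ _ _ _ _ HV).
  assert (HW := wronskian_const P U U1 V V1 HU (proj1 HV)).
  destruct HV as ([V_0 V_1] & V0 & Hd). destruct HU as [U_0 U_1].
  set (W := (U 0 * V1 0 - U1 0 * V 0)%C) in *.
  destruct (proj1 (filterlim_locally _ _) Hlim (mkposreal 1 Rlt_0_1)) as [X0 HX0].
  assert (HUb : forall x, X0 < x -> Cmod (U x) <= 2).
  { intros x Hx. destruct (HX0 x Hx) as [B1 B2].
    change (Rabs (fst (U x) - 0) < 1) in B1. change (Rabs (snd (U x) - 0) < 1) in B2.
    rewrite Rminus_0_r in B1, B2. generalize (Cmod_le_abs (U x)). lra. }
  set (X := Rmax 0 X0 + 1).
  assert (HX : 0 <= X /\ X0 < X) by (unfold X; generalize (Rmax_l 0 X0), (Rmax_r 0 X0); lra).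
  assert (HW0 : Cmod W <= 0).
  { apply (le_of_exp_decay _ _ (8 * K) r Hr). intros t Ht. set (x := X + t).
    assert (Hx : 0 <= x /\ X0 < x) by (unfold x; lra).
    assert (Hex : exp (- r * x) <= exp (- r * t)) by (apply exp_le; unfold x; nra).
    assert (HG : Cmod ((U (x + 1)%R * V (x + 1)%R + W * RtoC (x + 1)%R) - (U x * V x + W * RtoC x))%C
        <= 4 * K * exp (- r * x) * (x + 1) - 4 * K * exp (- r * x) * x).
    { apply (dominated_increment (fun x => U x * V x + W * RtoC x)%C
        (fun x => RtoC 2 * (U x * V1 x))%C
        (fun t => 4 * K * exp (- r * x) * t) (fun _ => 4 * K * exp (- r * x) * 1)); [lra| | |].
      - intros s _. eapply cder_eq.
        + apply cder_plus; [apply cder_mult; [apply U_0|apply V_0]|].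
          apply cder_scal, cder_RtoC, rder_id.
        + cbv beta. rewrite <- (HW s). ring.
      - intros s _. apply rder_scal, rder_id.
      - intros s Hs. rewrite !Cmod_mult, Cmod_R, Rabs_right by lra.
        destruct (Hd s ltac:(lra)) as [_ H1]. specialize (HUb s ltac:(lra)).
        assert (exp (- r * s) <= exp (- r * x)) by (apply exp_le; nra).
        assert (Cmod (V1 s) <= K * exp (- r * x)) by nra.
        assert (Cmod (U s) * Cmod (V1 s) <= 2 * (K * exp (- r * x))) by (apply Rmult_le_compat; auto using Cmod_ge_0).
        lra. }
    replace W with (((U (x + 1)%R * V (x + 1)%R + W * RtoC (x + 1)%R) - (U x * V x + W * RtoC x)) +
      (U x * V x + - (U (x + 1)%R * V (x + 1)%R)))%C by (rewrite RtoC_plus; ring).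
    eapply Rle_trans; [apply Cmod_triangle|].
    assert (H3 : Cmod (U x * V x + - (U (x + 1)%R * V (x + 1)%R))%C <= 4 * K * exp (- r * x)).
    { eapply Rle_trans; [apply Cmod_triangle|]. rewrite Cmod_opp, !Cmod_mult.
      destruct (Hd x ltac:(lra)) as [H0 _]. destruct (Hd (x + 1) ltac:(lra)) as [H1 _].
      assert (exp (- r * (x + 1)) <= exp (- r * x)) by (apply exp_le; nra).
      assert (Cmod (V (x + 1)%R) <= K * exp (- r * x)) by nra.
      assert (Cmod (U x) * Cmod (V x) <= 2 * (K * exp (- r * x))) by (apply Rmult_le_compat; auto using Cmod_ge_0; apply HUb; lra).
      assert (Cmod (U (x + 1)%R) * Cmod (V (x + 1)%R) <= 2 * (K * exp (- r * x))) by (apply Rmult_le_compat; auto using Cmod_ge_0; apply HUb; lra).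
      lra. }
    assert (8 * K * exp (- r * x) <= 8 * K * exp (- r * t)) by (apply Rmult_le_compat_l; lra).
    lra. }
  assert (Z2 : Cmod W = 0) by (apply Rle_antisym; [exact HW0|apply Cmod_ge_0]).
  apply Cmod_eq_0 in Z2.
  replace (U1 0) with (U 0 * V1 0 - (U 0 * V1 0 - U1 0 * V 0))%C by (rewrite V0; ring).
  fold W. rewrite Z2. ring.
Qed.

Lemma solves_unique P u u1 v v1 : regular P -> solves P u u1 -> solves P v v1 ->
  u 0 = v 0 -> u1 0 = v1 0 -> forall x, u x = v x.
Proof.
  intros [_ Pb] [U0 U1] [V0 V1] E0 E1 x. destruct (Pb (Rabs x)) as [M HM].
  assert (Z := ode_stability P (fun _ => RtoC 0) (fun x => u x - v x)%C (fun x => u1 x - v1 x)%C (Rabs x) M 0).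
  assert (Z' : Cmod (u x - v x)%C ^ 2 + Cmod (u1 x - v1 x)%C ^ 2 <=
    (Cmod (u 0 - v 0)%C ^ 2 + Cmod (u1 0 - v1 0)%C ^ 2 + 0 ^ 2) * exp ((M + 2) * Rabs x)).
  { apply Z; try lra; auto.
    - intros t _. now apply cder_minus.
    - intros t _. eapply cder_eq; [apply cder_minus; [apply U1|apply V1]|]. cbv beta; ring.
    - intros t _. rewrite Cmod_0; lra. }
  rewrite E0, E1 in Z'.
  replace (v 0 - v 0)%C with (RtoC 0) in Z' by ring.
  replace (v1 0 - v1 0)%C with (RtoC 0) in Z' by ring. rewrite Cmod_0 in Z'.
  assert (Hsq : Cmod (u x - v x)%C ^ 2 <= 0) by (generalize (pow2_ge_0 (Cmod (u1 x - v1 x)%C)); nra).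
  assert (Z2 : Cmod (u x - v x)%C = 0) by (generalize (Cmod_ge_0 (u x - v x)%C); nra).
  apply Cmod_eq_0 in Z2. replace (u x) with ((u x - v x) + v x)%C by ring. rewrite Z2; ring.
Qed.

Lemma helm_bound alpha theta sigma X x : 0 < alpha -> 0 <= theta <= 1 -> -1 <= sigma <= 0 -> Rabs x <= X ->
  Cmod (helm alpha theta (damped sigma) x) <= 4 * (1 + ppp X alpha) /\
  Cmod (helm alpha theta (damped sigma) x - helm alpha theta (RtoC 1) x)%C <= 3 * Rabs sigma * (1 + ppp X alpha).
Proof.
  intros Ha Hth Hs Hx. set (k := damped sigma).
  assert (E : forall k, helm alpha theta k x = (- (k * k) * RtoC (1 + theta * ppp x alpha))%C).
  { intros k'. unfold helm, pot. rewrite RtoC_plus, RtoC_mult. ring. }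
  assert (Hk := damped_sqr_diff sigma Hs). fold k in Hk.
  assert (Hp := ppp_ge_0 x alpha).
  assert (Hpm : ppp x alpha <= ppp X alpha) by (apply ppp_mono; [lra|generalize (Rle_abs x); lra]).
  assert (H0 : 0 <= theta * ppp x alpha) by (apply Rmult_le_pos; lra).
  assert (H1 : theta * ppp x alpha <= ppp X alpha) by nra.
  assert (H3 : Rabs sigma <= 1) by (apply Rabs_le; lra).
  split.
  - rewrite E, Cmod_mult, Cmod_opp, Cmod_R, Rabs_right by lra.
    assert (Cmod (k * k) <= 4).
    { replace (k * k)%C with ((k * k - RtoC 1) + RtoC 1)%C by ring.
      eapply Rle_trans; [apply Cmod_triangle|]. rewrite Cmod_1. lra. }
    apply Rmult_le_compat; auto using Cmod_ge_0; lra.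
  - rewrite !E.
    replace (- (k * k) * RtoC (1 + theta * ppp x alpha) - - (RtoC 1 * RtoC 1) * RtoC (1 + theta * ppp x alpha))%C
      with (- (k * k - RtoC 1) * RtoC (1 + theta * ppp x alpha))%C by ring.
    rewrite Cmod_mult, Cmod_opp, Cmod_R, Rabs_right by lra.
    apply Rmult_le_compat; auto using Cmod_ge_0; lra.
Qed.

(** [V - u] solves the damped equation with the difference of the potentials times [u] as source; on
    [[-X, X]] both this source and the initial slope are of order sigma. *)
Lemma helm_continuous_dependence alpha theta u u1 C0 X : 0 < alpha -> 0 <= theta <= 1 -> 0 <= X -> 0 <= C0 ->
  solves (helm alpha theta (RtoC 1)) u u1 -> exists D, 0 <= D /\
  forall sigma V V1, -1 <= sigma <= 0 -> solves (helm alpha theta (damped sigma)) V V1 ->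
  V 0 = u 0 -> Cmod (V1 0 - u1 0)%C <= C0 * Rabs sigma ->
  forall x, Rabs x <= X -> Cmod (V x - u x)%C <= D * Rabs sigma.
Proof.
  intros Ha Hth HX HC0 [U0 U1].
  set (M := 4 * (1 + ppp X alpha)).
  assert (HM : 0 <= M) by (unfold M; generalize (ppp_ge_0 X alpha); lra).
  set (Q := (Cmod (u 0) ^ 2 + Cmod (u1 0) ^ 2) * exp ((M + 2) * X)).
  assert (HQ : 0 <= Q).
  { apply Rmult_le_pos; [|left; apply exp_pos].
    generalize (pow2_ge_0 (Cmod (u 0))), (pow2_ge_0 (Cmod (u1 0))); lra. }
  assert (Hexp : forall x, Rabs x <= X -> exp ((M + 2) * Rabs x) <= exp ((M + 2) * X)).
  { intros x Hx. apply exp_le. apply Rmult_le_compat_l; lra. }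
  assert (Hu : forall x, Rabs x <= X -> Cmod (u x) <= sqrt Q).
  { intros x Hx.
    assert (Z : Cmod (u x) ^ 2 + Cmod (u1 x) ^ 2 <= (Cmod (u 0) ^ 2 + Cmod (u1 0) ^ 2 + 0 ^ 2) * exp ((M + 2) * Rabs x)).
    { apply (ode_stability (helm alpha theta (RtoC 1)) (fun _ => RtoC 0) u u1 X M 0); auto.
      - intros t _. eapply cder_eq; [apply U1|]. cbv beta; ring.
      - intros t Ht. rewrite <- damped_0. apply (helm_bound alpha theta 0 X t); lra.
      - intros t _. rewrite Cmod_0; lra. }
    apply Rsqr_incr_0_var; [|apply sqrt_pos]. rewrite Rsqr_sqrt, Rsqr_pow2 by auto.
    specialize (Hexp x Hx). unfold Q.
    generalize (pow2_ge_0 (Cmod (u 0))), (pow2_ge_0 (Cmod (u1 0))), (pow2_ge_0 (Cmod (u1 x))). intros.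
    assert ((Cmod (u 0) ^ 2 + Cmod (u1 0) ^ 2 + 0 ^ 2) * exp ((M + 2) * Rabs x) <=
      (Cmod (u 0) ^ 2 + Cmod (u1 0) ^ 2) * exp ((M + 2) * X)).
    { rewrite pow_ne_zero, Rplus_0_r by lia. apply Rmult_le_compat_l; lra. }
    lra. }
  set (e := 3 * (1 + ppp X alpha) * sqrt Q).
  set (D2 := (C0 ^ 2 + e ^ 2) * exp ((M + 2) * X)).
  assert (HD2 : 0 <= D2).
  { apply Rmult_le_pos; [|left; apply exp_pos]. generalize (pow2_ge_0 C0), (pow2_ge_0 e); lra. }
  exists (sqrt D2). split; [apply sqrt_pos|].
  intros sigma V V1 Hs [V_0 V_1] E0 E1 x Hx.
  assert (Z : Cmod (V x - u x)%C ^ 2 + Cmod (V1 x - u1 x)%C ^ 2 <=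
     (Cmod (V 0 - u 0)%C ^ 2 + Cmod (V1 0 - u1 0)%C ^ 2 + (e * Rabs sigma) ^ 2) * exp ((M + 2) * Rabs x)).
  { apply (ode_stability (helm alpha theta (damped sigma))
      (fun t => (helm alpha theta (damped sigma) t - helm alpha theta (RtoC 1) t) * u t)%C
      (fun t => V t - u t)%C (fun t => V1 t - u1 t)%C X M); auto.
    - intros t _. now apply cder_minus.
    - intros t _. eapply cder_eq; [apply cder_minus; [apply V_1|apply U1]|]. cbv beta; ring.
    - intros t Ht. now apply (helm_bound alpha theta sigma X t).
    - intros t Ht. rewrite Cmod_mult. unfold e.
      replace (3 * (1 + ppp X alpha) * sqrt Q * Rabs sigma) with (3 * Rabs sigma * (1 + ppp X alpha) * sqrt Q) by ring.
      apply Rmult_le_compat; auto using Cmod_ge_0. now apply (helm_bound alpha theta sigma X t). }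
  rewrite E0 in Z. replace (u 0 - u 0)%C with (RtoC 0) in Z by ring. rewrite Cmod_0 in Z.
  assert (Hs0 := Rabs_pos sigma).
  apply Rsqr_incr_0_var; [|apply Rmult_le_pos; [apply sqrt_pos|auto]].
  rewrite Rsqr_mult, Rsqr_sqrt, !Rsqr_pow2 by auto.
  assert (HE1 : Cmod (V1 0 - u1 0)%C ^ 2 <= (C0 * Rabs sigma) ^ 2).
  { apply pow_incr. split; [apply Cmod_ge_0|auto]. }
  assert (Hb : (0 ^ 2 + Cmod (V1 0 - u1 0)%C ^ 2 + (e * Rabs sigma) ^ 2) * exp ((M + 2) * Rabs x) <=
     ((C0 * Rabs sigma) ^ 2 + (e * Rabs sigma) ^ 2) * exp ((M + 2) * X)).
  { rewrite pow_ne_zero, Rplus_0_l by lia. apply Rmult_le_compat.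
    - generalize (pow2_ge_0 (Cmod (V1 0 - u1 0)%C)), (pow2_ge_0 (e * Rabs sigma)); lra.
    - left; apply exp_pos.
    - lra.
    - auto. }
  generalize (pow2_ge_0 (Cmod (V1 x - u1 x)%C)). intros.
  replace (D2 * Rabs sigma ^ 2) with (((C0 * Rabs sigma) ^ 2 + (e * Rabs sigma) ^ 2) * exp ((M + 2) * X)) by (unfold D2; ring).
  lra.
Qed.

(** * The reflection coefficient *)

Lemma weyl_tends_to_0 K r P v v1 : 0 < r -> weyl K r P v v1 ->
  filterlim v (Rbar_locally p_infty) (locally (RtoC 0)).
Proof.
  intros Hr (_ & _ & Hd). apply filterlim_locally. intros [eps He].
  destruct (exp_decay_small K r eps Hr He) as (M & HM & H).
  exists M. intros x Hx. specialize (H x Hx). destruct (Hd x ltac:(lra)) as [H0 _].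
  split.
  - change (Rabs (fst (v x) - 0) < eps). rewrite Rminus_0_r.
    generalize (Re_le_Cmod (v x)); unfold Re; lra.
  - change (Rabs (snd (v x) - 0) < eps). rewrite Rminus_0_r.
    generalize (Im_le_Cmod (v x)); unfold Im; lra.
Qed.

Lemma le_0_of_small (a c : R) : (forall eps, 0 < eps < 1 -> a <= eps * c) -> a <= 0.
Proof.
  intros H. apply Rnot_lt_le; intros Ha.
  assert (Hc : 0 < c) by (generalize (H (1 / 2) ltac:(lra)); lra).
  set (e := Rmin (1 / 2) (a / (2 * c))).
  assert (He : 0 < e) by (apply Rmin_glb_lt; [lra|apply Rdiv_lt_0_compat; lra]).
  assert (He1 : e <= 1 / 2) by apply Rmin_l.
  assert (He2 : e <= a / (2 * c)) by apply Rmin_r.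
  specialize (H e ltac:(lra)).
  apply Rmult_le_compat_r with (r := c) in He2; [|lra].
  replace (a / (2 * c) * c) with (a / 2) in He2 by (field; lra). lra.
Qed.

(** * Uniqueness of the outgoing solution and matching with plane waves *)

Section Outgoing.
Variables (alpha theta C0 : R) (m : C) (u u1 : R -> C).
Hypothesis Ha : 0 < alpha.
Hypothesis Hth : 0 <= theta <= 1.
Hypothesis HC0 : 0 <= C0.
Hypothesis Hu : solves (helm alpha theta (RtoC 1)) u u1.
Hypothesis U0 : u 0 = RtoC 1.
Hypothesis U1 : u1 0 = m.
Hypothesis Habs : forall sigma, -1 <= sigma < 0 -> exists K r V V1, 0 < r /\
  weyl K r (helm alpha theta (damped sigma)) V V1 /\ Cmod (V1 0 - m)%C <= C0 * Rabs sigma.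

(** The approximants are normalized decaying solutions, picked by choice for
    [sigma = - 1 / (n + 1)]. Their slopes at 0 tend to [m], and continuous dependence extends the
    convergence to compact sets. *)
Lemma canonical_outgoing : outgoing (slowness2 alpha theta) u.
Proof.
  set (sigma := fun n => - / INR (S n)).
  assert (Hs : forall n, -1 <= sigma n < 0).
  { intros n. unfold sigma. assert (H : 0 < INR (S n)) by (apply lt_0_INR; lia).
    assert (H1 : 1 <= INR (S n)) by (rewrite S_INR; generalize (pos_INR n); lra).
    assert (0 < / INR (S n)) by (apply Rinv_0_lt_compat; auto).
    assert (/ INR (S n) <= / 1) by (apply Rinv_le_contravar; lra). lra. }
  assert (Hlim : is_lim_seq sigma 0).
  { unfold sigma. replace (Finite 0) with (Rbar_opp 0) by (simpl; f_equal; ring).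
    apply -> (is_lim_seq_opp (fun n => / INR (S n)) 0).
    replace (Finite 0) with (Rbar_inv p_infty) by reflexivity.
    apply is_lim_seq_inv; [|easy]. apply -> is_lim_seq_incr_1. apply is_lim_seq_INR. }
  assert (Hex : forall n, exists V, exists K r V1, 0 < r /\
     weyl K r (helm alpha theta (damped (sigma n))) V V1 /\ Cmod (V1 0 - m)%C <= C0 * Rabs (sigma n)).
  { intros n. destruct (Habs (sigma n) (Hs n)) as (K & r & V & V1 & H). exists V, K, r, V1. exact H. }
  set (V := fun n => proj1_sig (constructive_indefinite_description _ (Hex n))).
  assert (HV : forall n, exists K r V1, 0 < r /\
     weyl K r (helm alpha theta (damped (sigma n))) (V n) V1 /\ Cmod (V1 0 - m)%C <= C0 * Rabs (sigma n)).
  { intros n. exact (proj2_sig (constructive_indefinite_description _ (Hex n))). }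
  split; [|split].
  - apply is_solution_iff. now exists u1.
  - exists 0. rewrite U0. intros H. apply (f_equal fst) in H. simpl in H. lra.
  - exists sigma, V. split; [intros n; apply (Hs n)|]. split; [exact Hlim|]. split; [|split].
    + intros n. apply is_solution_iff. destruct (HV n) as (K & r & V1 & _ & (H & _) & _). now exists V1.
    + intros Kc HK eps Heps. destruct (compact_P1 _ HK) as (lo & hi & Hb).
      set (X := Rabs lo + Rabs hi).
      assert (HX : forall x, Kc x -> Rabs x <= X).
      { intros x Hx. specialize (Hb x Hx). unfold X.
        generalize (Rabs_maj2 lo), (Rle_abs hi), (Rabs_pos lo), (Rabs_pos hi). intros.
        apply Rabs_le; lra. }
      assert (HX0 : 0 <= X) by (unfold X; generalize (Rabs_pos lo), (Rabs_pos hi); lra).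
      destruct (helm_continuous_dependence alpha theta u u1 C0 X Ha Hth HX0 HC0 Hu) as (D & HD & HDb).
      apply is_lim_seq_spec in Hlim.
      assert (He : 0 < eps / (D + 1)) by (apply Rdiv_lt_0_compat; lra).
      destruct (Hlim (mkposreal _ He)) as [N HN]. exists N. intros n Hn x Hx.
      specialize (HN n Hn). simpl in HN. rewrite Rminus_0_r in HN.
      destruct (HV n) as (K & r & V1 & _ & (Hsol & V0 & _) & HVm).
      rewrite <- U1 in HVm.
      eapply Rle_lt_trans.
      * apply (HDb (sigma n) (V n) V1); auto; [generalize (Hs n); lra|now rewrite V0, U0].
      * apply Rle_lt_trans with ((D + 1) * Rabs (sigma n)).
        { apply Rmult_le_compat_r; [apply Rabs_pos|lra]. }
        apply Rmult_lt_compat_l with (r := D + 1) in HN; [|lra].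
        replace ((D + 1) * (eps / (D + 1))) with eps in HN by (field; lra). exact HN.
    + intros n. destruct (HV n) as (K & r & V1 & Hr & Hw & _). apply (weyl_tends_to_0 _ _ _ _ _ Hr Hw).
Qed.

(** Each approximant is [U n 0] times the normalized decaying solution at [sigma n], which tends to
    [u]; the approximating sequence therefore influences only the factor. *)
Lemma outgoing_proportional (w : R -> C) : outgoing (slowness2 alpha theta) w ->
  forall x, w x = (w 0 * u x)%C.
Proof.
  intros (Hw & _ & sigma & U & Hs & Hlim & HU & Hcv & Hdec) x.
  destruct (helm_continuous_dependence alpha theta u u1 C0 (Rabs x) Ha Hth (Rabs_pos x) HC0 Hu) as (D & HD & HDb).
  assert (Z : Cmod (w x - w 0 * u x)%C <= 0).
  { apply (le_0_of_small _ (1 + (Cmod (w 0) + 1) * D + Cmod (u x))). intros eps Heps.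
    assert (H1 := Hcv (fun y => - Rabs x <= y <= Rabs x) (compact_P3 _ _) eps (proj1 Heps)).
    apply is_lim_seq_spec in Hlim. assert (H2 := Hlim (mkposreal _ (proj1 Heps))).
    destruct H1 as [N1 HN1]. destruct H2 as [N2 HN2]. set (n := (N1 + N2)%nat).
    specialize (HN1 n ltac:(unfold n; lia)). specialize (HN2 n ltac:(unfold n; lia)).
    simpl in HN2. rewrite Rminus_0_r in HN2. specialize (Hs n).
    assert (Hsn : -1 <= sigma n < 0) by (rewrite Rabs_left in HN2; lra).
    destruct (Habs (sigma n) Hsn) as (K & r & V & V1 & Hr & HV & HVm).
    destruct (proj1 (is_solution_iff _ _ _ _) (HU n)) as [Un1 HUn].
    assert (E : forall y, U n y = (U n 0 * V y)%C).
    { intros y.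
      replace (U n 0 * V y)%C with (RtoC 0 + U n 0 * V y)%C by ring.
      assert (Hzero : solves (helm alpha theta (damped (sigma n))) (fun _ => RtoC 0) (fun _ => RtoC 0)).
      { split; intros t; [apply cder_const|]. eapply cder_eq; [apply cder_const|ring]. }
      apply (solves_unique (helm alpha theta (damped (sigma n))) (U n) Un1
         (fun t => RtoC 0 + U n 0 * V t)%C (fun t => RtoC 0 + U n 0 * V1 t)%C).
      - now apply pot_regular.
      - exact HUn.
      - apply solves_lin; [exact Hzero|apply HV].
      - destruct HV as (_ & V0 & _). rewrite V0. ring.
      - rewrite (decaying_is_weyl _ _ _ _ _ _ _ Hr HV HUn (Hdec n)). ring. }
    rewrite <- U1 in HVm.
    assert (HVx : Cmod (V x - u x)%C <= D * Rabs (sigma n)).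
    { apply (HDb (sigma n) V V1); auto; [lra|apply HV|now rewrite U0, (proj1 (proj2 HV))|lra]. }
    assert (Hx1 := HN1 x ltac:(generalize (Rle_abs x), (Rabs_maj2 x); lra)).
    assert (Hx0 := HN1 0 ltac:(generalize (Rabs_pos x); lra)).
    replace (w x - w 0 * u x)%C with
      (- (U n x - w x) + (U n 0 * (V x - u x) + (U n 0 - w 0) * u x))%C.
    2: { rewrite (E x). ring. }
    eapply Rle_trans; [apply Cmod_triangle|]. rewrite Cmod_opp.
    assert (H3 := Cmod_triangle (U n 0 * (V x - u x)) ((U n 0 - w 0) * u x)).
    rewrite !Cmod_mult in H3.
    assert (HU0 : Cmod (U n 0) <= Cmod (w 0) + 1).
    { replace (U n 0) with ((U n 0 - w 0) + w 0)%C by ring.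
      eapply Rle_trans; [apply Cmod_triangle|]. lra. }
    assert (HDe : Cmod (V x - u x)%C <= D * eps).
    { eapply Rle_trans; [exact HVx|]. apply Rmult_le_compat_l; lra. }
    assert (H4 : Cmod (U n 0) * Cmod (V x - u x)%C <= (Cmod (w 0) + 1) * (D * eps)).
    { apply Rmult_le_compat; auto using Cmod_ge_0. }
    assert (H5 : Cmod (U n 0 - w 0)%C * Cmod (u x) <= eps * Cmod (u x)).
    { apply Rmult_le_compat_r; [apply Cmod_ge_0|lra]. }
    lra. }
  assert (Z2 : Cmod (w x - w 0 * u x)%C = 0) by (apply Rle_antisym; [exact Z|apply Cmod_ge_0]).
  apply Cmod_eq_0 in Z2.
  replace (w x) with ((w x - w 0 * u x) + w 0 * u x)%C by ring. rewrite Z2; ring.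
Qed.

(** The amplitudes solve [A + B = 1] and [i (A - B) = m], the values of [u] and its derivative at
    0. *)
Let A0 : C := ((RtoC 1 - Ci * m) / RtoC 2)%C.
Let B0 : C := ((RtoC 1 + Ci * m) / RtoC 2)%C.

(** On [t <= 0] the difference [h] solves [h'' = - h] with zero data at 0, and [|h|^2 + |h'|^2] is
    conserved. *)
Lemma canonical_left (x : R) : x <= 0 -> u x = (A0 * cis x + B0 * cis (- x))%C.
Proof.
  intros Hx. assert (H2 : RtoC 2 <> RtoC 0).
  { intros H; apply (f_equal fst) in H; simpl in H; lra. }
  assert (HC : (Ci * Ci)%C = RtoC (-1)) by (apply injective_projections; simpl; ring).
  set (h := fun t => (u t - (A0 * cis (1 * t) + B0 * cis (-1 * t)))%C).
  set (h1 := fun t => (u1 t - (A0 * (Ci * RtoC 1 * cis (1 * t)) + B0 * (Ci * RtoC (-1) * cis (-1 * t))))%C).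
  assert (Dh : forall t, cder h t (h1 t)).
  { intros t. apply cder_minus; [apply Hu|]. apply cder_plus; apply cder_scal, cder_cis. }
  assert (Dh1 : forall t, t <= 0 -> cder h1 t (- h t)%C).
  { intros t Ht. eapply cder_eq.
    - apply cder_minus; [apply Hu|].
      apply cder_plus; apply cder_scal, cder_scal, cder_cis.
    - unfold helm, pot. rewrite ppp_nonpos by auto. unfold h.
      transitivity (- u t - ((Ci * Ci) * (A0 * cis (1 * t)) + (Ci * Ci) * (RtoC (-1) * RtoC (-1)) * (B0 * cis (-1 * t))))%C; [ring|].
      rewrite HC. replace (RtoC (-1)) with (- RtoC 1)%C by (now rewrite <- RtoC_opp). ring. }
  assert (h0 : h 0 = RtoC 0).
  { unfold h. rewrite !Rmult_0_r, cis_0, U0. unfold A0, B0. field. }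
  assert (h10 : h1 0 = RtoC 0).
  { unfold h1. rewrite !Rmult_0_r, cis_0, U1. unfold A0, B0.
    replace (RtoC (-1)) with (- RtoC 1)%C by (now rewrite <- RtoC_opp).
    transitivity (m - (RtoC 0 - (Ci * Ci) * m))%C; [field; auto|]. rewrite HC.
    replace (RtoC (-1)) with (- RtoC 1)%C by (now rewrite <- RtoC_opp). ring. }
  assert (HE : Cmod (h x) ^ 2 + Cmod (h1 x) ^ 2 <= Cmod (h 0) ^ 2 + Cmod (h1 0) ^ 2).
  { apply (incr_of_deriv (fun t => Cmod (h t) ^ 2 + Cmod (h1 t) ^ 2)
      (fun t => 2 * Re (Cconj (h t) * h1 t) + 2 * Re (Cconj (h1 t) * - h t))); [auto| |].
    - intros t Ht. apply rder_plus; apply cder_Cmod2; auto. apply Dh1; lra.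
    - intros t Ht. right. unfold Re; simpl; ring. }
  rewrite h0, h10, Cmod_0 in HE.
  assert (Z2 : Cmod (h x) = 0).
  { generalize (Cmod_ge_0 (h x)), (pow2_ge_0 (Cmod (h1 x))); nra. }
  apply Cmod_eq_0 in Z2.
  transitivity (h x + (A0 * cis (1 * x) + B0 * cis (-1 * x)))%C; [unfold h; ring|].
  rewrite Z2. replace (1 * x) with x by ring. replace (-1 * x) with (- x) by ring. ring.
Qed.

Lemma plane_waves_independent (a b : C) :
  (forall x, x < 0 -> (a * cis x + b * cis (- x))%C = RtoC 0) -> a = RtoC 0 /\ b = RtoC 0.
Proof.
  intros H. assert (HPI := PI_RGT_0).
  (* These two points give [a + b = 0] and [a - b = 0]. *)
  assert (H1 := H (- PI) ltac:(lra)). assert (H2 := H (- (PI / 2)) ltac:(lra)).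
  rewrite Ropp_involutive in H1, H2. unfold cis in H1, H2.
  rewrite cos_neg, sin_neg, cos_PI, sin_PI in H1. rewrite cos_neg, sin_neg, cos_PI2, sin_PI2 in H2.
  destruct a as [a1 a2], b as [b1 b2].
  injection H1 as H1 H1'. injection H2 as H2 H2'. simpl in *.
  split; apply injective_projections; simpl; lra.
Qed.

(** The hypothesis says that the incident amplitude [B0] is nonzero. Proportionality to [u] and
    independence of plane waves make the ratio unique, so [iota] returns it. *)
Lemma reflection_formula : (RtoC 1 + Ci * m)%C <> RtoC 0 ->
  reflection alpha theta = ((RtoC 1 - Ci * m) / (RtoC 1 + Ci * m))%C.
Proof.
  intros Hm. assert (H2 : RtoC 2 <> RtoC 0).
  { intros H; apply (f_equal fst) in H; simpl in H; lra. }
  assert (HB : B0 <> RtoC 0).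
  { unfold B0. intros H. apply Hm. replace (RtoC 1 + Ci * m)%C with ((RtoC 1 + Ci * m) / RtoC 2 * RtoC 2)%C by (field; auto).
    rewrite H. ring. }
  assert (HAB : (A0 / B0)%C = ((RtoC 1 - Ci * m) / (RtoC 1 + Ci * m))%C) by (unfold A0, B0; field; auto).
  rewrite <- HAB.
  assert (Huniq : forall r, is_reflection alpha theta r -> r = (A0 / B0)%C).
  { intros r (w & A & B & Hw & Hl & HBn & ->).
    assert (Hprop := outgoing_proportional w Hw).
    destruct (plane_waves_independent (A - w 0 * A0) (B - w 0 * B0)) as [EA EB].
    { intros x Hx. specialize (Hl x Hx). rewrite Hprop, canonical_left in Hl by lra.
      transitivity ((A * cis x + B * cis (- x)) - w 0 * (A0 * cis x + B0 * cis (- x)))%C; [ring|].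
      rewrite <- Hl. ring. }
    assert (EA' : A = (w 0 * A0)%C) by (replace A with ((A - w 0 * A0) + w 0 * A0)%C by ring; rewrite EA; ring).
    assert (EB' : B = (w 0 * B0)%C) by (replace B with ((B - w 0 * B0) + w 0 * B0)%C by ring; rewrite EB; ring).
    assert (Hw0 : w 0 <> RtoC 0).
    { intros H. apply HBn. rewrite EB', H. ring. }
    rewrite EA', EB'. field. auto. }
  apply Huniq. unfold reflection.
  apply (iota_correct (V := C_R_CompleteNormedModule) (is_reflection alpha theta)).
  exists (A0 / B0)%C. split.
  - exists u, A0, B0. split; [apply canonical_outgoing|]. split; [|split; auto].
    intros x Hx. apply canonical_left; lra.
  - intros r Hr. symmetry. now apply Huniq.
Qed.
End Outgoing.

(** * First-order expansion of the reflection coefficient *)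

Lemma Ci_sqr : (Ci * Ci)%C = (- RtoC 1)%C.
Proof. apply injective_projections; simpl; ring. Qed.

Lemma cis_PI : cis PI = (- RtoC 1)%C.
Proof. unfold cis. rewrite cos_PI, sin_PI. apply injective_projections; simpl; ring. Qed.

Lemma cis_PI2 : cis (PI / 2) = Ci.
Proof. unfold cis. rewrite cos_PI2, sin_PI2. reflexivity. Qed.

(** At [phi0] without damping the coefficients are the square of [cis tau], with
    [tau = PI / 2 - phi0], and [i * theta], as required by [born]. The multiplier
    [cis (phi0 - PI / 2)] has coercivity constant [sin phi0]. The slope [m] is obtained by turning
    back with [cis phi0]. *)
Lemma born_rotated alpha : 0 < alpha -> exists C1, 0 <= C1 /\ forall theta, 0 <= theta <= 1 ->
  exists (m : C) (C0 : R), 0 <= C0 /\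
  (forall sigma, -1 <= sigma < 0 -> exists K r V V1, 0 < r /\
    weyl K r (helm alpha theta (damped sigma)) V V1 /\ Cmod (V1 0 - m)%C <= C0 * Rabs sigma) /\
  Cmod (m + Ci - RtoC (theta * (Gamma (alpha + 1) / Rpower 2 (alpha + 1))) * cis (- (alpha + 1) * (PI / 2)))%C
    <= C1 * theta ^ 2.
Proof.
  intros Ha. destruct (phi0_spec alpha Ha) as [Hphi Heq].
  destruct (limiting_absorption alpha Ha) as [K HK].
  set (phi := phi0 alpha) in *. set (tau := PI / 2 - phi).
  assert (Htau : 0 <= tau < PI / 2) by (unfold tau; lra).
  destruct (gamma_rotated alpha tau Ha Htau) as (cJ & HcJ & HJ).
  set (G := Gamma (alpha + 1) / Rpower 2 (alpha + 1)) in *.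
  assert (Hs : 0 < sin phi) by (apply sin_gt_0; lra).
  assert (Hcos : 0 < cos tau) by (apply cos_gt_0; lra).
  set (b := cis (PI / 2)).
  assert (Hre : forall t, Re (cis t) = cos t) by reflexivity.
  destruct (born alpha tau (sin phi) (sin phi / 2) K (cis (phi - PI / 2)) b Ha Hcos ltac:(lra) Hs)
    with (J := (cis (- (alpha + 1) * tau) * RtoC G)%C) (cJ := cJ) (rJ := cos tau) as [C1 HC1].
  - rewrite Cmod_cis; lra.
  - right. rewrite Hre, <- cos_neg, <- cos_shift. f_equal. ring.
  - right. rewrite <- !cis_plus, Hre, <- cos_shift. f_equal. unfold tau. field.
  - unfold b. rewrite <- cis_plus, Hre. apply cos_ge_0; lra.
  - exact Hcos.
  - intros F F0 DF x Hx. apply HJ; auto.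
  - exists (Rabs C1). split; [apply Rabs_pos|]. intros theta Hth.
    destruct (HK theta Hth) as (y & y1 & Hy & C0 & HC0).
    exists (cis phi * y1 0)%C, (Rabs C0). split; [apply Rabs_pos|]. split.
    + intros sigma Hsig. destruct (HC0 sigma Hsig) as (K' & r' & V & V1 & Hr' & HV & HVm).
      exists K', r', V, V1. split; [auto|split; [auto|]].
      eapply Rle_trans; [exact HVm|]. apply Rmult_le_compat_r; [apply Rabs_pos|apply Rle_abs].
    + assert (Hpot : rot alpha theta (RtoC 1) phi = pot alpha (cis tau * cis tau) (RtoC theta * b)).
      { unfold rot, b. f_equal.
        - rewrite <- cis_plus. replace (tau + tau) with (PI + - (2) * phi) by (unfold tau; field).
          rewrite cis_plus, cis_PI. ring.
        - replace (PI / 2) with (PI + - (alpha + 2) * phi) by lra.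
          rewrite cis_plus, cis_PI. ring. }
      rewrite Hpot in Hy. specialize (HC1 theta y y1 (proj1 Hth) Hy).
      replace (cis phi * y1 0 + Ci - RtoC (theta * G) * cis (- (alpha + 1) * (PI / 2)))%C with
        (cis phi * (y1 0 + cis tau + RtoC theta * b * (cis (- (alpha + 1) * tau) * RtoC G)))%C.
      * rewrite Cmod_mult, Cmod_cis, Rmult_1_l. eapply Rle_trans; [exact HC1|].
        apply Rmult_le_compat_r; [apply pow2_ge_0|apply Rle_abs].
      * assert (E1 : (cis phi * cis tau)%C = Ci).
        { rewrite <- cis_plus, <- cis_PI2. f_equal. unfold tau. ring. }
        assert (E2 : (cis phi * b * cis (- (alpha + 1) * tau))%C = (- cis (- (alpha + 1) * (PI / 2)))%C).
        { unfold b. rewrite <- !cis_plus.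
          (* The phases containing [phi] add up to [(alpha + 2) * phi = PI / 2], so the rotation
             angle drops out of the result. *)
          replace (phi + PI / 2 + - (alpha + 1) * tau) with (PI + - (alpha + 1) * (PI / 2)).
          - rewrite cis_plus, cis_PI. ring.
          - unfold tau.
            replace (phi + PI / 2 + - (alpha + 1) * (PI / 2 - phi)) with
              ((alpha + 2) * phi + PI / 2 - (alpha + 1) * (PI / 2)) by ring.
            rewrite Heq. field. }
        rewrite RtoC_mult.
        transitivity (cis phi * y1 0 + cis phi * cis tau +
          RtoC theta * RtoC G * (cis phi * b * cis (- (alpha + 1) * tau)))%C; [ring|].
        rewrite E1, E2. ring.
Qed.

(** [mu = m + i] is the deviation from the slope at [theta = 0], and [R = - i mu / (2 + i mu)]. The
    bound on [mu] keeps the denominator at least 1 in modulus; [e] stands for the part of [mu]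
    beyond first order in theta. *)
Lemma reflection_expansion (mu e : C) : Cmod mu <= 1 ->
  Cmod ((RtoC 1 - Ci * (mu - Ci)) / (RtoC 1 + Ci * (mu - Ci)) - - (Ci / RtoC 2) * (mu - e))%C
    <= Cmod mu ^ 2 + Cmod e.
Proof.
  intros Hmu.
  assert (H2 : RtoC 2 <> RtoC 0) by (intros H; apply (f_equal fst) in H; simpl in H; lra).
  assert (HD : 1 <= Cmod (RtoC 2 + Ci * mu)%C).
  { generalize (Cmod_triangle (RtoC 2 + Ci * mu) (- (Ci * mu))).
    replace (RtoC 2 + Ci * mu + - (Ci * mu))%C with (RtoC 2) by ring.
    rewrite Cmod_opp, Cmod_mult, Cmod_Ci, Cmod_R, Rabs_right by lra. lra. }
  assert (HD0 : (RtoC 2 + Ci * mu)%C <> RtoC 0) by (intros H; rewrite H, Cmod_0 in HD; lra).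
  assert (E1 : (RtoC 1 - Ci * (mu - Ci))%C = (- (Ci * mu))%C).
  { transitivity (RtoC 1 + Ci * Ci - Ci * mu)%C; [ring|]. rewrite Ci_sqr. ring. }
  assert (E2 : (RtoC 1 + Ci * (mu - Ci))%C = (RtoC 2 + Ci * mu)%C).
  { transitivity (RtoC 1 - Ci * Ci + Ci * mu)%C; [ring|]. rewrite Ci_sqr.
    replace (RtoC 2) with (RtoC 1 + RtoC 1)%C by (rewrite <- RtoC_plus; f_equal; ring). ring. }
  rewrite E1, E2.
  replace (- (Ci * mu) / (RtoC 2 + Ci * mu) - - (Ci / RtoC 2) * (mu - e))%C with
    ((Ci * Ci) * (mu * mu) / (RtoC 2 * (RtoC 2 + Ci * mu)) + - (Ci / RtoC 2 * e))%C by (field; auto).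
  eapply Rle_trans; [apply Cmod_triangle|]. rewrite Cmod_opp.
  unfold Cdiv. rewrite !Cmod_mult, !Cmod_inv, Cmod_mult, !Cmod_Ci, Cmod_R, Rabs_right
    by (try lra; auto; apply Cmult_neq_0; auto).
  set (D := Cmod (RtoC 2 + Ci * mu)%C) in *.
  assert (Hmu0 := Cmod_ge_0 mu). assert (He0 := Cmod_ge_0 e).
  assert (Hi : / (2 * D) <= 1).
  { rewrite <- Rinv_1. apply Rinv_le_contravar; lra. }
  assert (Hi0 : 0 < / (2 * D)) by (apply Rinv_0_lt_compat; lra).
  assert (1 * 1 * (Cmod mu * Cmod mu) * / (2 * D) <= Cmod mu ^ 2).
  { replace (1 * 1 * (Cmod mu * Cmod mu) * / (2 * D)) with (Cmod mu ^ 2 * / (2 * D)) by ring.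
    rewrite <- (Rmult_1_r (Cmod mu ^ 2)) at 2. apply Rmult_le_compat_l; [apply pow2_ge_0|auto]. }
  lra.
Qed.

Lemma Rpower_le_exponent (x p q : R) : 0 < x <= 1 -> p <= q -> Rpower x q <= Rpower x p.
Proof.
  intros Hx Hpq. unfold Rpower. apply exp_le.
  assert (ln x <= 0) by (rewrite <- ln_1; apply ln_le; lra). nra.
Qed.

Theorem theorem1p1 :
  forall alpha : R, 0 < alpha ->
  exists K : R,
    at_right 0 (fun theta : R =>
      Cmod (reflection alpha theta
            - RtoC (Gamma (alpha + 1)) / pow_2i (alpha + 2) * RtoC theta)%C
      <= K * Rpower theta (1 + Rmin (1 / alpha) 1)).
Proof.
  intros alpha Ha. destruct (born_rotated alpha Ha) as (C1 & HC1 & Hborn).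
  set (G := Gamma (alpha + 1) / Rpower 2 (alpha + 1)) in *.
  (* [M * theta] will bound [|mu|], so [theta < / M] gives both [|mu| <= 1] and [theta <= 1]. *)
  set (M := Rabs G + C1 + 1).
  assert (HM : 1 <= M) by (unfold M; generalize (Rabs_pos G); lra).
  exists (M ^ 2 + C1).
  assert (HM0 : 0 < / M) by (apply Rinv_0_lt_compat; lra).
  exists (mkposreal _ HM0). intros theta Hball Hth0.
  change (Rabs (theta - 0) < / M) in Hball. rewrite Rminus_0_r, Rabs_right in Hball by lra.
  assert (HMth : M * theta <= 1).
  { apply Rmult_lt_compat_l with (r := M) in Hball; [|lra]. rewrite Rinv_r in Hball; lra. }
  assert (Hth1 : theta <= 1) by nra.
  destruct (Hborn theta ltac:(lra)) as (m & C0 & HC0 & Habs & Hm).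
  set (e := (m + Ci - RtoC (theta * G) * cis (- (alpha + 1) * (PI / 2)))%C) in *.
  set (mu := (m + Ci)%C).
  assert (Hmu : Cmod mu <= M * theta).
  { replace mu with (e + RtoC (theta * G) * cis (- (alpha + 1) * (PI / 2)))%C by (unfold mu, e; ring).
    eapply Rle_trans; [apply Cmod_triangle|].
    rewrite Cmod_mult, Cmod_cis, Cmod_R, Rabs_mult, (Rabs_right theta), Rmult_1_r by lra.
    unfold M. assert (C1 * theta ^ 2 <= C1 * theta) by (apply Rmult_le_compat_l; nra).
    generalize (Rabs_pos G). nra. }
  assert (Hm' : m = (mu - Ci)%C) by (unfold mu; ring).
  destruct (ode_exists (helm alpha theta (RtoC 1)) (RtoC 1) m) as (u & u1 & Hu & U0 & U1);
    [apply pot_regular, Ha|apply pot_regular, Ha|].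
  assert (Hne : (RtoC 1 + Ci * m)%C <> RtoC 0).
  { rewrite Hm'. intros H.
    assert (Z : (RtoC 2)%C = (- (Ci * mu))%C).
    { transitivity (RtoC 1 + Ci * (mu - Ci) - Ci * mu + (RtoC 1 + Ci * Ci))%C.
      - replace (RtoC 2) with (RtoC 1 + RtoC 1)%C by (rewrite <- RtoC_plus; f_equal; ring). ring.
      - rewrite H, Ci_sqr. ring. }
    apply (f_equal Cmod) in Z. rewrite Cmod_opp, Cmod_mult, Cmod_Ci, Cmod_R, Rabs_right in Z by lra. lra. }
  rewrite (reflection_formula alpha theta C0 m u u1 Ha ltac:(lra) HC0 Hu U0 U1 Habs Hne).
  (* The factor [- i / 2] is [1 / (2 i)], which turns [1 / (2 i)^(alpha + 1)] into
     [1 / (2 i)^(alpha + 2)]. *)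
  assert (ET : (RtoC (Gamma (alpha + 1)) / pow_2i (alpha + 2) * RtoC theta)%C = (- (Ci / RtoC 2) * (mu - e))%C).
  { assert (H2 : RtoC 2 <> RtoC 0) by (intros H; apply (f_equal fst) in H; simpl in H; lra).
    assert (HP : RtoC (Rpower 2 (alpha + 1)) <> RtoC 0).
    { intros H. apply (f_equal fst) in H. simpl in H. generalize (exp_pos ((alpha + 1) * ln 2)). unfold Rpower in H. lra. }
    assert (Hc := cis_neq_0 (PI * (alpha + 2) / 2)).
    replace (mu - e)%C with (RtoC (theta * G) * cis (- (alpha + 1) * (PI / 2)))%C by (unfold mu, e; ring).
    assert (Ecis : (- Ci * cis (- (alpha + 1) * (PI / 2)) * cis (PI * (alpha + 2) / 2))%C = RtoC 1).
    { rewrite <- Cmult_assoc, <- cis_plus.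
      replace (- (alpha + 1) * (PI / 2) + PI * (alpha + 2) / 2) with (PI / 2) by field.
      rewrite cis_PI2. transitivity (- (Ci * Ci))%C; [ring|]. rewrite Ci_sqr. ring. }
    assert (Einv : (- Ci * cis (- (alpha + 1) * (PI / 2)))%C = (/ cis (PI * (alpha + 2) / 2))%C).
    { transitivity ((- Ci * cis (- (alpha + 1) * (PI / 2)) * cis (PI * (alpha + 2) / 2)) / cis (PI * (alpha + 2) / 2))%C.
      - field. auto.
      - rewrite Ecis. field. auto. }
    assert (EP : Rpower 2 (alpha + 2) = Rpower 2 (alpha + 1) * 2).
    { replace (alpha + 2) with (alpha + 1 + 1) by ring. rewrite Rpower_plus, Rpower_1 by lra. reflexivity. }
    unfold pow_2i. rewrite EP, RtoC_mult.
    transitivity (/ RtoC 2 * RtoC (theta * G) * (- Ci * cis (- (alpha + 1) * (PI / 2))))%C; [|field; auto].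
    rewrite Einv. unfold G. rewrite RtoC_mult, RtoC_div.
    - field. auto.
    - intros H. apply HP. now rewrite H. }
  rewrite ET, Hm'.
  eapply Rle_trans; [apply reflection_expansion; lra|].
  (* The error obtained is quadratic; the exponent on the right is at most 2 and [theta <= 1]. *)
  assert (Hp2 : theta ^ 2 <= Rpower theta (1 + Rmin (1 / alpha) 1)).
  { rewrite <- (Rpower_pow 2 theta Hth0). apply Rpower_le_exponent; [lra|].
    generalize (Rmin_r (1 / alpha) 1). simpl. lra. }
  assert (Hmu2 : Cmod mu ^ 2 <= M ^ 2 * theta ^ 2).
  { rewrite <- Rpow_mult_distr. apply pow_incr. split; [apply Cmod_ge_0|auto]. }
  apply Rle_trans with ((M ^ 2 + C1) * theta ^ 2); [lra|].
  apply Rmult_le_compat_l; [generalize (pow2_ge_0 M); lra|auto].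
Qed.
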